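(* Let $M$ be a closed oriented surface and $C=\{c_1,\dots,c_n\}\subset M$ a finite set of distinct points. Flat cone metrics on $M$ with cone points in $C$, cone angles in $(\pi/2)\mathbb{Z}$ and rotational holonomy in $\mathbb{Z}_4$ are the same thing as pairs $(X,q)$ with $X$ a Riemann surface homeomorphic to $M$ and $q$ a meromorphic section of $K_X^{4}$ with $\operatorname{div}(q)=\sum_i m_ic_i$, $m_i>-4$. That is: every such metric is of the form $|q|^{1/2}$ for such a pair $(X,q)$ (with $X$ the surface $M$ endowed with a complex structure), and conversely for every such pair $|q|^{1/2}$ is such a metric. Under this correspondence the metric is $|q|^{1/2}$, the cone angle at $c_i$ is $(m_i+4)\pi/2$, and the rotational holonomy is the monodromy of the local fourth roots of $q$.
   Context: $\mathbb{Z}_4=\mathbb{Z}/4\mathbb{Z}$ is identified with the group $\mu_4$ of quarter turns (fourth roots of unity), $1$ being rotation by $\pi/2$. A flat cone metric on $M$ is a flat metric on $M\setminus C$ with conical singularities at the points of $C$ (cone angle $2\pi$, i.e. $m_i=0$, being a smooth marked point). Its rotational holonomy is the homomorphism on $H_1(M\setminus C;\mathbb{Z})$ giving the rotation part of the composite of the transition maps $z\mapsto uz+t$, $|u|=1$, of developing charts along a loop; it lies in $\mathbb{Z}_4$ if all these rotations are by multiples of $\pi/2$. $K_X$ is the canonical bundle. If $q=f(w)(dw)^4$ in a local coordinate $w$, then $|q|^{1/2}$ denotes the metric $|f(w)|^{1/2}|dw|^2$. The monodromy of the local fourth roots is the homomorphism sending $\gamma$ to the fourth root of unity by which a local fourth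 root of $q$ is multiplied when continued along $\gamma$. *)

(* Defs.v *)
From HB Require Import structures.
From mathcomp Require Import all_boot all_order all_algebra.
From mathcomp Require Import all_classical all_reals all_analysis.
From mathcomp Require Export complex.
Set Implicit Arguments.
Unset Strict Implicit.
Unset Printing Implicit Defensive.
Import Order.TTheory GRing.Theory Num.Theory.
Import numFieldNormedType.Exports.
Local Open Scope classical_set_scope.
Local Open Scope complex_scope.
Local Open Scope ring_scope.

(* The usual topology of the complex numbers: the one of [R[i]] as a
   numFieldType.  Derivatives of functions [R[i] -> R[i]] are thus complex
   derivatives. *)
HB.instance Definition _ (R : realType) := NormedModule.copy R[i] R[i]^o.

Section PlaneCalculus.
Context {R : realType}.
Implicit Types (u : R[i] -> R) (f : R[i] -> R[i]) (U : set R[i]) (z v : R[i]).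

Definition sqmod z : R := complex.Re z ^+ 2 + complex.Im z ^+ 2.

Definition expi (a : R) : R[i] := cos a +i* sin a.

Definition holomorphic_at f z := \forall w \near z, derivable f w 1.

(* Real differential calculus is carried out along real lines: [along u z v]
   is t |-> u (z + t v). *)
Definition along u z v : R -> R := fun t => u (z + t%:C * v).

Definition partial u v : R[i] -> R := fun z => derive1 (along u z v) 0.

Definition differential f z v : R[i] :=
  partial (@complex.Re R \o f) v z +i* partial (@complex.Im R \o f) v z.

Definition jacobian_det f z : R :=
  complex.Re (differential f z 1) * complex.Im (differential f z 'i%C)
  - complex.Im (differential f z 1) * complex.Re (differential f z 'i%C).

Fixpoint Ck (n : nat) U u : Prop :=
  (forall z, U z -> {for z, continuous u}) /\
  if n is n'.+1 then
    forall v, v = 1 \/ v = 'i%C ->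
      (forall z, U z -> derivable (along u z v) 0 1) /\ Ck n' U (partial u v)
  else True.

Definition smooth U u := forall n, Ck n U u.

Definition smooth_map U f :=
  smooth U (@complex.Re R \o f) /\ smooth U (@complex.Im R \o f).

(* Local degree +1: the image under f of every small positively oriented
   circle about z winds exactly once around f z. *)
Definition orientation_preserving_at f z :=
  exists2 e : R, 0 < e & forall r : R, 0 < r < e ->
    exists rho a : R -> R,
      [/\ continuous a, a (2 * pi) = a 0 + 2 * pi &
       forall t, 0 <= t <= 2 * pi ->
         0 < rho t /\
         f (z + r%:C * expi t) - f z = (rho t)%:C * expi (a t)].

End PlaneCalculus.

Section Charts.
Context {R : realType} {M : topologicalType}.

(* [coord] matters on [dom] only, and [icoord] on the image of [dom]. *)
Record chart := Chart {
  dom : set M ;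
  coord :> M -> R[i] ;
  icoord : R[i] -> M }.

Implicit Types (S : set M) (A : set chart) (phi psi w : chart).

Definition is_chart phi :=
  [/\ open (dom phi), open (phi @` dom phi),
      forall x, dom phi x -> icoord phi (phi x) = x,
      forall x, dom phi x -> {for x, continuous phi} &
      forall x, dom phi x -> {for phi x, continuous (icoord phi)}].

Definition transition phi psi : R[i] -> R[i] := psi \o icoord phi.

Definition is_atlas S (compatible : chart -> chart -> Prop) A :=
  [/\ forall phi, A phi -> is_chart phi,
      forall x, S x -> exists2 phi, A phi & dom phi x &
      forall phi psi, A phi -> A psi -> compatible phi psi].

(* In the next two definitions only the parts of the charts lying over the
   open set S are compared. *)
Definition oriented_compat S phi psi :=
  forall x, (dom phi `&` dom psi `&` S) x ->
    orientation_preserving_at (transition phi psi) (phi x).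

Definition smooth_compat S phi psi :=
  let D := dom phi `&` dom psi `&` S in
  [/\ smooth_map (phi @` D) (transition phi psi),
      smooth_map (psi @` D) (transition psi phi) &
      forall x, D x -> 0 < jacobian_det (transition phi psi) (phi x)].

Definition holomorphic_compat phi psi :=
  forall x, (dom phi `&` dom psi) x ->
    holomorphic_at (transition phi psi) (phi x).

(* A closed (compact, connected, Hausdorff) topological surface, oriented by an
   atlas O whose transition maps preserve the orientation of the plane. *)
Definition closed_oriented_surface (O : set chart) :=
  [/\ hausdorff_space M, compact [set: M], connected [set: M], [set: M] !=set0 &
      is_atlas setT (oriented_compat setT) O].

(* X makes the surface (M, O) a Riemann surface inducing the orientation O. *)
Definition complex_structure (O X : set chart) :=
  is_atlas setT holomorphic_compat X /\
  forall o w, O o -> X w -> oriented_compat setT o w.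

(* Riemannian metrics on S: a smooth atlas together with the coefficients of
   the first fundamental form E dx^2 + 2 F dx dy + G dy^2 in each chart.  The
   charts may stick out of S; nothing is required outside S. *)
Record metric := Metric {
  mcharts : set chart ;
  coefE : chart -> M -> R ;
  coefF : chart -> M -> R ;
  coefG : chart -> M -> R }.

Implicit Types g : metric.

(* Squared length of the tangent vector at x with coordinates v in phi. *)
Definition sqlen g phi (x : M) (v : R[i]) : R :=
  coefE g phi x * complex.Re v ^+ 2
  + 2 * coefF g phi x * complex.Re v * complex.Im v
  + coefG g phi x * complex.Im v ^+ 2.

(* In the coordinate w, a smooth coordinate on S, squared lengths for g at x
   are given by N x. *)
Definition metric_in_coordinate S g w (N : M -> R[i] -> R) :=
  forall phi, mcharts g phi ->
    smooth_compat S phi w /\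
    forall x v, (dom phi `&` dom w `&` S) x ->
      sqlen g phi x v = N x (differential (transition phi w) (phi x) v).

Definition riemannian_metric (O : set chart) S g :=
  [/\ is_atlas S (smooth_compat S) (mcharts g),
      forall o phi, O o -> mcharts g phi -> oriented_compat S o phi,
      forall phi, mcharts g phi ->
        [/\ smooth (phi @` (dom phi `&` S)) (coefE g phi \o icoord phi),
            smooth (phi @` (dom phi `&` S)) (coefF g phi \o icoord phi) &
            smooth (phi @` (dom phi `&` S)) (coefG g phi \o icoord phi)],
      forall phi x, mcharts g phi -> (dom phi `&` S) x ->
        0 < coefE g phi x /\
        coefF g phi x ^+ 2 < coefE g phi x * coefG g phi x &
      forall psi, mcharts g psi -> metric_in_coordinate S g psi (sqlen g psi)].

(* g and g' are the same metric, possibly presented by different atlases of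
   the same smooth structure on S. *)
Definition same_metric S g g' :=
  forall psi, mcharts g' psi -> metric_in_coordinate S g psi (sqlen g' psi).

(* Developing charts: orientation preserving isometries from an open subset of
   S onto an open subset of the Euclidean plane. *)
Definition developing_chart S g z :=
  [/\ is_chart z, dom z `<=` S &
      metric_in_coordinate S g z (fun _ v => sqmod v)].

Definition flat_metric (O : set chart) S g :=
  riemannian_metric O S g /\
  forall x, S x -> exists2 z, developing_chart S g z & dom z x.

(* Squared length of the tangent vector v at z = r e^(ia) for the metric
   dr^2 + (theta / 2 pi)^2 r^2 da^2 of the cone of total angle theta; here
   dr(v) = Re (v conj(z)) / r and r da(v) = Im (v conj(z)) / r. *)
Definition cone_sqlen (theta : R) (z v : R[i]) : R :=
  (complex.Re (v * conjc z) ^+ 2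
   + (theta / (2 * pi)) ^+ 2 * complex.Im (v * conjc z) ^+ 2) / sqmod z.

(* A neighbourhood of p is isometric, off p, to a neighbourhood of the apex in
   the cone of total angle theta. *)
Definition conical_singularity S g p (theta : R) :=
  0 < theta /\
  exists w, [/\ is_chart w, dom w p, w p = 0, dom w `\ p `<=` S &
    metric_in_coordinate S g w (fun x v => cone_sqlen theta (w x) v)].

Definition flat_cone_metric (O : set chart) n (c : 'I_n -> M) g
    (theta : 'I_n -> R) :=
  flat_metric O (~` range c) g /\
  forall i, conical_singularity (~` range c) g (c i) (theta i).

End Charts.
Arguments chart : clear implicits.
Arguments metric : clear implicits.

Section Homology.
Context {R : realType} {M : topologicalType}.
Implicit Types (S : set M) (p : R -> M) (sigma : R * R -> M)
  (c : (R -> M) -> int).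

Definition clamp (t : R) : R := Num.max 0 (Num.min t 1).

(* Paths on [0, 1] are represented by functions on R that are constant on each
   side of [0, 1], so that a path has only one representative. *)
Definition simplex1 S p :=
  [/\ continuous p, forall t, p t = p (clamp t) & range p `<=` S].

Definition loop S p := simplex1 S p /\ p 0 = p 1.

Definition simplex2 S sigma :=
  let D := [set x : R * R | [/\ 0 <= x.1, 0 <= x.2 & x.1 + x.2 <= 1]] in
  {within D, continuous sigma} /\ sigma @` D `<=` S.

Definition single p : (R -> M) -> int := fun p' => (p' == p)%:R.

Definition boundary2 sigma : (R -> M) -> int :=
  single (fun t => sigma (1 - clamp t, clamp t))
  - single (fun t => sigma (0, clamp t))
  + single (fun t => sigma (clamp t, 0)).

(* Singular 1-cycles of S with integer coefficients: finitely supported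
   integer functions on the singular 1-simplices, with zero boundary. *)
Definition cycle1 S c :=
  [/\ finite_set [set p | c p != 0],
      forall p, c p != 0 -> simplex1 S p &
      forall x : M,
        \sum_(p \in [set: R -> M]) c p * ((p 1 == x)%:R - (p 0 == x)%:R) = 0].

(* Homomorphisms from H_1(S; Z) to the multiplicative group of the complex
   numbers, as functions on cycles that are trivial on boundaries.  Values
   outside [cycle1 S] are irrelevant. *)
Definition H1_character S (chi : ((R -> M) -> int) -> R[i]) :=
  (forall a b, cycle1 S a -> cycle1 S b -> chi (a + b) = chi a * chi b) /\
  (forall sigma, simplex2 S sigma -> chi (boundary2 sigma) = 1).

(* The group Z_4 of quarter turns is the group of fourth roots of unity. *)
Definition valued_in_mu4 S (chi : ((R -> M) -> int) -> R[i]) :=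
  forall a, cycle1 S a -> chi a ^+ 4 = 1.

(* gamma is cut into N + 1 pieces, the j-th one being gamma on
   [t j, t (j + 1)]. *)
Definition subdivision (N : nat) (t : nat -> R) :=
  [/\ t 0%N = 0, t N.+1 = 1 & forall j, (j <= N)%N -> t j <= t j.+1].

End Homology.

Section Holonomy.
Context {R : realType} {M : topologicalType}.
Implicit Types (S : set M) (g : metric R M) (gamma : R -> M).

(* The loop gamma is covered by developing charts z 0, ..., z N, z (N+1) = z 0,
   the transition from z (j+1) to z j near gamma (t (j+1)) is zeta |-> u j zeta
   + b, and rot is the rotation part of the composite of these transitions;
   so z 0, continued along gamma, becomes rot z 0 + const. *)
Definition rotation_along S g gamma (rot : R[i]) :=
  exists (N : nat) (t : nat -> R) (z : nat -> chart R M) (u : nat -> R[i]),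
    [/\ subdivision N t,
        forall j, (j <= N)%N -> developing_chart S g (z j) /\
          forall s, t j <= s <= t j.+1 -> dom (z j) (gamma s),
        z N.+1 = z 0%N,
        forall j, (j <= N)%N -> `|u j| = 1 /\
          exists b, \forall y \near gamma (t j.+1),
            z j y = u j * z j.+1 y + b &
        rot = \prod_(j < N.+1) u j].

Definition rotational_holonomy S g chi :=
  H1_character S chi /\
  forall gamma, loop S gamma -> rotation_along S g gamma (chi (single gamma)).

Definition quarter_flat_cone_metric (O : set (chart R M)) n (c : 'I_n -> M) g
    (theta : 'I_n -> R) :=
  [/\ flat_cone_metric O c g theta,
      forall i, exists k : int, theta i = k%:~R * (pi / 2) &
      exists2 chi, rotational_holonomy (~` range c) g chi &
        valued_in_mu4 (~` range c) chi].

End Holonomy.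

Section Differentials.
Context {R : realType} {M : topologicalType}.
Implicit Types (S V : set M) (X : set (chart R M)) (gamma : R -> M)
  (q h : chart R M -> M -> R[i]).

(* Over V, the functions [q w], for w in the complex atlas X, are the
   coefficients of a section of the k-th power of the canonical bundle: the
   expressions q w (dw)^k agree. *)
Definition differential_law (k : nat) X V q :=
  forall w w' x, X w -> X w' -> (dom w `&` dom w' `&` V) x ->
    q w x = q w' x * derive1 (transition w w') (w x) ^+ k.

(* q is a meromorphic section of the k-th power of the canonical bundle, with
   divisor D.  By convention a coefficient takes the value 0 at a pole, in
   accordance with 0^-1 = 0. *)
Definition meromorphic_section (k : nat) X q (D : M -> int) :=
  differential_law k X setT q /\
  forall w p, X w -> dom w p ->
    exists h : R[i] -> R[i],
      [/\ holomorphic_at h (w p), h (w p) != 0 &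
       \forall y \near p, q w y = (w y - w p) ^ (D p) * h (w y)].

Definition divisor n (c : 'I_n -> M) (m : 'I_n -> int) : M -> int :=
  fun p => \sum_(i | c i == p) m i.

(* The metric |f(w)|^(1/2) |dw|^2, where q = f(w) (dw)^4. *)
Definition abs_sqrt_metric X q : metric R M :=
  let lambda w x := Num.sqrt (ComplexField.Normc.normc (q w x)) in
  @Metric R M X lambda (fun _ _ => 0) lambda.

(* h is a fourth root of q over V, that is a holomorphic 1-form on V with
   h^4 = q. *)
Definition fourth_root X q V h :=
  [/\ open V, differential_law 1 X V h &
      forall w x, X w -> (dom w `&` V) x ->
        holomorphic_at (h w \o icoord w) (w x) /\ h w x ^+ 4 = q w x].

Definition forms_agree_near X p (a : R[i]) h h' :=
  forall w, X w -> dom w p -> \forall y \near p, h w y = a * h' w y.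

(* The local fourth root h 0 of q, continued along gamma through h 1, ..., h N,
   comes back as zeta times h 0. *)
Definition fourth_root_along S X q gamma (zeta : R[i]) :=
  exists (N : nat) (t : nat -> R) (V : nat -> set M)
      (h : nat -> chart R M -> M -> R[i]),
    [/\ subdivision N t,
        forall j, (j <= N)%N ->
          [/\ V j `<=` S, fourth_root X q (V j) (h j) &
              forall s, t j <= s <= t j.+1 -> V j (gamma s)],
        forall j, (j < N)%N ->
          forms_agree_near X (gamma (t j.+1)) 1 (h j.+1) (h j) &
        forms_agree_near X (gamma 1) zeta (h N) (h 0%N)].

Definition fourth_root_monodromy S X q chi :=
  H1_character S chi /\
  forall gamma, loop S gamma ->
    fourth_root_along S X q gamma (chi (single gamma)).

End Differentials.

(* Main.v *)
Require Import Defs.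
From HB Require Import structures.
From mathcomp Require Import all_boot all_order all_algebra.
From mathcomp Require Import all_classical all_reals all_analysis.
From mathcomp Require Import zify ring lra.
Set Implicit Arguments.
Unset Strict Implicit.
Unset Printing Implicit Defensive.
Import Order.TTheory GRing.Theory Num.Theory.
Import numFieldNormedType.Exports.
Local Open Scope classical_set_scope.
Local Open Scope complex_scope.
Local Open Scope ring_scope.

(* Developing charts z of a flat metric are unique up to z |-> u z + b with
   |u| = 1, and conformal coordinates are holomorphic functions of z.  Hence
   the developing charts form a complex atlas off the cone points, and the
   differentials dz a local system whose monodromy is the rotational holonomy.
   If the holonomy is valued in Z_4, the fourth power of this local system has
   no monodromy; a global section A of it yields q = A (dz)^4.  A cone of angle
   2 pi b is conformal to a punctured disk by z |-> |z|^(b-1) z / b, and in this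
   coordinate q z^(-m), with m = 4 b - 4, is holomorphic of modulus one, hence
   constant.
   Conversely, the primitives of the local fourth roots of q are developing
   charts, and at a zero or pole the equation z^m (z')^4 = w^m f(w)^4 has a
   solution z(w), which provides the conformal coordinate of a cone.
   A local fourth root of q is a constant multiple of dz, so the continuation of
   fourth roots and that of developing charts are one and the same parallel
   transport. *)

(** * Differential calculus in the plane *)

(** The orientation [O] is topological: its transition maps are only homeomorphisms of local degree
    one, and the metric has smooth charts off the cone points only. At a cone point the orientation
    of a conformal chart is therefore deduced from the nearby points, by a homotopy of circles. A
    conformal change of coordinate is known at first to satisfy the Cauchy-Riemann equations at each
    point. That it is affine when its derivative has modulus one requires the derivative to be
    holomorphic in turn, hence Goursat's theorem and Cauchy's formula. Rotation and continuation of
    roots are relations between a loop and a number. To compare them, one germ is fixed at each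
    point, so that a local system becomes a function [th x y] of two nearby points and transport
    along a path becomes a function of time. Each relation implies the transport equation, whose
    solution is unique, and each holds for at least one number; hence both are equivalent to it.
    Since germs are fixed at all points, transport is a number for every path and not only for
    loops; this extends the character to all chains. *)

Section Modulus.
Context {R : realType}.
Local Notation C := R[i].
Implicit Types (z w : C).

Definition nm z : R := Num.sqrt (sqmod z).

Lemma norm_nm z : `|z| = (nm z)%:C.
Proof. by rewrite normc_def. Qed.

Lemma normc_nm z : ComplexField.Normc.normc z = nm z.
Proof. by case: z. Qed.

Lemma nm_ge0 z : 0 <= nm z. Proof. exact: sqrtr_ge0. Qed.

Lemma nmR (x : R) : nm x%:C = `|x|.
Proof. by rewrite /nm /sqmod /= expr0n /= addr0 sqrtr_sqr. Qed.

Lemma nmD z w : nm (z + w) <= nm z + nm w.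
Proof. by rewrite -lecR rmorphD /= -!norm_nm ler_normD. Qed.

Lemma nmM z w : nm (z * w) = nm z * nm w.
Proof. by apply: complexI; rewrite rmorphM /= -!norm_nm normrM. Qed.

Lemma nmN z : nm (- z) = nm z.
Proof. by apply: complexI; rewrite -!norm_nm normrN. Qed.

Lemma nmC z w : nm (z - w) = nm (w - z).
Proof. by rewrite -nmN opprB. Qed.

Lemma nmB z w : nm (z - w) <= nm z + nm w.
Proof. by rewrite -(nmN w) nmD. Qed.

Lemma nm_tri z w t : nm (z - w) <= nm (z - t) + nm (t - w).
Proof. by have := nmD (z - t) (t - w); rewrite addrA subrK. Qed.

Lemma nm_eq0 z : (nm z == 0) = (z == 0).
Proof. by rewrite -(inj_eq (@complexI R)) -norm_nm normr_eq0. Qed.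

Lemma nm0 : nm 0 = 0. Proof. by apply/eqP; rewrite nm_eq0. Qed.

Lemma nm_gt0 z : (0 < nm z) = (z != 0).
Proof. by rewrite lt_def nm_eq0 nm_ge0 andbT. Qed.

Lemma nm1 : nm 1 = 1.
Proof. by rewrite (nmR 1) normr1. Qed.

Lemma nmX z n : nm (z ^+ n) = nm z ^+ n.
Proof. by elim: n => [|n IH]; rewrite ?expr0 ?nm1 // !exprS nmM IH. Qed.

Lemma nmV z : nm z^-1 = (nm z)^-1.
Proof. by rewrite -!normc_nm ComplexField.Normc.normcV. Qed.

Lemma nm_sqr z : nm z ^+ 2 = sqmod z.
Proof. by rewrite /nm sqr_sqrtr // addr_ge0 // sqr_ge0. Qed.

Lemma nmi : nm 'i%C = 1.
Proof. by rewrite /nm /sqmod /= expr0n /= add0r expr1n sqrtr1. Qed.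

Lemma nm_conj z : nm (z^*%C) = nm z.
Proof. by case: z => a b; rewrite /nm /sqmod /= sqrrN. Qed.

Lemma Re_nm z : `|complex.Re z| <= nm z.
Proof. by rewrite -sqrtr_sqr ler_wsqrtr // lerDl sqr_ge0. Qed.

Lemma Im_nm z : `|complex.Im z| <= nm z.
Proof. by rewrite -sqrtr_sqr ler_wsqrtr // lerDr sqr_ge0. Qed.

Lemma nm_le z : nm z <= `|complex.Re z| + `|complex.Im z|.
Proof.
rewrite [in nm z](complexE z); apply: (le_trans (nmD _ _)).
by rewrite nmM nmi mul1r !nmR.
Qed.

Lemma sqmodM z w : sqmod (z * w) = sqmod z * sqmod w.
Proof. by rewrite -!nm_sqr nmM exprMn. Qed.

Lemma expi_neq0 (a : R) : expi a != 0.
Proof.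
apply/eqP => /(congr1 sqmod); rewrite /sqmod /= cos2Dsin2 expr0n /= addr0.
by move/eqP; rewrite oner_eq0.
Qed.

Lemma nm_expi (a : R) : nm (expi a) = 1.
Proof. by rewrite /nm /sqmod /= cos2Dsin2 sqrtr1. Qed.

Lemma expiD (a b : R) : expi (a + b) = expi a * expi b.
Proof. by rewrite /expi cosD sinD; simpc; rewrite [X in _ +i* X]addrC. Qed.

Lemma expi0 : expi 0 = 1 :> C.
Proof. by rewrite /expi cos0 sin0. Qed.

Lemma nbhsCP z (A : set C) :
  nbhs z A <-> exists2 e : R, 0 < e & forall w, nm (w - z) < e -> A w.
Proof.
split=> [/nbhs_ballP[e /= e0 eA]|[e e0 eA]].
  have eR : e = (complex.Re e)%:C by rewrite RRe_real // gtr0_real.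
  exists (complex.Re e); first by rewrite -ltcR -eR.
  move=> w wz; apply: eA; rewrite -ball_normE /= eR norm_nm ltcR.
  by rewrite nmC.
apply/nbhs_ballP; exists e%:C; first by rewrite /= ltcR.
by move=> w; rewrite -ball_normE /= norm_nm ltcR nmC; exact: eA.
Qed.

Lemma nm_ball z (e : R) : 0 < e -> \forall w \near z, nm (w - z) < e.
Proof. by move=> e0; apply/nbhsCP; exists e. Qed.

Lemma contC (T : topologicalType) (f : T -> C) x :
  {for x, continuous f} <->
  forall e : R, 0 < e -> \forall y \near x, nm (f y - f x) < e.
Proof.
split=> [fx e e0|fx A]; first exact: (fx _ (nm_ball (f x) e0)).
move=> /nbhsCP[e e0 eA]; by apply: filterS (fx e e0) => y yx; apply: eA.
Qed.

Lemma nbhsRP (x : R) (A : set R) :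
  nbhs x A <-> exists2 e : R, 0 < e & forall y, `|y - x| < e -> A y.
Proof.
split=> [/nbhs_ballP[e /= e0 eA]|[e e0 eA]].
  by exists e => // y yx; apply: eA; rewrite -ball_normE /= distrC.
apply/nbhs_ballP; exists e => // y; rewrite -ball_normE /= distrC; exact: eA.
Qed.

Lemma contR (T : topologicalType) (f : T -> R) x :
  {for x, continuous f} <->
  forall e : R, 0 < e -> \forall y \near x, `|f y - f x| < e.
Proof.
split=> [fx e e0|fx A].
  have h : \forall y \near x, ball (f x) e (f y).
    exact: fx (nbhsx_ballx _ _ e0).
  by apply: filterS h => y; rewrite -ball_normE /= distrC.
move=> /nbhsRP[e e0 eA]; have := fx e e0.
by apply: filterS => y yx; apply: eA.
Qed.

Lemma contRC (T : topologicalType) (f : T -> R) x :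
  {for x, continuous f} <-> {for x, continuous (fun y => (f y)%:C)}.
Proof.
rewrite contC contR; split=> + e e0 => /(_ e e0); apply: filterS => y.
  by rewrite -rmorphB /= nmR.
by rewrite -rmorphB /= nmR.
Qed.

Lemma cont_Re (T : topologicalType) (f : T -> C) x :
  {for x, continuous f} -> {for x, continuous (fun y => complex.Re (f y))}.
Proof.
move=> /contC fx; apply/contR => e e0; apply: (filterS _ (fx e e0)) => y.
by apply: le_lt_trans; rewrite -raddfB Re_nm.
Qed.

Lemma cont_Im (T : topologicalType) (f : T -> C) x :
  {for x, continuous f} -> {for x, continuous (fun y => complex.Im (f y))}.
Proof.
move=> /contC fx; apply/contR => e e0; apply: (filterS _ (fx e e0)) => y.
by apply: le_lt_trans; rewrite -raddfB Im_nm.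
Qed.

Lemma cont_complex (T : topologicalType) (f g : T -> R) x :
  {for x, continuous f} -> {for x, continuous g} ->
  {for x, continuous (fun y => f y +i* g y)}.
Proof.
move=> /contR fx /contR gx; apply/contC => e e0.
have e20 : 0 < e / 2 by rewrite divr_gt0.
near=> y; apply: (le_lt_trans (nm_le _)) => /=.
have : `|f y - f x| < e / 2 by near: y; exact: fx.
have : `|g y - g x| < e / 2 by near: y; exact: gx.
by lra.
Unshelve. all: by end_near. Qed.

Lemma contD (T : topologicalType) (f g : T -> C) x :
  {for x, continuous f} -> {for x, continuous g} -> {for x, continuous (fun y => f y + g y)}.
Proof. by move=> h1 h2; exact: cvgD h1 h2. Qed.

Lemma contM (T : topologicalType) (f g : T -> C) x :
  {for x, continuous f} -> {for x, continuous g} -> {for x, continuous (fun y => f y * g y)}.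
Proof. by move=> h1 h2; exact: cvgM h1 h2. Qed.

Lemma contN (T : topologicalType) (f : T -> C) x :
  {for x, continuous f} -> {for x, continuous (fun y => - f y)}.
Proof. by move=> h1; exact: cvgN h1. Qed.

Lemma contB (T : topologicalType) (f g : T -> C) x :
  {for x, continuous f} -> {for x, continuous g} -> {for x, continuous (fun y => f y - g y)}.
Proof. by move=> h1 h2; exact: contD h1 (contN h2). Qed.

Lemma cont_cst (T : topologicalType) (a : C) (x : T) : {for x, continuous (fun=> a)}.
Proof. exact: cst_continuous. Qed.

Lemma contV (T : topologicalType) (f : T -> C) x : f x != 0 ->
  {for x, continuous f} -> {for x, continuous (fun y => (f y)^-1)}.
Proof. by move=> f0 h; exact: cvgV f0 h. Qed.

Lemma cont_comp (T U V : topologicalType) (f : T -> U) (g : U -> V) x :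
  {for x, continuous f} -> {for f x, continuous g} ->
  {for x, continuous (fun y => g (f y))}.
Proof. exact: continuous_comp. Qed.

Lemma cont_affine (a b x : R) : {for x, continuous (fun t : R => a * t + b)}.
Proof.
by apply: cvgD; [apply: cvgM; [exact: cvg_cst|exact: cvg_id]|exact: cvg_cst].
Qed.

End Modulus.

(** * Real differentials with explicit error bounds, and complex derivatives *)

Section RealDerivative.
Context {R : realType}.
Local Notation C := R[i].
Implicit Types (f g : C -> C) (z w p q h v : C).

(** A real-linear map of the plane is encoded by its values at 1 and at i, so that complex linearity
    reads [q = 'i * p], as in [dl_conf]. *)
Definition dl p q v : C := (complex.Re v)%:C * p + (complex.Im v)%:C * q.

Lemma dlD p q v w : dl p q (v + w) = dl p q v + dl p q w.
Proof. by rewrite /dl !raddfD /=; ring. Qed.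

Lemma dlN p q v : dl p q (- v) = - dl p q v.
Proof. by rewrite /dl !raddfN /=; ring. Qed.

Lemma dlZ p q (a : R) v : dl p q (a%:C * v) = a%:C * dl p q v.
Proof.
case: v => x y; rewrite /dl; simpc => /=.
by rewrite !rmorphM /=; ring.
Qed.

Lemma dl_nm p q v : nm (dl p q v) <= (nm p + nm q) * nm v.
Proof.
rewrite /dl; apply: (le_trans (nmD _ _)); rewrite !nmM !nmR mulrDl.
by rewrite [nm p * _]mulrC [nm q * _]mulrC lerD // ler_wpM2r ?nm_ge0 // ?Re_nm ?Im_nm.
Qed.

Lemma dl1 p q : dl p q 1 = p.
Proof. by rewrite /dl /= mul1r mul0r addr0. Qed.

Lemma dli p q : dl p q 'i%C = q.
Proof. by rewrite /dl /= mul1r mul0r add0r. Qed.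

Lemma dl_conf p v : dl p ('i%C * p) v = v * p.
Proof. by rewrite /dl [v in RHS]complexE; ring. Qed.

(** [sml], [lipz], [tend0] and [bnd] are o(h), O(h), o(1) and O(1) as h tends to 0. The first three
    include the point h = 0, where they force the value 0. *)
Definition sml (r : C -> C) :=
  forall e : R, 0 < e ->
    exists2 d : R, 0 < d & forall h, nm h < d -> nm (r h) <= e * nm h.

Definition lipz (k : C -> C) :=
  exists2 K : R, 0 < K &
    exists2 d : R, 0 < d & forall h, nm h < d -> nm (k h) <= K * nm h.

Definition tend0 (b : C -> C) :=
  forall e : R, 0 < e ->
    exists2 d : R, 0 < d & forall h, nm h < d -> nm (b h) <= e.

Definition bnd (b : C -> C) :=
  exists2 K : R, 0 < K &
    exists2 d : R, 0 < d & forall h, nm h < d -> nm (b h) <= K.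

Lemma min_gt0 (a b : R) : 0 < a -> 0 < b -> 0 < Num.min a b.
Proof. by move=> a0 b0; rewrite lt_min a0. Qed.

Lemma half_pos (a : R) : 0 < a -> 0 < a / 2.
Proof. by move=> a0; rewrite divr_gt0. Qed.

Lemma smlD r s : sml r -> sml s -> sml (fun h => r h + s h).
Proof.
move=> rs ss e e0; have e20 : 0 < e / 2 by rewrite divr_gt0.
have [d d0 rd] := rs _ e20; have [d' d'0 sd] := ss _ e20.
exists (Num.min d d'); first exact: min_gt0.
move=> h; rewrite lt_min => /andP[/rd rh /sd sh].
by apply: (le_trans (nmD _ _)); lra.
Qed.

Lemma sml_bnd b r : bnd b -> sml r -> sml (fun h => b h * r h).
Proof.
move=> [K K0 [d d0 bd]] rs e e0.
have [d' d'0 rd] := rs (e / K) (divr_gt0 e0 K0).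
exists (Num.min d d'); first exact: min_gt0.
move=> h; rewrite lt_min => /andP[/bd bh /rd rh].
rewrite nmM; apply: (le_trans (ler_pM (nm_ge0 _) (nm_ge0 _) bh rh)).
by rewrite mulrA [K * _]mulrC divfK // gt_eqF.
Qed.

Lemma sml_tend0 b k : tend0 b -> lipz k -> sml (fun h => b h * k h).
Proof.
move=> b0 [K K0 [d d0 kd]] e e0.
have [d' d'0 bd] := b0 (e / K) (divr_gt0 e0 K0).
exists (Num.min d d'); first exact: min_gt0.
move=> h; rewrite lt_min => /andP[/kd kh /bd bh].
rewrite nmM; apply: (le_trans (ler_pM (nm_ge0 _) (nm_ge0 _) bh kh)).
by rewrite mulrA divfK // gt_eqF.
Qed.

Lemma sml_comp r k : sml r -> lipz k -> sml (r \o k).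
Proof.
move=> rs [K K0 [d d0 kd]] e e0.
have [d' d'0 rd] := rs (e / K) (divr_gt0 e0 K0).
exists (Num.min d (d' / K)); first by apply: min_gt0; rewrite ?divr_gt0.
move=> h; rewrite lt_min => /andP[/kd kh hd] /=.
apply: (le_trans (rd _ _)).
  by apply: (le_lt_trans kh); rewrite mulrC -ltr_pdivlMr.
apply: (le_trans (ler_wpM2l _ kh)); first by rewrite divr_ge0 // ltW.
by rewrite mulrA divfK // gt_eqF.
Qed.

Lemma sml_lip r : sml r -> lipz r.
Proof. by move=> /(_ 1 ltr01)[d d0 rd]; exists 1 => //; exists d. Qed.

Lemma lipzD k l : lipz k -> lipz l -> lipz (fun h => k h + l h).
Proof.
move=> [K K0 [d d0 kd]] [L L0 [d' d'0 ld]].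
exists (K + L); first exact: addr_gt0.
exists (Num.min d d'); first exact: min_gt0.
move=> h; rewrite lt_min => /andP[/kd kh /ld lh].
by apply: (le_trans (nmD _ _)); lra.
Qed.

Lemma lip_tend0 k : lipz k -> tend0 k.
Proof.
move=> [K K0 [d d0 kd]] e e0; exists (Num.min d (e / K)).
  by apply: min_gt0; rewrite ?divr_gt0.
move=> h; rewrite lt_min => /andP[/kd kh hd].
by apply: (le_trans kh); rewrite mulrC -ler_pdivlMr // ltW.
Qed.

Lemma lip_dl p q : lipz (dl p q).
Proof.
exists (nm p + nm q + 1); first by have := nm_ge0 p; have := nm_ge0 q; lra.
exists 1 => // h _; apply: (le_trans (dl_nm _ _ _)).
by rewrite ler_wpM2r ?nm_ge0 //; lra.
Qed.

Lemma sml_cont_eq r s : r =1 s -> sml r -> sml s.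
Proof. by move=> rs h e e0; have [d d0 hd] := h e e0; exists d => // k; rewrite -rs; exact: hd. Qed.

(* The real differential of [f] at [z] exists and is v |-> Re v * p + Im v * q;
   [cder] is the complex derivative, by the Cauchy-Riemann equations. *)
Definition rd f z p q := sml (fun h => f (z + h) - f z - dl p q h).

Definition cder f z p := rd f z p ('i%C * p).

Lemma rd_near f g z p q : (\forall w \near z, f w = g w) ->
  rd f z p q -> rd g z p q.
Proof.
move=> /nbhsCP[d d0 fg] rf e e0; have [d' d'0 hd] := rf e e0.
exists (Num.min d d'); first exact: min_gt0.
move=> h; rewrite lt_min => /andP[hd1 /hd].
by rewrite !fg ?subrr ?nm0 // addrC addKr.
Qed.

Lemma rd_lip f z p q : rd f z p q -> lipz (fun h => f (z + h) - f z).
Proof.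
move=> fz; have := lipzD (sml_lip fz) (lip_dl p q).
by congr lipz; apply/funext => h; rewrite subrK.
Qed.

Lemma rd_cont f z p q : rd f z p q -> {for z, continuous f}.
Proof.
move=> /rd_lip/lip_tend0 t; apply/contC => e e0.
have [d d0 hd] := t _ (half_pos e0).
apply/nbhsCP; exists d => // w /hd; rewrite [z + _]addrC subrK => /le_lt_trans; apply.
lra.
Qed.

Lemma sml_dl p q : sml (dl p q) -> p = 0 /\ q = 0.
Proof.
have key (a : C) (r : R -> C) : (forall t : R, 0 < t -> nm (r t) = t) ->
    sml (dl p q) -> (forall t : R, dl p q (r t) = t%:C * a) -> a = 0.
  move=> r1 s ra; apply/eqP; rewrite -nm_eq0; apply/negPn/negP => a0.
  have a_gt0 : 0 < nm a by rewrite lt_def a0 nm_ge0.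
  have [d d0 hd] := s (nm a / 2) (half_pos a_gt0).
  have d20 : 0 < d / 2 by rewrite divr_gt0.
  have := hd (r (d / 2)); rewrite ra nmM nmR r1 // gtr0_norm //.
  have -> : d / 2 < d by lra.
  move=> /(_ isT); rewrite mulrC ler_pM2r //; lra.
move=> s; split.
  apply: (key p (fun t => t%:C)) => // t; first by move=> t0; rewrite nmR gtr0_norm.
  by rewrite /dl /= mul0r addr0.
apply: (key q (fun t => t%:C * 'i%C)) => // t.
  by move=> t0; rewrite nmM nmi mulr1 nmR gtr0_norm.
by rewrite dlZ dli.
Qed.

Lemma rd_unique f z p q p' q' : rd f z p q -> rd f z p' q' -> p = p' /\ q = q'.
Proof.
move=> r1 r2; have : sml (dl (p' - p) (q' - q)).
  have m1 : bnd (fun=> -1).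
    by exists 1 => //; exists 1 => // h _; rewrite nmN nm1.
  apply: sml_cont_eq (smlD r1 (sml_bnd m1 r2)) => h.
  by rewrite /dl; ring.
by move=> /sml_dl[/subr0_eq-> /subr0_eq->].
Qed.

Lemma cder_unique f z p p' : cder f z p -> cder f z p' -> p = p'.
Proof. by move=> h /(rd_unique h)[]. Qed.

Lemma rd_dl p q z : rd (dl p q) z p q.
Proof.
by move=> e e0; exists 1 => // h _; rewrite dlD [dl p q z + _]addrC addrK subrr nm0 mulr_ge0 ?nm_ge0 // ltW.
Qed.

Lemma rd_cst (a : C) z : rd (fun=> a) z 0 0.
Proof.
move=> e e0; exists 1 => // h _.
by rewrite /dl !mulr0 addr0 !subrr nm0 mulr_ge0 ?nm_ge0 // ltW.
Qed.

Lemma cder_cst (a : C) z : cder (fun=> a) z 0.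
Proof. by rewrite /cder mulr0; exact: rd_cst. Qed.

Lemma rd_ext f g z p q : f =1 g -> rd f z p q -> rd g z p q.
Proof. by move=> fg; apply: rd_near; near=> w; exact: fg.
Unshelve. all: by end_near. Qed.

Lemma cder_id z : cder id z 1.
Proof.
apply: rd_ext (rd_dl _ _ z) => w.
by rewrite dl_conf mulr1.
Qed.

Lemma rd_Re z : rd (fun w => (complex.Re w)%:C) z 1 0.
Proof. by apply: rd_ext (rd_dl _ _ z) => w; rewrite /dl mulr1 mulr0 addr0. Qed.

Lemma rd_Im z : rd (fun w => (complex.Im w)%:C) z 0 1.
Proof. by apply: rd_ext (rd_dl _ _ z) => w; rewrite /dl mulr1 mulr0 add0r. Qed.

Lemma rdD f g z p q p' q' : rd f z p q -> rd g z p' q' ->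
  rd (fun w => f w + g w) z (p + p') (q + q').
Proof.
move=> rf rg; apply: sml_cont_eq (smlD rf rg) => h; rewrite /dl; ring.
Qed.

Lemma tend0_bnd (a : C) b : tend0 b -> bnd (fun h => a + b h).
Proof.
move=> /(_ 1 ltr01)[d d0 bd]; exists (nm a + 1); first by have := nm_ge0 a; lra.
by exists d => // h /bd bh; apply: (le_trans (nmD _ _)); lra.
Qed.

Lemma bnd_cst (a : C) : bnd (fun=> a).
Proof.
exists (nm a + 1); first by have := nm_ge0 a; lra.
by exists 1 => // h _; lra.
Qed.

Lemma rdM f g z p q p' q' : rd f z p q -> rd g z p' q' ->
  rd (fun w => f w * g w) z (p * g z + f z * p') (q * g z + f z * q').
Proof.
move=> rf rg.
have s1 := sml_bnd (tend0_bnd (g z) (lip_tend0 (rd_lip rg))) rf.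
have s2 := sml_tend0 (lip_tend0 (rd_lip rg)) (lip_dl p q).
have s3 := sml_bnd (bnd_cst (f z)) rg.
apply: sml_cont_eq (smlD (smlD s1 s2) s3) => h; rewrite /dl; ring.
Qed.

Lemma rd_comp f g z p q p' q' : rd f z p q -> rd g (f z) p' q' ->
  rd (g \o f) z (dl p' q' p) (dl p' q' q).
Proof.
move=> rf rg.
have s1 := sml_comp rg (rd_lip rf).
have s2 : sml (fun h => dl p' q' (f (z + h) - f z - dl p q h)).
  move=> e e0.
  set K := nm p' + nm q' + 1.
  have K0 : 0 < K by rewrite /K; have := nm_ge0 p'; have := nm_ge0 q'; lra.
  have [d d0 hd] := rf (e / K) (divr_gt0 e0 K0).
  exists d => // h /hd hh; apply: (le_trans (dl_nm _ _ _)).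
  apply: (@le_trans _ _ (K * nm (f (z + h) - f z - dl p q h))).
    by rewrite ler_wpM2r ?nm_ge0 // /K; lra.
  apply: (le_trans (ler_wpM2l (ltW K0) hh)).
  by rewrite mulrA [K * _]mulrC divfK // gt_eqF.
apply: sml_cont_eq (smlD s1 s2) => h /=.
rewrite [f z + _]addrC subrK (dlD _ _ (_ - _) (- _)) dlN.
have -> : dl p' q' (dl p q h) = dl (dl p' q' p) (dl p' q' q) h.
  by rewrite [dl p q h]/dl dlD !dlZ.
ring.
Qed.

Lemma rdN f z p q : rd f z p q -> rd (fun w => - f w) z (- p) (- q).
Proof.
move=> rf; have := rdM (rd_cst (-1) z) rf; rewrite !mul0r !add0r !mulN1r.
by apply: rd_ext => w; rewrite mulN1r.
Qed.

Lemma rdB f g z p q p' q' : rd f z p q -> rd g z p' q' ->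
  rd (fun w => f w - g w) z (p - p') (q - q').
Proof. by move=> rf /rdN; exact: rdD. Qed.

Lemma rd_eq f z p q p' q' : rd f z p q -> p = p' -> q = q' -> rd f z p' q'.
Proof. by move=> h <- <-. Qed.

Lemma cder_eq f z p p' : cder f z p -> p = p' -> cder f z p'.
Proof. by move=> h <-. Qed.

Lemma cderD f g z p p' : cder f z p -> cder g z p' ->
  cder (fun w => f w + g w) z (p + p').
Proof. by move=> /rdD h /h; rewrite -mulrDr. Qed.

Lemma cderN f z p : cder f z p -> cder (fun w => - f w) z (- p).
Proof. by move=> /rdN h; rewrite /cder mulrN. Qed.

Lemma cderB f g z p p' : cder f z p -> cder g z p' ->
  cder (fun w => f w - g w) z (p - p').
Proof. by move=> /rdB h /h; rewrite -mulrBr. Qed.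

Lemma cderM f g z p p' : cder f z p -> cder g z p' ->
  cder (fun w => f w * g w) z (p * g z + f z * p').
Proof. by move=> /rdM h /h /rd_eq; apply => //; ring. Qed.

Lemma cder_comp f g z p p' : cder f z p -> cder g (f z) p' ->
  cder (g \o f) z (p' * p).
Proof. by move=> /rd_comp h /h /rd_eq; apply; rewrite dl_conf; ring. Qed.

Lemma cderX f z p n : cder f z p ->
  cder (fun w => f w ^+ n) z (f z ^+ n.-1 * p *+ n).
Proof.
move=> fz; elim: n => [|n IH]; first by rewrite mulr0n; exact: cder_cst.
rewrite (_ : (fun w => _) = (fun w => f w * f w ^+ n)); last first.
  by apply/funext => w; rewrite exprS.
apply: cder_eq (cderM fz IH) _; case: n {IH} => [|n] /=; first by rewrite !expr0; ring.
by rewrite mulrnAr [in RHS]mulrSr mulrA -exprS addrC [p * _]mulrC.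
Qed.

Lemma cder_inv z : z != 0 -> cder (fun w => w^-1) z (- z ^- 2).
Proof.
move=> z0; have nz0 : 0 < nm z by rewrite nm_gt0.
(* The error term is h^2 / ((z + h) z^2), a bounded factor times the small term h^2. *)
set b : C -> C := fun h => if z + h == 0 then 0 else (z + h)^-1 * z ^- 2.
have s0 : sml (fun h => h * h).
  move=> e e0; exists e => // h he; rewrite nmM ler_wpM2r ?nm_ge0 //; exact: ltW.
have bb : bnd b.
  exists (2 / nm z * nm (z ^- 2)).
    by rewrite mulr_gt0 ?divr_gt0 // nm_gt0 invr_neq0 // expf_neq0.
  exists (nm z / 2); first by rewrite divr_gt0.
  move=> h hz; rewrite /b; case: eqP => [_|_].
    by rewrite nm0 mulr_ge0 ?nm_ge0 // divr_ge0 ?nm_ge0.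
  rewrite nmM ler_wpM2r ?nm_ge0 // nmV -[2 / _]invf_div lef_pV2 ?posrE.
  - have := nmB (z + h) h; rewrite addrK; lra.
  - by have := nmB (z + h) h; rewrite addrK; lra.
  - by rewrite divr_gt0.
have [d d0 dz] : exists2 d : R, 0 < d & forall h, nm h < d -> z + h != 0.
  exists (nm z) => // h hz; apply/eqP => zh; move: hz.
  by rewrite -nmN (_ : - h = z) ?ltxx //; apply/esym/eqP; rewrite -addr_eq0 zh.
move=> e e0; have [d' d'0 hd'] := sml_bnd bb s0 e0.
exists (Num.min d d'); first exact: min_gt0.
move=> h; rewrite lt_min => /andP[hd /hd'].
have zh := dz h hd; rewrite /b (negbTE zh) dl_conf; congr (nm _ <= _); field.
by rewrite zh z0.
Qed.

Lemma cderV f z p : cder f z p -> f z != 0 ->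
  cder (fun w => (f w)^-1) z (- (f z) ^- 2 * p).
Proof. by move=> fz f0; exact: cder_comp fz (cder_inv f0). Qed.

End RealDerivative.

Section Derivatives.
Context {R : realType}.
Local Notation C := R[i].
Implicit Types (f g : C -> C) (z w p q h v : C) (u : C -> R).

Lemma derive_quotP (K : numFieldType) (V : normedModType K) (f : V -> V)
    (x v d : V) :
  is_derive x v f d <-> (fun h : K => h^-1 *: (f (h *: v + x) - f x)) @ 0^' --> d.
Proof.
split=> [[fx <-]|fd]; first exact: fx.
by split; [apply/cvg_ex; exists d|exact: cvg_lim fd].
Qed.

Lemma cderP f z p : cder f z p <-> is_derive z 1 f p.
Proof.
rewrite derive_quotP; split=> [fz|fz].
  move=> A /nbhsCP[e e0 eA].
  have [d d0 hd] := fz _ (half_pos e0).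
  apply/nbhs_ballP; exists d%:C; first by rewrite /= ltcR.
  move=> h; rewrite -ball_normE /= sub0r normrN norm_nm ltcR => /hd {}hd h0.
  apply: eA; have h0' : 0 < nm h by rewrite nm_gt0.
  rewrite -(ltr_pM2l h0') -nmM; apply: (@le_lt_trans _ _ (e / 2 * nm h)); last nra.
  apply: le_trans hd; rewrite dl_conf /= le_eqVlt; apply/orP; left; apply/eqP.
  congr nm; rewrite [_ *: 1]mulr1 [h + z]addrC.
  by rewrite [_ *: _](_ : _ = h^-1 * (f (z + h) - f z)) // mulrBr mulVKf.
move=> e e0; have := fz _ (nm_ball p e0).
move=> /nbhs_ballP[d /= d0 hd].
have dR : d = (complex.Re d)%:C by rewrite RRe_real // gtr0_real.
exists (complex.Re d); first by rewrite -ltcR -dR.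
move=> h hh; have [->|h0] := eqVneq h 0.
  by rewrite addr0 subrr nm0 mulr0 dl_conf mul0r subrr nm0.
have bh : ball (0 : C) d h by rewrite -ball_normE /= sub0r normrN norm_nm dR ltcR.
have := hd h bh h0 => /ltW; rewrite -(ler_pM2r (_ : 0 < nm h)) ?nm_gt0 // -nmM.
rewrite [_ *: 1]mulr1 [h + z]addrC dl_conf.
rewrite [_ *: _](_ : _ = h^-1 * (f (z + h) - f z)) //.
by rewrite mulrBl mulrAC mulVf // mul1r [p * h]mulrC.
Qed.

Lemma cder_derive1 f z p : cder f z p -> derive1 f z = p.
Proof. by move=> /cderP h; rewrite derive1E derive_val. Qed.

Lemma derivable_cder f z : derivable f z 1 -> cder f z (derive1 f z).
Proof. by move=> fz; apply/cderP; rewrite derive1E; apply: derivableP. Qed.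

Lemma cder_derivable f z p : cder f z p -> derivable f z 1.
Proof. by move=> /cderP[]. Qed.

Lemma derP (phi : R -> R) (t d : R) :
  is_derive t 1 phi d <->
  forall e : R, 0 < e -> exists2 r : R, 0 < r &
    forall h : R, `|h| < r -> `|phi (t + h) - phi t - h * d| <= e * `|h|.
Proof.
rewrite derive_quotP; split=> fz.
  move=> e e0; have := fz _ (nbhsx_ballx d e e0).
  move=> /nbhs_ballP[r /= r0 hr]; exists r => // h hh.
  have [->|h0] := eqVneq h 0; first by rewrite addr0 subrr mul0r subrr normr0 mulr0.
  have bh : ball (0 : R) r h by rewrite -ball_normE /= sub0r normrN.
  have := hr h bh h0; rewrite -ball_normE /= => /ltW; rewrite -(ler_pM2r (_ : 0 < `|h|)) ?normr_gt0 // -normrM.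
  rewrite [_ *: 1]mulr1 [h + t]addrC [_ *: _](_ : _ = h^-1 * (phi (t + h) - phi t)) //.
  rewrite (_ : (d - _) * h = - (phi (t + h) - phi t - h * d)) ?normrN //; by field.
move=> A /nbhsRP[e e0 eA].
have [r r0 hr] := fz _ (half_pos e0).
apply/nbhs_ballP; exists r => // h.
rewrite -ball_normE /= sub0r normrN => /hr {}hr h0.
apply: eA; have h0' : 0 < `|h| by rewrite normr_gt0.
rewrite -(ltr_pM2l h0') -normrM; apply: (@le_lt_trans _ _ (e / 2 * `|h|)); last nra.
apply: le_trans hr; rewrite le_eqVlt; apply/orP; left; apply/eqP.
congr `| _ |; rewrite [_ *: 1]mulr1 [h + t]addrC.
by rewrite [_ *: _](_ : _ = h^-1 * (phi (t + h) - phi t)) //; field.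
Qed.

Implicit Types (ga de : R -> C) (t : R).

(** A curve is differentiated as a map of the plane depending on the real part only, with
    differential zero at i; the rules for [rd] then apply to curves as well. *)
Definition cd (ga : R -> C) (t : R) (d : C) :=
  rd (fun z => ga (complex.Re z)) t%:C d 0.

Lemma cdP (ga : R -> C) t d : cd ga t d <->
  forall e : R, 0 < e -> exists2 r : R, 0 < r &
    forall h : R, `|h| < r -> nm (ga (t + h) - ga t - h%:C * d) <= e * `|h|.
Proof.
split=> H e e0; have [r r0 hr] := H e e0; exists r => // h hh.
  have := hr h%:C; rewrite nmR => /(_ hh).
  by rewrite /dl /= mul0r addr0.
have := hr (complex.Re h) (le_lt_trans (Re_nm h) hh).
rewrite /dl mulr0 addr0 raddfD /= => /le_trans; apply.
by rewrite ler_wpM2l ?Re_nm // ltW.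
Qed.

Lemma cd_Re ga t d : cd ga t d ->
  is_derive t 1 (fun s => complex.Re (ga s)) (complex.Re d).
Proof.
move=> /cdP H; apply/derP => e /H[r r0 hr]; exists r => // h /hr.
apply: le_trans; apply: le_trans (Re_nm _); rewrite !raddfB /=.
by case: d {H hr} => a b /=; rewrite mul0r subr0.
Qed.

Lemma cd_pair (ga : R -> C) t d :
  is_derive t 1 (fun s => complex.Re (ga s)) (complex.Re d) ->
  is_derive t 1 (fun s => complex.Im (ga s)) (complex.Im d) -> cd ga t d.
Proof.
move=> /derP H1 /derP H2; apply/cdP => e e0.
have [r1 r10 h1] := H1 _ (half_pos e0); have [r2 r20 h2] := H2 _ (half_pos e0).
exists (Num.min r1 r2); first exact: min_gt0.
move=> h; rewrite lt_min => /andP[/h1 {}h1 /h2 {}h2].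
apply: (le_trans (nm_le _)); rewrite !raddfB /=.
case: d h1 h2 {H1 H2} => a b /= h1 h2; rewrite !mul0r subr0 addr0; lra.
Qed.

Lemma cd_real (phi : R -> R) t d :
  is_derive t 1 phi d -> cd (fun s => (phi s)%:C) t d%:C.
Proof. by move=> H; apply: cd_pair => //=; exact: is_derive_cst. Qed.

Lemma cd_comp ga f t d p q : cd ga t d -> rd f (ga t) p q -> cd (f \o ga) t (dl p q d).
Proof. by move=> H /(rd_comp H)/rd_eq; apply => //; rewrite /dl !mul0r addr0. Qed.

Lemma cd_ccomp ga f t d p : cd ga t d -> cder f (ga t) p -> cd (f \o ga) t (p * d).
Proof. by move=> H /(cd_comp H); rewrite dl_conf mulrC. Qed.

Lemma cdD ga de t d d' : cd ga t d -> cd de t d' -> cd (fun s => ga s + de s) t (d + d').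
Proof. by move=> /rdD h /h; rewrite addr0. Qed.

Lemma cdM ga de t d d' : cd ga t d -> cd de t d' ->
  cd (fun s => ga s * de s) t (d * de t + ga t * d').
Proof. by move=> /rdM h /h /rd_eq; apply => //; rewrite mulr0 mul0r addr0. Qed.

Lemma cd_cst (a : C) t : cd (fun=> a) t 0.
Proof. exact: rd_cst. Qed.

Lemma cd_eq ga t d d' : cd ga t d -> d = d' -> cd ga t d'.
Proof. by move=> h <-. Qed.

Lemma cd_ext ga de t d : ga =1 de -> cd ga t d -> cd de t d.
Proof. by move=> e; apply: rd_ext => w; rewrite e. Qed.

Lemma cd_cont ga t d : cd ga t d -> {for t, continuous ga}.
Proof.
move=> H; apply/contC => e e0; have [r r0 hr] := lip_tend0 (rd_lip H) (half_pos e0).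
apply/nbhsRP; exists r => // s st; have := hr (s - t)%:C; rewrite nmR => /(_ st).
by rewrite -rmorphD /= [t + _]addrC subrK; lra.
Qed.

Lemma cd_line (a b : C) t : cd (fun s => a + s%:C * b) t b.
Proof.
apply/cdP => e e0; exists 1 => // h _.
rewrite (_ : _ - _ = 0) ?nm0 ?mulr_ge0 // ?ltW //.
by rewrite rmorphD /=; ring.
Qed.

Lemma cd_affine ga (a b t : R) d : cd ga (a * t + b) d ->
  cd (fun s => ga (a * s + b)) t (a%:C * d).
Proof.
move=> H; have hl : cd (fun s => b%:C + s%:C * a%:C) t a%:C by exact: cd_line.
have e1 : b%:C + t%:C * a%:C = (a * t + b)%:C :> C by rewrite rmorphD rmorphM /=; ring.
have := cd_comp hl; rewrite e1 => /(_ _ _ _ H).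
rewrite /dl /= mulr0 addr0; apply: cd_ext => s /=.
by congr ga; rewrite mul0r subr0; ring.
Qed.

Lemma rd_along f z p q v t : rd f (z + t%:C * v) p q ->
  cd (fun s => f (z + s%:C * v)) t (dl p q v).
Proof. exact: cd_comp (cd_line z v t). Qed.

Lemma rd_derive u z p q v : rd (fun w => (u w)%:C) z p q ->
  is_derive (0 : R) 1 (along u z v) (complex.Re (dl p q v)).
Proof.
move=> H; have := @rd_along _ z p q v 0; rewrite mul0r addr0 => /(_ _ H) /cd_Re.
exact.
Qed.

Lemma rd_partial u z p q v : rd (fun w => (u w)%:C) z p q ->
  derivable (along u z v) 0 1 /\ partial u v z = complex.Re (dl p q v).
Proof.
move=> /(rd_derive v) H; split; first by case: H.
by rewrite /partial derive1E derive_val.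
Qed.

Lemma rdRe f z p q : rd f z p q ->
  rd (fun w => (complex.Re (f w))%:C) z (complex.Re p)%:C (complex.Re q)%:C.
Proof.
move=> H; have := rd_comp H (rd_Re (f z)) => /rd_eq; apply; by rewrite /dl mulr1 mulr0 addr0.
Qed.

Lemma rdIm f z p q : rd f z p q ->
  rd (fun w => (complex.Im (f w))%:C) z (complex.Im p)%:C (complex.Im q)%:C.
Proof.
move=> H; have := rd_comp H (rd_Im (f z)) => /rd_eq; apply; by rewrite /dl mulr1 mulr0 add0r.
Qed.

Lemma rd_pair (u1 u2 : C -> R) z (p1 q1 p2 q2 : R) :
  rd (fun w => (u1 w)%:C) z p1%:C q1%:C -> rd (fun w => (u2 w)%:C) z p2%:C q2%:C ->
  rd (fun w => u1 w +i* u2 w) z (p1 +i* p2) (q1 +i* q2).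
Proof.
move=> h1 h2; have := rdD h1 (rdM (rd_cst 'i%C z) h2).
move=> /rd_eq h; apply: rd_ext (h _ _ _ _) => [w||]; by simpc.
Qed.

Lemma rd_differential f z p q v : rd f z p q -> differential f z v = dl p q v.
Proof.
move=> H; rewrite /differential (rd_partial v (rdRe H)).2 (rd_partial v (rdIm H)).2.
by case: p q v {H} => a b [c d] [x y]; rewrite /dl /=; simpc => /=.
Qed.

Lemma rd_jacobian f z p q : rd f z p q ->
  jacobian_det f z = complex.Re p * complex.Im q - complex.Im p * complex.Re q.
Proof.
by move=> H; rewrite /jacobian_det !(rd_differential _ H) dl1 dli.
Qed.

Lemma along_cd u z v t d :
  is_derive (0 : R) 1 (along u (z + t%:C * v) v) d ->
  is_derive (t : R) 1 (along u z v) d.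
Proof.
move=> /derP H; apply/derP => e /H[r r0 hr]; exists r => // h /hr.
rewrite /along add0r mul0r addr0 rmorphD /=; congr (`|u _ - _ - _| <= _).
by rewrite mulrDl addrA.
Qed.

Lemma MVT_exists (phi dphi : R -> R) (a b : R) : a <= b ->
  (forall t, a <= t <= b -> is_derive t 1 phi (dphi t)) ->
  exists2 c, a <= c <= b & phi b - phi a = dphi c * (b - a).
Proof.
move=> ab H.
have h1 x : x \in `]a, b[ -> is_derive x 1 phi (dphi x).
  by rewrite in_itv /= => /andP[xa xb]; apply: H; rewrite !ltW.
have h2 : {within `[a, b], continuous phi}.
  apply: derivable_within_continuous => x; rewrite in_itv /= => xab.
  by have [] := H x xab.
by have [c] := MVT_segment ab h1 h2; rewrite in_itv /= => cab ->; exists c.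
Qed.

Lemma MVT_along u z v t :
  (forall s : R, `|s| <= `|t| -> derivable (along u (z + s%:C * v) v) 0 1) ->
  exists2 s : R, `|s| <= `|t| & u (z + t%:C * v) - u z = t * partial u v (z + s%:C * v).
Proof.
move=> H; have der (s : R) : `|s| <= `|t| ->
    is_derive s 1 (along u z v) (partial u v (z + s%:C * v)).
  move=> st; apply: along_cd; rewrite /partial derive1E; apply: derivableP; exact: H.
have u0 : u z = along u z v 0 by rewrite /along mul0r addr0.
rewrite u0 -/(along u z v t); have [t0|t0] := leP 0 t.
  have [s|c /andP[c0 ct] E] := @MVT_exists (along u z v)
    (fun s => partial u v (z + s%:C * v)) _ _ t0.
    by move=> /andP[s0 st]; apply: der; rewrite !ger0_norm.
  by exists c; [rewrite !ger0_norm|rewrite E subr0 mulrC].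
have [s|c /andP[c0 ct] E] := @MVT_exists (along u z v)
    (fun s => partial u v (z + s%:C * v)) _ _ (ltW t0).
  move=> /andP[s0 st]; apply: der; rewrite !ler0_norm //; lra.
exists c; first by rewrite !ler0_norm //; lra.
by rewrite -opprB E; ring.
Qed.

(** The increment from z to z + h is taken along a vertical segment and then a horizontal one; the
    mean value theorem on each turns it into values of the partial derivatives at points close to z,
    where they are continuous. *)
Lemma C1_rd u z :
  (\forall w \near z, derivable (along u w 1) 0 1 /\ derivable (along u w 'i%C) 0 1) ->
  {for z, continuous (partial u 1)} -> {for z, continuous (partial u 'i%C)} ->
  rd (fun w => (u w)%:C) z (partial u 1 z)%:C (partial u 'i%C z)%:C.
Proof.
move=> /nbhsCP[d d0 hd] /contR c1 /contR c2 e e0.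
have /nbhsCP[d1 d10 h1] := c1 _ (half_pos e0).
have /nbhsCP[d2 d20 h2] := c2 _ (half_pos e0).
exists (Num.min d (Num.min d1 d2)); first by do 2! apply: min_gt0 => //.
move=> h; rewrite !lt_min => /and3P[hd0 hd1 hd2].
set x := complex.Re h; set y := complex.Im h.
have hE : h = x%:C * 1 + y%:C * 'i%C by rewrite [LHS]complexE mulr1 mulrC -/x -/y [X in _ + X]mulrC.
have near_ s t : `|s| <= `|x| -> `|t| <= `|y| -> nm (z + t%:C * 'i%C + s%:C * 1 - z) <= nm h.
  move=> sx ty; rewrite /nm ler_wsqrtr // /sqmod.
  rewrite (_ : _ - z = s +i* t); last by case: (z) => a b; simpc; congr (_ +i* _); ring.
  by rewrite /= lerD // -/x -/y -real_normK ?num_real // -[leRHS]real_normK ?num_real // lerXn2r ?nnegrE.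
have y0 : `|0 : R| <= `|y| by rewrite normr0.
have x0 : `|0 : R| <= `|x| by rewrite normr0.
have [s sx Es] := @MVT_along u (z + y%:C * 'i%C) 1 x
  (fun s sx => (hd _ (le_lt_trans (near_ s y sx (lexx _)) hd0)).1).
have [|t ty Et] := @MVT_along u z 'i%C y.
  move=> t ty; have := near_ 0 t x0 ty; rewrite mul0r addr0 => hh.
  exact: (hd _ (le_lt_trans hh hd0)).2.
have b1 := h1 _ (le_lt_trans (near_ s y sx (lexx _)) hd1).
have b2 : `|partial u 'i%C (z + t%:C * 'i%C) - partial u 'i%C z| < e / 2.
  by apply: h2; have := near_ 0 t x0 ty; rewrite mul0r addr0 => hh; exact: le_lt_trans hd2.
rewrite /dl -/x -/y -!rmorphM -rmorphD -!rmorphB nmR /=.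
have -> : u (z + h) - u z - (x * partial u 1 z + y * partial u 'i%C z) =
   x * (partial u 1 (z + y%:C * 'i%C + s%:C * 1) - partial u 1 z)
   + y * (partial u 'i%C (z + t%:C * 'i%C) - partial u 'i%C z).
  rewrite !mulrBr -Es -Et {1}hE [x%:C * 1 + _]addrC addrA; ring.
apply: (le_trans (ler_normD _ _)); rewrite !normrM.
have := Re_nm h; have := Im_nm h; rewrite -/x -/y => yh xh.
have : `|x| * `|partial u 1 (z + y%:C * 'i%C + s%:C * 1) - partial u 1 z| <= nm h * (e / 2).
  by rewrite ler_pM // ltW.
have : `|y| * `|partial u 'i%C (z + t%:C * 'i%C) - partial u 'i%C z| <= nm h * (e / 2).
  by rewrite ler_pM // ltW.
lra.
Qed.

End Derivatives.

(** * Smooth functions of the plane, studied point by point *)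

Section Smooth.
Context {R : realType}.
Local Notation C := R[i].
Implicit Types (f : C -> C) (z w v : C) (u : C -> R) (U V : set C) (n : nat).

(** Continuity and partial derivatives are taken in the whole plane and not within U, so regularity
    on U is a conjunction of conditions at single points. *)
Lemma CkE n U u : Ck n U u <-> forall z, U z -> Ck n [set z] u.
Proof.
elim: n u => [|n IH] u /=.
  split=> [[H _] z Uz|H]; first by split=> // _ ->; exact: H.
  by split=> // z Uz; have [+ _] := H z Uz; exact.
split=> [[c H] z Uz|H].
  split=> [_ ->|v hv]; first exact: c.
  have [d k] := H v hv; split=> [_ ->|]; first exact: d.
  exact: (IH _).1 k z Uz.
split=> [z Uz|v hv]; first by have [+ _] := H z Uz; exact.
split=> [z Uz|]; first by have [_ /(_ v hv)[+ _]] := H z Uz; exact.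
by apply/IH => z Uz; have [_ /(_ v hv)[_ +]] := H z Uz.
Qed.

(* [smn n u z] is C^n regularity on a neighbourhood of [z]. *)
Definition smn n u z := \forall w \near z, Ck n [set w] u.

(** One neighbourhood serves all n, which makes smoothness at a point an open condition. *)
Definition sm u z := \forall w \near z, forall n, Ck n [set w] u.

Definition sm2 f z := sm (@complex.Re R \o f) z /\ sm (@complex.Im R \o f) z.

Lemma near_near_C z (P : C -> Prop) : (\forall w \near z, P w) ->
  \forall w \near z, \forall t \near w, P t.
Proof.
move=> /nbhsCP[e e0 H]; apply/nbhsCP; exists e => // w wz.
apply/nbhsCP; exists (e - nm (w - z)); first lra.
by move=> t tw; apply: H; have := nm_tri t z w; lra.
Qed.

Lemma near_along u u' z v : (\forall w \near z, u w = u' w) ->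
  \forall s \near (0 : R), along u z v s = along u' z v s.
Proof.
move=> H; have c := cd_cont (@cd_line R z v 0).
have H' : nbhs (z + (0 : R)%:C * v) (fun w => u w = u' w) by rewrite mul0r addr0.
exact: c H'.
Qed.

Lemma near_derivable u u' z v : (\forall w \near z, u w = u' w) ->
  derivable (along u z v) 0 1 -> derivable (along u' z v) 0 1.
Proof. by move=> /(near_along v) H; apply: near_eq_derivable; rewrite ?oner_neq0. Qed.

Lemma near_partial u u' z v : (\forall w \near z, u w = u' w) ->
  \forall w \near z, partial u v w = partial u' v w.
Proof.
move=> /near_near_C; apply: filterS => w /(near_along v) H.
by rewrite /partial !derive1E; apply: near_eq_derive; rewrite ?oner_neq0.
Qed.

Lemma near_continuous (T : topologicalType) (W : topologicalType) (g g' : T -> W) (x : T) :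
  (\forall y \near x, g y = g' y) -> {for x, continuous g} -> {for x, continuous g'}.
Proof.
move=> H gx A; rewrite -(nbhs_singleton H) => /gx gA.
have gA' : \forall y \near x, A (g y) by [].
suff : \forall y \near x, A (g' y) by [].
by near=> y; rewrite -(near H y) //; near: y.
Unshelve. all: by end_near. Qed.

Lemma Ck_near n u u' z : (\forall w \near z, u w = u' w) ->
  Ck n [set z] u -> Ck n [set z] u'.
Proof.
elim: n u u' => [|n IH] u u' E /= [c H].
  by split=> // _ ->; apply: near_continuous E _; exact: c.
split=> [_ ->|v hv]; first by apply: near_continuous E _; exact: c.
have [d k] := H v hv; split=> [_ ->|]; first by apply: near_derivable E _; exact: d.
by apply: IH k; exact: near_partial.
Qed.

Lemma smn_near n u u' z : (\forall w \near z, u w = u' w) -> smn n u z -> smn n u' z.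
Proof.
move=> /near_near_C E H; near=> w; apply: (@Ck_near _ u); near: w => //.
Unshelve. all: by end_near. Qed.

Lemma sm_near u u' z : (\forall w \near z, u w = u' w) -> sm u z -> sm u' z.
Proof.
move=> /near_near_C E H; near=> w => n; apply: (@Ck_near _ u); first by near: w.
by move: n; near: w.
Unshelve. all: by end_near. Qed.

Lemma smn_cont n u z : smn n u z -> \forall w \near z, {for w, continuous u}.
Proof. by apply: filterS => w; case: n => [|n] [c _]; exact: c. Qed.

Lemma smnS n u z : smn n.+1 u z <->
  [/\ \forall w \near z, {for w, continuous u},
      \forall w \near z, derivable (along u w 1) 0 1 /\ derivable (along u w 'i%C) 0 1,
      smn n (partial u 1) z & smn n (partial u 'i%C) z].
Proof.
split=> [H|[c d H1 H2]].
  split; first exact: smn_cont H.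
  - apply: filterS H => w [_ H]; split.
      by have [+ _] := H 1 (or_introl erefl); exact.
    by have [+ _] := H 'i%C (or_intror erefl); exact.
  - by apply: filterS H => w [_ /(_ _ (or_introl erefl))[]].
  - by apply: filterS H => w [_ /(_ _ (or_intror erefl))[]].
apply: filterS3 d H1 (filterI c H2) => w [d1 d2] k1 [cw k2].
split=> [_ ->|v [] ->]; first exact: cw.
  by split=> [_ ->|]; [exact: d1|exact: k1].
by split=> [_ ->|]; [exact: d2|exact: k2].
Qed.

Lemma sm_smn u z n : sm u z -> smn n u z.
Proof. by apply: filterS => w. Qed.

Lemma smn1_rd n u z : smn n.+1 u z -> \forall w \near z,
  rd (fun w => (u w)%:C) w (partial u 1 w)%:C (partial u 'i%C w)%:C.
Proof.
move=> /smnS[_ /near_near_C d /smn_cont c1 /smn_cont c2].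
by apply: filterS3 d c1 c2 => w; exact: C1_rd.
Qed.

Lemma sm_rd u z : sm u z ->
  rd (fun w => (u w)%:C) z (partial u 1 z)%:C (partial u 'i%C z)%:C.
Proof. by move=> /(@sm_smn _ _ 1) /smn1_rd /nbhs_singleton. Qed.

Lemma sm_open u z : sm u z -> \forall w \near z, sm u w.
Proof. exact: near_near_C. Qed.

Lemma sm_partial1 u z : sm u z -> sm (partial u 1) z.
Proof. by apply: filterS => w H n; have [_ /(_ 1 (or_introl erefl))[]] := H n.+1. Qed.

Lemma sm_partiali u z : sm u z -> sm (partial u 'i%C) z.
Proof. by apply: filterS => w H n; have [_ /(_ 'i%C (or_intror erefl))[]] := H n.+1. Qed.

Lemma smoothP U u : open U -> smooth U u <-> forall z, U z -> sm u z.
Proof.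
move=> oU; split=> [H z Uz|H n].
  have : nbhs z U by exact: open_nbhs_nbhs.
  apply: filterS => w Uw n; by have /CkE := H n; exact.
by apply/CkE => z /H/nbhs_singleton.
Qed.

Lemma smooth_mapP U f : open U -> smooth_map U f <-> forall z, U z -> sm2 f z.
Proof.
move=> oU; rewrite /smooth_map !smoothP //; split=> [[h1 h2] z Uz|H].
  by split; [exact: h1|exact: h2].
by split=> z /H[].
Qed.

(* It suffices to check that the partial derivatives of the functions of a
   class of differentiable functions are sums and products that remain in
   C^n, C^n being handled by induction. *)
Lemma smn_rdS n u z (p q : C -> R) :
  (\forall w \near z, rd (fun w => (u w)%:C) w (p w)%:C (q w)%:C) ->
  smn n p z -> smn n q z -> smn n.+1 u z.
Proof.
move=> H hp hq; apply/smnS; split.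
- by apply: filterS H => w /rd_cont h; apply/contRC.
- by apply: filterS H => w h; split; [exact: (rd_partial 1 h).1|exact: (rd_partial 'i%C h).1].
- apply: smn_near hp; apply: filterS H => w h.
  by rewrite (rd_partial 1 h).2 dl1.
- apply: smn_near hq; apply: filterS H => w h.
  by rewrite (rd_partial 'i%C h).2 dli.
Qed.

Lemma smn0 u z : (\forall w \near z, {for w, continuous u}) -> smn 0 u z.
Proof. by apply: filterS => w c; split=> // _ ->. Qed.

Lemma smn_le n u z : smn n.+1 u z -> smn n u z.
Proof.
elim: n u => [|n IH] u; first by move=> /smn_cont; exact: smn0.
by move=> /smnS[c d /IH h1 /IH h2]; apply/smnS.
Qed.

Lemma smnD n u u' z : smn n u z -> smn n u' z -> smn n (fun w => u w + u' w) z.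
Proof.
elim: n u u' => [|n IH] u u' h h'.
  have c := smn_cont h; have c' := smn_cont h'; apply: smn0; near=> w.
  have cw : {for w, continuous u} by near: w.
  have cw' : {for w, continuous u'} by near: w.
  exact: cvgD cw cw'.
have r := smn1_rd h; have r' := smn1_rd h'.
have /smnS[_ _ h1 h2] := h; have /smnS[_ _ h1' h2'] := h'.
apply: (@smn_rdS _ _ _ (fun w => partial u 1 w + partial u' 1 w)
                       (fun w => partial u 'i%C w + partial u' 'i%C w)); last 2 first.
- exact: IH.
- exact: IH.
apply: filterS2 r r' => w rw rw'.
apply: rd_ext (rd_eq (rdD rw rw') _ _) => [t||]; first by rewrite rmorphD.
- by rewrite rmorphD.
- by rewrite rmorphD.
Unshelve. all: by end_near. Qed.

Lemma smnM n u u' z : smn n u z -> smn n u' z -> smn n (fun w => u w * u' w) z.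
Proof.
elim: n u u' => [|n IH] u u' h h'.
  have c := smn_cont h; have c' := smn_cont h'; apply: smn0; near=> w.
  have cw : {for w, continuous u} by near: w.
  have cw' : {for w, continuous u'} by near: w.
  exact: cvgM cw cw'.
have r := smn1_rd h; have r' := smn1_rd h'.
have /smnS[_ _ h1 h2] := h; have /smnS[_ _ h1' h2'] := h'.
have l := smn_le h; have l' := smn_le h'.
apply: (@smn_rdS _ _ _ (fun w => partial u 1 w * u' w + u w * partial u' 1 w)
            (fun w => partial u 'i%C w * u' w + u w * partial u' 'i%C w)); last 2 first.
- by apply: smnD; apply: IH.
- by apply: smnD; apply: IH.
apply: filterS2 r r' => w rw rw'.
apply: rd_ext (rd_eq (rdM rw rw') _ _) => [t||]; first by rewrite rmorphM.
- by rewrite rmorphD !rmorphM.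
- by rewrite rmorphD !rmorphM.
Unshelve. all: by end_near. Qed.

Lemma smn_cst n (a : R) z : smn n (fun=> a) z.
Proof.
elim: n a => [|n IH] a; first by apply: smn0; apply: filterE => w; exact: cst_continuous.
by apply: (@smn_rdS _ _ _ (fun=> 0) (fun=> 0)) => //; apply: filterE => w; exact: rd_cst.
Qed.

Lemma smP u z : sm u z <-> exists2 e : R, 0 < e &
  forall n w, nm (w - z) < e -> smn n u w.
Proof.
split=> [/near_near_C/nbhsCP[e e0 H]|[e e0 H]].
  by exists e => // n w /H; apply: filterS.
by apply/nbhsCP; exists e => // w wz n; have /nbhs_singleton := H n w wz.
Qed.

(** An induction on n at a fixed point would yield neighbourhoods shrinking with n. An open
    condition [P], sufficient for C^n regularity near each point where it holds, provides a
    neighbourhood independent of n. *)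
Lemma sm_ind (P : C -> Prop) u z : (\forall w \near z, P w) ->
  (forall w n, P w -> smn n u w) -> sm u z.
Proof.
move=> /nbhsCP[e e0 H] K; apply/smP; exists e => // n w /H; exact: K.
Qed.

Lemma smD u u' z : sm u z -> sm u' z -> sm (fun w => u w + u' w) z.
Proof.
move=> /sm_open h /sm_open h'; apply: (@sm_ind (fun w => sm u w /\ sm u' w)).
  exact: filterI.
by move=> w n [/sm_smn ? /sm_smn ?]; exact: smnD.
Unshelve. all: by end_near. Qed.

Lemma smM u u' z : sm u z -> sm u' z -> sm (fun w => u w * u' w) z.
Proof.
move=> /sm_open h /sm_open h'; apply: (@sm_ind (fun w => sm u w /\ sm u' w)).
  exact: filterI.
by move=> w n [/sm_smn ? /sm_smn ?]; exact: smnM.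
Unshelve. all: by end_near. Qed.

Lemma sm_cst (a : R) z : sm (fun=> a) z.
Proof.
by apply: (@sm_ind (fun=> True)) => [|w n _]; [near=> w|exact: smn_cst].
Unshelve. all: by end_near. Qed.

Lemma sm_Re z : sm (@complex.Re R) z.
Proof.
apply: (@sm_ind (fun=> True)) => [|w [|n] _]; first by near=> w.
  by apply: smn0; near=> t; apply/contRC; exact: rd_cont (rd_Re _).
by apply: (@smn_rdS _ _ _ (fun=> 1) (fun=> 0)); rewrite ?smn_cst //;
  [near=> t; exact: rd_Re|exact: smn_cst|exact: smn_cst].
Unshelve. all: by end_near. Qed.

Lemma sm_Im z : sm (@complex.Im R) z.
Proof.
apply: (@sm_ind (fun=> True)) => [|w [|n] _]; first by near=> w.
  by apply: smn0; near=> t; apply/contRC; exact: rd_cont (rd_Im _).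
by apply: (@smn_rdS _ _ _ (fun=> 0) (fun=> 1)); rewrite ?smn_cst //;
  [near=> t; exact: rd_Im|exact: smn_cst|exact: smn_cst].
Unshelve. all: by end_near. Qed.

Lemma sm2_rd f z : sm2 f z -> exists p q, rd f z p q.
Proof.
move=> [/sm_rd h1 /sm_rd h2]; eexists; eexists; apply: rd_ext (rd_pair h1 h2) => w /=.
by case: (f w).
Qed.

Lemma sm2_open f z : sm2 f z -> \forall w \near z, sm2 f w.
Proof.
move=> [/sm_open h1 /sm_open h2]; exact: filterI.
Qed.

Lemma sm2_cont f z : sm2 f z -> {for z, continuous f}.
Proof. by move=> /sm2_rd[p [q /rd_cont]]. Qed.

Lemma sm2_near f g z : (\forall w \near z, f w = g w) -> sm2 f z -> sm2 g z.
Proof.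
by move=> E [h1 h2]; split; [apply: sm_near h1|apply: sm_near h2];
  apply: filterS E => w /= ->.
Qed.

Lemma cont_near (T W : topologicalType) (g : T -> W) (x : T) (P : W -> Prop) :
  {for x, continuous g} -> (\forall y \near g x, P y) -> \forall y \near x, P (g y).
Proof. by move=> gx Px; exact: gx P Px. Qed.

(** By the chain rule the partial derivatives of u o f are sums of products of those of f with
    compositions (partial of u) o f. The induction on n thus ranges over all u, with f fixed. *)
Lemma sm_comp u f z : sm2 f z -> sm u (f z) -> sm (u \o f) z.
Proof.
move=> h1 h2.
have cf := sm2_cont h1.
apply: (@sm_ind (fun w => sm2 f w /\ sm u (f w))).
  apply: filterI; first exact: sm2_open.
  exact: (@cont_near _ _ _ _ (sm u) cf (sm_open h2)).
move=> {cf h1 h2 z} + n; elim: n u => [|n IH] u z [hf hu].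
  apply: smn0; have := sm2_open hf; have := @cont_near _ _ _ _ (sm u) (sm2_cont hf) (sm_open hu).
  apply: filterS2 => w H' H; apply: continuous_comp; first exact: sm2_cont.
  by apply/contRC; exact: rd_cont (sm_rd H').
have cf := @cont_near _ _ _ _ (sm u) (sm2_cont hf) (sm_open hu).
have Hf := sm2_open hf.
pose p v w := partial u 1 (f w) * partial (@complex.Re R \o f) v w
   + partial u 'i%C (f w) * partial (@complex.Im R \o f) v w.
apply: (@smn_rdS _ _ _ (p 1) (p 'i%C)).
- apply: filterS2 cf Hf => w ku [k1 k2].
  have rf : rd f w (partial (@complex.Re R \o f) 1 w +i* partial (@complex.Im R \o f) 1 w)
     (partial (@complex.Re R \o f) 'i%C w +i* partial (@complex.Im R \o f) 'i%C w).
    by apply: rd_ext (rd_pair (sm_rd k1) (sm_rd k2)) => t /=; case: (f t).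
  apply: rd_eq (rd_comp rf (sm_rd ku)) _ _; rewrite /dl /p /=;
    by rewrite rmorphD !rmorphM /= [_ * _]mulrC [X in _ + X = _]mulrC.
- apply: smnD; apply: smnM.
  + by apply: IH; split=> //; exact: sm_partial1.
  + by apply: sm_smn; exact: sm_partial1 hf.1.
  + by apply: IH; split=> //; exact: sm_partiali.
  + by apply: sm_smn; exact: sm_partial1 hf.2.
- apply: smnD; apply: smnM.
  + by apply: IH; split=> //; exact: sm_partial1.
  + by apply: sm_smn; exact: sm_partiali hf.1.
  + by apply: IH; split=> //; exact: sm_partiali.
  + by apply: sm_smn; exact: sm_partiali hf.2.
Unshelve. all: by end_near. Qed.

Lemma sm2_comp f g z : sm2 f z -> sm2 g (f z) -> sm2 (g \o f) z.
Proof. by move=> h [h1 h2]; split; [exact: sm_comp h1|exact: sm_comp h2]. Qed.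

Lemma rd_powR u z (a p q : R) : 0 < u z -> rd (fun w => (u w)%:C) z p%:C q%:C ->
  rd (fun w => (powR (u w) a)%:C) z (a * powR (u z) (a - 1) * p)%:C
     (a * powR (u z) (a - 1) * q)%:C.
Proof.
move=> u0 ru; have := cd_real (is_derive1_powR a u0) => h.
apply: rd_ext (rd_eq (rd_comp ru h) _ _) => //; by rewrite /dl mulr0 addr0 /= -rmorphM mulrC.
Qed.

(** Differentiation lowers the exponent by one, so the induction on n is over all exponents. *)
Lemma sm_powR u z (a : R) : 0 < u z -> sm u z -> sm (fun w => powR (u w) a) z.
Proof.
move=> u0 h.
have open_pos t : 0 < u t -> sm u t -> \forall w \near t, 0 < u w /\ sm u w.
  move=> t0 ht; have c : {for t, continuous u}.
    by apply/contRC; exact: rd_cont (sm_rd ht).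
  have /contR/(_ _ t0) c' := c; have o := sm_open ht.
  apply: filterS2 c' o => w; rewrite ltr_norml => H ow; split=> //; lra.
apply: (@sm_ind (fun w => 0 < u w /\ sm u w)); first exact: open_pos.
move=> {u0 h z} z n; elim: n a z => [|n IH] a z [u0 h].
  apply: smn0; have := open_pos z u0 h ; apply: filterS => w [p k].
  by apply/contRC; exact: rd_cont (rd_powR a p (sm_rd k)).
apply: (@smn_rdS _ _ _ (fun w => a * powR (u w) (a - 1) * partial u 1 w)
   (fun w => a * powR (u w) (a - 1) * partial u 'i%C w)).
- have := open_pos z u0 h ; apply: filterS => w [p k].
  exact: rd_powR (sm_rd k).
- apply: smnM; first by apply: smnM; [exact: smn_cst|exact: IH].
  by apply: sm_smn; exact: sm_partial1.
- apply: smnM; first by apply: smnM; [exact: smn_cst|exact: IH].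
  by apply: sm_smn; exact: sm_partiali.
Unshelve. all: by end_near. Qed.

End Smooth.

(** * Holomorphic functions *)

Section Clamp.
Context {R : realType}.
Implicit Types s t : R.

Lemma clamp_itv t : 0 <= clamp t <= 1.
Proof. by rewrite /clamp le_max lexx /= ge_max ler01 ge_min lexx orbT. Qed.

Lemma clamp_id t : 0 <= t <= 1 -> clamp t = t.
Proof. by move=> /andP[t0 t1]; rewrite /clamp (min_l t1) (max_r t0). Qed.

Lemma clamp_lip s t : `|clamp s - clamp t| <= `|s - t|.
Proof.
rewrite /clamp /Num.max /Num.min.
by do !case: ifP; rewrite ?ltNge => *; rewrite ler_norml; apply/andP; split;
  move: (ler_norm (s - t)) (ler_norm (- (s - t))); rewrite normrN; lra.
Qed.

Lemma clamp_continuous : continuous (@clamp R).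
Proof.
move=> t; apply/contR => e e0; apply/nbhsRP; exists e => // s.
exact: le_lt_trans (clamp_lip _ _).
Qed.

End Clamp.

(** * Integrals over the unit interval and along segments *)

Section Integral.
Context {R : realType}.
Local Notation C := R[i].
Implicit Types (f g : C -> C) (z w p q h v : C) (phi psi : R -> C) (t : R).

Definition contI phi := forall t, 0 <= t <= 1 -> {for t, continuous phi}.

(* [v] is the integral of [phi] over the unit interval. *)
Definition isI phi v := exists Phi : R -> C,
  [/\ contI Phi, forall t, 0 < t < 1 -> cd Phi t (phi t) & v = Phi 1 - Phi 0].

Definition Itg phi : C := xget 0 [set v | isI phi v].

(** Mean value inequality for plane curves: with D the displacement, the real function Re (conj D *
    Phi) has increment |D|^2 and derivative at most |D| B. *)
Lemma curve_mean (Phi phi : R -> C) (B : R) : contI Phi ->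
  (forall t, 0 < t < 1 -> cd Phi t (phi t)) ->
  (forall t, 0 < t < 1 -> nm (phi t) <= B) -> nm (Phi 1 - Phi 0) <= B.
Proof.
move=> c d b; set D := Phi 1 - Phi 0.
have [D0|D0] := eqVneq D 0.
  rewrite D0 nm0; apply: le_trans (nm_ge0 _) (b (1 / 2) _).
  by apply/andP; split; lra.
have nD : 0 < nm D by rewrite nm_gt0.
have dpsi (x : R) : x \in `]0, 1[%R ->
    is_derive x 1 (fun t => complex.Re (D^*%C * Phi t)) (complex.Re (D^*%C * phi x)).
  rewrite in_itv /= => /d h; apply: cd_Re.
  apply: cd_eq (cdM (cd_cst (D^*%C) x) h) _; by rewrite mul0r add0r.
have H (x : R) : 0 <= x <= 1 -> {for x, continuous (fun t => complex.Re (D^*%C * Phi t))}.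
  by move=> /c cx; exact: cont_Re (contM (@cont_cst _ _ _ _) cx).
have cpsi : {within `[0, 1], continuous (fun t => complex.Re (D^*%C * Phi t))}.
  by apply: continuous_in_subspaceT => x /set_mem /=; rewrite in_itv /=; exact: H.
have [x] := MVT ltr01 dpsi cpsi.
rewrite in_itv /= => x01; rewrite subr0 mulr1 -raddfB -mulrBr -/D => E.
have E' : nm D ^+ 2 = complex.Re (D^*%C * phi x).
  by rewrite -E nm_sqr /sqmod; case: (D) => a b' /=; rewrite !expr2; ring.
have : complex.Re (D^*%C * phi x) <= nm D * B.
  apply: le_trans (ler_norm _) _; apply: le_trans (Re_nm _) _.
  by rewrite nmM nm_conj ler_wpM2l ?nm_ge0 //; exact: b.
by rewrite -E' expr2 ler_pM2l.
Qed.

Lemma contIB phi psi : contI phi -> contI psi -> contI (fun t => phi t - psi t).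
Proof. by move=> c1 c2 t t01; exact: contB (c1 t t01) (c2 t t01). Qed.

Lemma isI_unique phi psi v v' : isI phi v -> isI psi v' ->
  (forall t, 0 < t < 1 -> phi t = psi t) -> v = v'.
Proof.
move=> [Phi [c d ->]] [Psi [c' d' ->]] E; apply/eqP; rewrite -subr_eq0 -nm_eq0.
rewrite eq_le nm_ge0 andbT.
have := @curve_mean (fun t => Phi t - Psi t) (fun=> 0) 0 (contIB c c').
rewrite (_ : Phi 1 - Phi 0 - (Psi 1 - Psi 0) = Phi 1 - Psi 1 - (Phi 0 - Psi 0)); last ring.
apply=> t t01; last by rewrite nm0.
have h := rdB (d t t01) (d' t t01).
apply: rd_eq h _ _; last by rewrite subrr.
by rewrite E // subrr.
Qed.

(** The interval of integration exceeds [0, 1] on both sides, so that the derivative is two-sided at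
    0 and at 1. *)
Lemma real_primitive (phi : R -> R) : continuous phi ->
  exists Phi : R -> R, forall t, -1 < t < 2 -> is_derive t 1 Phi (phi t).
Proof.
move=> c; pose F x := (\int[lebesgue_measure]_(t in [set` `[(-1 : R), x]]) (phi t))%R.
exists F => t /andP[t1 t2].
have ig : lebesgue_measure.-integrable `[(-1 : R), 2] (EFin \o phi).
  apply: continuous_compact_integrable; first exact: segment_compact.
  exact: continuous_subspaceT.
have [d e] := continuous_FTC1_closed t2 ig t1 (c t).
by rewrite -e derive1E; exact: derivableP.
Qed.

Lemma isI_exists phi : contI phi -> exists v, isI phi v.
Proof.
(* Continuity of [phi] is assumed at the points of [0, 1] only; [clamp] extends it to the line. *)
move=> c; pose psi t := phi (clamp t).
have cpsi : continuous psi.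
  move=> t; apply: continuous_comp; first exact: clamp_continuous.
  by apply: c; exact: clamp_itv.
have [P1 h1] := real_primitive (fun t => cont_Re (cpsi t)).
have [P2 h2] := real_primitive (fun t => cont_Im (cpsi t)).
pose P t := P1 t +i* P2 t; exists (P 1 - P 0); exists P.
have d t : 0 <= t <= 1 -> cd P t (psi t).
  move=> /andP[t0 t1]; apply: cd_pair => /=; [apply: h1|apply: h2]; lra.
split=> [t t01|t t01|]; [exact: cd_cont (d t t01)| |by []].
apply: cd_eq (d t _) _; first lra.
by rewrite /psi clamp_id //; lra.
Qed.

Lemma ItgP phi : contI phi -> isI phi (Itg phi).
Proof. by move=> /isI_exists h; exact: xgetPex. Qed.

Lemma ItgE phi v : isI phi v -> Itg phi = v.
Proof.
move=> h; apply: (@isI_unique phi phi) => //; exact: xgetI h.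
Qed.

Lemma isI_congr phi psi v : isI phi v -> (forall t, 0 < t < 1 -> phi t = psi t) -> isI psi v.
Proof.
by move=> [Phi [c d e]] E; exists Phi; split=> // t t01; rewrite -E //; exact: d.
Qed.

Lemma isID phi psi v v' : isI phi v -> isI psi v' -> isI (fun t => phi t + psi t) (v + v').
Proof.
move=> [Phi [c d ->]] [Psi [c' d' ->]]; exists (fun t => Phi t + Psi t); split.
- by move=> t t01; exact: contD (c t t01) (c' t t01).
- by move=> t t01; apply: cdD; [exact: d|exact: d'].
- by ring.
Qed.

Lemma isIZ phi v (a : C) : isI phi v -> isI (fun t => a * phi t) (a * v).
Proof.
move=> [Phi [c d ->]]; exists (fun t => a * Phi t); split.
- by move=> t t01; exact: contM (@cont_cst _ _ _ _) (c t t01).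
- by move=> t t01; apply: cd_eq (cdM (cd_cst a t) (d t t01)) _; rewrite mul0r add0r.
- by rewrite mulrBr.
Qed.

Lemma isIB phi psi v v' : isI phi v -> isI psi v' -> isI (fun t => phi t - psi t) (v - v').
Proof.
move=> h /(isIZ (-1)) h'; rewrite -mulN1r; apply: isI_congr (isID h h') _ => t _.
by rewrite mulN1r.
Qed.

Lemma isI_bound phi v (B : R) : isI phi v -> (forall t, 0 < t < 1 -> nm (phi t) <= B) ->
  nm v <= B.
Proof. by move=> [Phi [c d ->]]; exact: curve_mean. Qed.

Lemma isI_cst (a : C) : isI (fun=> a) a.
Proof.
exists (fun t : R => 0 + t%:C * a); split=> [t _|t _|]; last by ring.
  exact: cd_cont (cd_line 0 a t).
exact: cd_line.
Qed.

Lemma isI_cd (ga : R -> C) phi : (forall t, 0 <= t <= 1 -> cd ga t (phi t)) ->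
  isI phi (ga 1 - ga 0).
Proof.
move=> h; exists ga; split=> [t t01|t t01|]; [exact: cd_cont (h t t01)| |by []].
by apply: h; lra.
Qed.

Definition lin (a b : C) t := a + t%:C * (b - a).

Definition seg f a b := (b - a) * Itg (fun t => f (lin a b t)).

Lemma lin0 a b : lin a b 0 = a. Proof. by rewrite /lin mul0r addr0. Qed.

Lemma lin1 a b : lin a b 1 = b. Proof. by rewrite /lin mul1r addrC subrK. Qed.

Lemma lin_cd a b t : cd (lin a b) t (b - a).
Proof. exact: cd_line. Qed.

Lemma lin_nm a b t z : 0 <= t <= 1 ->
  nm (lin a b t - z) <= (1 - t) * nm (a - z) + t * nm (b - z).
Proof.
move=> /andP[t0 t1]; rewrite (_ : _ - z = (1 - t)%:C * (a - z) + t%:C * (b - z)).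
  by apply: le_trans (nmD _ _) _; rewrite !nmM !nmR !ger0_norm // subr_ge0.
by rewrite /lin rmorphB rmorph1 /=; ring.
Qed.

Lemma lin_ball a b t z (r : R) : 0 <= t <= 1 ->
  nm (a - z) < r -> nm (b - z) < r -> nm (lin a b t - z) < r.
Proof.
move=> t01 ha hb; apply: le_lt_trans (lin_nm a b z t01) _.
move: t01 => /andP[t0 t1]; have [t2|t2] := ltP 0 t; last first.
  by rewrite (le_anti (introT andP (conj t2 t0))) subr0 mul1r mul0r addr0.
have : 0 < t * (r - nm (b - z)) by rewrite mulr_gt0 // subr_gt0.
have : 0 <= (1 - t) * (r - nm (a - z)) by rewrite mulr_ge0 // subr_ge0 // ltW.
lra.
Qed.

Lemma lin_cball a b t z (r : R) : 0 <= t <= 1 ->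
  nm (a - z) <= r -> nm (b - z) <= r -> nm (lin a b t - z) <= r.
Proof.
move=> t01 ha hb; apply: le_trans (lin_nm a b z t01) _.
move: t01 => /andP[t0 t1].
have : 0 <= t * (r - nm (b - z)) by rewrite mulr_ge0 // subr_ge0.
have : 0 <= (1 - t) * (r - nm (a - z)) by rewrite mulr_ge0 // subr_ge0.
lra.
Qed.

Lemma seg_cont f a b : (forall t, 0 <= t <= 1 -> {for lin a b t, continuous f}) ->
  contI (fun t => f (lin a b t)).
Proof.
move=> c t t01; apply: (@continuous_comp _ _ _ (lin a b) f); last exact: c.
exact: cd_cont (lin_cd a b t).
Qed.

Lemma seg_FTC F f a b : (forall t, 0 <= t <= 1 -> cder F (lin a b t) (f (lin a b t))) ->
  seg f a b = F b - F a.
Proof.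
move=> h; have k : isI (fun t => f (lin a b t) * (b - a)) (F b - F a).
  rewrite -[in F b](lin1 a b) -[in F a](lin0 a b).
  apply: (@isI_cd (F \o lin a b)) => t t01.
  exact: cd_ccomp (lin_cd a b t) (h t t01).
have [ab|ab] := eqVneq a b; first by rewrite /seg ab !subrr mul0r.
have ba : b - a != 0 by rewrite subr_eq0 eq_sym.
have := isIZ (b - a)^-1 k => k'.
rewrite /seg (@ItgE _ ((b - a)^-1 * (F b - F a))) ?mulVKf //.
by apply: isI_congr k' _ => t _; rewrite mulrC mulfK.
Qed.

Lemma seg_rev f a b : (forall t, 0 <= t <= 1 -> {for lin a b t, continuous f}) ->
  seg f b a = - seg f a b.
Proof.
move=> /seg_cont/ItgP h; rewrite /seg -mulNr opprB; congr (_ * _).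
case: h => Phi [c d E]; rewrite E; apply: ItgE.
exists (fun s => - Phi (-1 * s + 1)); split.
- move=> t t01; apply: contN; apply: cont_comp (@cont_affine _ _ _ _) _.
  by apply: c => /=; lra.
- move=> t t01; have t01' : 0 < -1 * t + 1 < 1 by lra.
  apply: cd_eq (rd_eq (rdN (cd_affine (d _ t01'))) erefl (oppr0 _)) _.
  have e1 : (-1)%:C = -1 :> C by exact: rmorphN1.
  rewrite e1 -mulNr opprK mul1r; congr f.
  by rewrite /lin rmorphD rmorphM /= e1; ring.
- by rewrite mulr1 addNr mulr0 add0r; ring.
Qed.

Lemma seg_mid f a b : (forall t, 0 <= t <= 1 -> {for lin a b t, continuous f}) ->
  seg f a b = seg f a ((a + b) / 2) + seg f ((a + b) / 2) b.
Proof.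
move=> /seg_cont/ItgP h; rewrite {1}/seg.
case: h => Phi [c d ->].
have two : (2 : C) != 0 by rewrite pnatr_eq0.
have hC : (1 / 2 : R)%:C = 1 / 2 :> C.
  by rewrite rmorphM fmorphV rmorph1 rmorph_nat.
have key (k : R) : 0 <= k <= 1 / 2 ->
    isI (fun t => f (lin a b ((1 / 2) * t + k))) (2 * (Phi (1 / 2 + k) - Phi k)).
  move=> k01; exists (fun s => 2 * Phi ((1 / 2) * s + k)); split.
  - move=> t t01; apply: contM (@cont_cst _ _ _ _) _; apply: cont_comp (@cont_affine _ _ _ _) _.
    by apply: c => /=; lra.
  - move=> t t01; have t01' : 0 < 1 / 2 * t + k < 1 by lra.
    apply: cd_eq (cdM (cd_cst 2 t) (cd_affine (d _ t01'))) _.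
    by rewrite hC; field.
  - by rewrite mulr1 mulr0 add0r mulrBr.
rewrite /seg (@ItgE _ (2 * (Phi (1 / 2 + 0) - Phi 0))); last first.
  apply: isI_congr (key 0 _) _; first by lra.
  by move=> t _; congr f; rewrite /lin rmorphD rmorphM /= hC; field.
rewrite (@ItgE _ (2 * (Phi (1 / 2 + 1 / 2) - Phi (1 / 2)))); last first.
  apply: isI_congr (key (1 / 2) _) _; first by lra.
  by move=> t _; congr f; rewrite /lin rmorphD rmorphM /= hC; field.
rewrite addr0 (_ : 1 / 2 + 1 / 2 = 1 :> R); last by lra.
by field.
Qed.

End Integral.

Section Completeness.
Context {R : realType}.
Local Notation C := R[i].

Lemma nested_intervals (l u : nat -> R) : (forall k m, l k <= u m) ->
  exists x, forall k, l k <= x <= u k.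
Proof.
move=> lu; have hs : has_sup (range l).
  split; first by exists (l 0%N); exists 0%N.
  by exists (u 0%N) => _ [k _ <-]; exact: lu.
exists (sup (range l)) => k; apply/andP; split.
  by apply: ub_le_sup; [exact: hs.2|exists k].
by apply: ge_sup; [exact: hs.1|move=> _ [m _ <-]; exact: lu].
Qed.

(** The intervals of radius 2 s / 2^n about x n are nested, and a common point is the limit, with
    this rate. *)
Lemma half_powers_cauchy (x : nat -> R) (s : R) : 0 <= s ->
  (forall n, `|x n.+1 - x n| <= s / 2 ^+ n) ->
  exists y, forall n, `|x n - y| <= 2 * s / 2 ^+ n.
Proof.
move=> s0 H; pose d n : R := s / 2 ^+ n.
have d0 n : 0 <= d n by rewrite divr_ge0 // exprn_ge0.
have dS n : d n = d n.+1 *+ 2.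
  by rewrite /d exprS mulr2n; field; rewrite expf_neq0.
pose l n := x n - d n *+ 2; pose u n := x n + d n *+ 2.
have lS n : l n <= l n.+1.
  have := H n; rewrite -/(d n) ler_norml /l => /andP[h1 h2].
  by have := dS n; rewrite !mulr2n => E; lra.
have uS n : u n.+1 <= u n.
  have := H n; rewrite -/(d n) ler_norml /u => /andP[h1 h2].
  by have := dS n; rewrite !mulr2n => E; lra.
have lm : {homo l : m n / (m <= n)%N >-> m <= n}.
  by apply: homo_leq => // y z t; exact: le_trans.
have um : {homo u : m n / (m <= n)%N >-> n <= m}.
  by apply: homo_leq => // y z t h1 h2; exact: le_trans h2 h1.
have lu k m : l k <= u m.
  apply: (le_trans (lm _ _ (leq_maxl k m))).
  apply: le_trans (um _ _ (leq_maxr k m)).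
  by rewrite /l /u; have := d0 (maxn k m); rewrite mulr2n; lra.
have [y hy] := nested_intervals lu; exists y => n.
have := hy n; rewrite /l /u ler_norml -mulrA -/(d n) mulr2n => /andP[h1 h2].
by apply/andP; split; lra.
Qed.

Lemma C_half_powers_cauchy (a : nat -> C) (s : R) : 0 <= s ->
  (forall n, nm (a n.+1 - a n) <= s / 2 ^+ n) ->
  exists b, forall n, nm (a n - b) <= 4 * s / 2 ^+ n.
Proof.
move=> s0 H.
have hr n : `|complex.Re (a n.+1) - complex.Re (a n)| <= s / 2 ^+ n.
  by apply: le_trans (H n); rewrite -raddfB Re_nm.
have hi n : `|complex.Im (a n.+1) - complex.Im (a n)| <= s / 2 ^+ n.
  by apply: le_trans (H n); rewrite -raddfB Im_nm.
have [x hx] := half_powers_cauchy s0 hr; have [y hy] := half_powers_cauchy s0 hi.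
exists (x +i* y) => n; apply: le_trans (nm_le _) _; rewrite !raddfB /=.
have := hx n; have := hy n; rewrite -!mulrA; lra.
Qed.

End Completeness.

(** * Goursat's theorem and primitives on a disk *)

Section Goursat.
Context {R : realType} (f : R[i] -> R[i]) (z0 : R[i]) (r : R)
  (fder : forall z, nm (z - z0) < r -> exists p, cder f z p).
Local Notation C := R[i].
Implicit Types (a b c z : C).

Let fcont z : nm (z - z0) < r -> {for z, continuous f}.
Proof. by move=> /fder[p /rd_cont]. Qed.

Let scont a b : nm (a - z0) < r -> nm (b - z0) < r ->
  forall t : R, 0 <= t <= 1 -> {for lin a b t, continuous f}.
Proof. by move=> ha hb t t01; apply: fcont; exact: lin_ball. Qed.

Definition tri (g : C -> C) a b c := seg g a b + seg g b c + seg g c a.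

Let half_ball a b : nm (a - z0) < r -> nm (b - z0) < r -> nm ((a + b) / 2 - z0) < r.
Proof.
move=> ha hb; have := @lin_ball _ a b (1 / 2) z0 r _ ha hb.
rewrite (_ : lin a b (1 / 2) = (a + b) / 2); first by apply; lra.
by rewrite /lin rmorphM fmorphV rmorph1 rmorph_nat; field.
Qed.

Lemma tri_split a b c : nm (a - z0) < r -> nm (b - z0) < r -> nm (c - z0) < r ->
  tri f a b c = tri f a ((a + b) / 2) ((c + a) / 2) + tri f ((a + b) / 2) b ((b + c) / 2)
    + tri f ((c + a) / 2) ((b + c) / 2) c + tri f ((a + b) / 2) ((b + c) / 2) ((c + a) / 2).
Proof.
move=> ha hb hc; have hab := half_ball ha hb; have hbc := half_ball hb hc.
have hca := half_ball hc ha.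
rewrite /tri (seg_mid (scont ha hb)) (seg_mid (scont hb hc)) (seg_mid (scont hc ha)).
rewrite (seg_rev (scont hab hca)) (seg_rev (scont hbc hab)) (seg_rev (scont hca hbc)).
by ring.
Qed.

Let nm_half a : nm (a / 2) = nm a / 2.
Proof. by rewrite nmM nmV -[2 in LHS](rmorph_nat (real_complex R)) nmR ger0_norm. Qed.

(* One of the four half-size triangles carries at least a quarter of the
   integral. *)
Lemma tri_child (T : C * C * C) (s : R) : let: (a, b, c) := T in
  [/\ nm (a - z0) <= s, nm (b - z0) <= s & nm (c - z0) <= s] -> s < r ->
  exists T' : C * C * C, let: (a', b', c') := T' in
  [/\ [/\ nm (a' - z0) <= s, nm (b' - z0) <= s & nm (c' - z0) <= s],
      nm (tri f a b c) <= 4 * nm (tri f a' b' c') &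
      forall d, nm (b - a) <= d -> nm (c - b) <= d -> nm (a - c) <= d ->
       nm (a' - a) <= d /\ [/\ nm (b' - a') <= d / 2, nm (c' - b') <= d / 2 & nm (a' - c') <= d / 2]].
Proof.
case: T => -[a b] c [ha hb hc] sr.
have hh x y : nm (x - z0) <= s -> nm (y - z0) <= s -> nm ((x + y) / 2 - z0) <= s.
  move=> hx hy; have := @lin_cball _ x y (1 / 2) z0 s _ hx hy.
  rewrite (_ : lin x y (1 / 2) = (x + y) / 2); first by apply; lra.
  by rewrite /lin rmorphM fmorphV rmorph1 rmorph_nat; field.
have E := tri_split (le_lt_trans ha sr) (le_lt_trans hb sr) (le_lt_trans hc sr).
set m1 := (a + b) / 2 in E; set m2 := (b + c) / 2 in E; set m3 := (c + a) / 2 in E.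
have h1 : nm (m1 - z0) <= s by exact: hh.
have h2 : nm (m2 - z0) <= s by exact: hh.
have h3 : nm (m3 - z0) <= s by exact: hh.
have [k|k1] := leP (nm (tri f a b c)) (4 * nm (tri f a m1 m3)).
  exists (a, m1, m3); split=> // d d1 d2 d3; split.
    by rewrite subrr nm0; apply: le_trans d1; exact: nm_ge0.
  rewrite (_ : m1 - a = (b - a) / 2); last by rewrite /m1; field.
  rewrite (_ : m3 - m1 = (c - b) / 2); last by rewrite /m1 /m3; field.
  rewrite (_ : a - m3 = (a - c) / 2); last by rewrite /m3; field.
  by rewrite !nm_half; split; lra.
have [k|k2] := leP (nm (tri f a b c)) (4 * nm (tri f m1 b m2)).
  exists (m1, b, m2); split=> // d d1 d2 d3; split.
    rewrite (_ : m1 - a = (b - a) / 2); last by rewrite /m1; field.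
    by rewrite nm_half; have := nm_ge0 (b - a); lra.
  rewrite (_ : b - m1 = (b - a) / 2); last by rewrite /m1; field.
  rewrite (_ : m2 - b = (c - b) / 2); last by rewrite /m2; field.
  rewrite (_ : m1 - m2 = (a - c) / 2); last by rewrite /m1 /m2; field.
  by rewrite !nm_half; split; lra.
have [k|k3] := leP (nm (tri f a b c)) (4 * nm (tri f m3 m2 c)).
  exists (m3, m2, c); split=> // d d1 d2 d3; split.
    rewrite (_ : m3 - a = - ((a - c) / 2)); last by rewrite /m3; field.
    by rewrite nmN nm_half; have := nm_ge0 (a - c); lra.
  rewrite (_ : m2 - m3 = (b - a) / 2); last by rewrite /m2 /m3; field.
  rewrite (_ : c - m2 = (c - b) / 2); last by rewrite /m2; field.
  rewrite (_ : m3 - c = (a - c) / 2); last by rewrite /m3; field.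
  by rewrite !nm_half; split; lra.
exists (m1, m2, m3); split=> //.
  rewrite leNgt; apply/negP => k4.
  have := nmD (tri f a m1 m3 + tri f m1 b m2 + tri f m3 m2 c) (tri f m1 m2 m3).
  have := nmD (tri f a m1 m3 + tri f m1 b m2) (tri f m3 m2 c).
  have := nmD (tri f a m1 m3) (tri f m1 b m2).
  rewrite -E; lra.
move=> d d1 d2 d3; split.
  rewrite (_ : m1 - a = (b - a) / 2); last by rewrite /m1; field.
  by rewrite nm_half; have := nm_ge0 (b - a); lra.
rewrite (_ : m2 - m1 = - ((a - c) / 2)); last by rewrite /m1 /m2; field.
rewrite (_ : m3 - m2 = - ((b - a) / 2)); last by rewrite /m3 /m2; field.
rewrite (_ : m1 - m3 = - ((c - b) / 2)); last by rewrite /m3 /m1; field.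
by rewrite !nmN !nm_half; split; lra.
Qed.

Lemma cder_quad (al be : C) z : cder (fun w => al * w + be / 2 * w ^+ 2) z (al + be * z).
Proof.
have h1 := cderM (cder_cst al z) (cder_id z).
have h2 := cderM (cder_cst (be / 2) z) (cderX 2 (cder_id z)).
by apply: cder_eq (cderD h1 h2) _; rewrite /= expr1; field.
Qed.

Lemma tri_affine (al be : C) a b c : tri (fun w => al + be * w) a b c = 0.
Proof.
have s x y : seg (fun w => al + be * w) x y =
    al * y + be / 2 * y ^+ 2 - (al * x + be / 2 * x ^+ 2).
  by apply: (@seg_FTC _ (fun w => al * w + be / 2 * w ^+ 2)) => t _; exact: cder_quad.
by rewrite /tri !s; ring.
Qed.

Lemma seg_diff (g : C -> C) a b (B : R) : nm (a - z0) < r -> nm (b - z0) < r ->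
  (forall z, {for z, continuous g}) ->
  (forall t : R, 0 <= t <= 1 -> nm (f (lin a b t) - g (lin a b t)) <= B) ->
  nm (seg f a b - seg g a b) <= nm (b - a) * B.
Proof.
move=> ha hb cg H; rewrite /seg -mulrBr nmM ler_wpM2l ?nm_ge0 //.
have i1 := ItgP (seg_cont (scont ha hb)).
have i2 := ItgP (@seg_cont _ g a b (fun t _ => cg _)).
by apply: isI_bound (isIB i1 i2) _ => t t01; apply: H; lra.
Qed.

Lemma goursat a b c : nm (a - z0) < r -> nm (b - z0) < r -> nm (c - z0) < r ->
  tri f a b c = 0.
Proof.
move=> ha hb hc.
(* All the triangles stay in the closed disk of radius s < r, so that their limit point lies in the
   open disk where f is differentiable. *)
pose s := Num.max (nm (a - z0)) (Num.max (nm (b - z0)) (nm (c - z0))).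
have sr : s < r by rewrite /s !gt_max ha hb hc.
have hs : [/\ nm (a - z0) <= s, nm (b - z0) <= s & nm (c - z0) <= s].
  by rewrite /s !le_max !lexx !orbT.
pose ok (T : C * C * C) := let: (a, b, c) := T in
  [/\ nm (a - z0) <= s, nm (b - z0) <= s & nm (c - z0) <= s].
pose step (T T' : C * C * C) := let: (a, b, c) := T in let: (a', b', c') := T' in
  [/\ [/\ nm (a' - z0) <= s, nm (b' - z0) <= s & nm (c' - z0) <= s],
      nm (tri f a b c) <= 4 * nm (tri f a' b' c') &
      forall d, nm (b - a) <= d -> nm (c - b) <= d -> nm (a - c) <= d ->
       nm (a' - a) <= d /\ [/\ nm (b' - a') <= d / 2, nm (c' - b') <= d / 2 & nm (a' - c') <= d / 2]].
have stepE T : exists T', ok T -> step T T'.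
  case: (pselect (ok T)) => [okT|nok]; last by exists T.
  have := @tri_child T s; case: T okT => -[x y] z okT /(_ okT sr)[[[x' y'] z'] h].
  by exists (x', y', z').
have [next nextP] := choice stepE.
pose T n := iter n next (a, b, c).
pose A n := (T n).1.1; pose B n := (T n).1.2; pose D n := (T n).2.
pose d : R := nm (b - a) + nm (c - b) + nm (a - c).
have d0 : 0 <= d by rewrite !addr_ge0 ?nm_ge0.
have TE n : T n = (A n, B n, D n) by rewrite /A /B /D; case: (T n) => -[].
have inv n : [/\ nm (A n - z0) <= s, nm (B n - z0) <= s, nm (D n - z0) <= s,
     nm (tri f a b c) <= 4 ^+ n * nm (tri f (A n) (B n) (D n)) &
     [/\ nm (B n - A n) <= d / 2 ^+ n, nm (D n - B n) <= d / 2 ^+ n &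
         nm (A n - D n) <= d / 2 ^+ n]] /\ ok (T n).
  elim: n => [|n [[i1 i2 i3 i4 [i5 i6 i7]] okn]].
    split; last exact: hs.
    rewrite /A /B /D /= expr0 divr1 mul1r; case: hs => *; split=> //.
    by rewrite /d; have := nm_ge0 (b - a); have := nm_ge0 (c - b); have := nm_ge0 (a - c); split; lra.
  have := nextP _ okn; rewrite -[next (T n)]/(T n.+1) (TE n) (TE n.+1) /step.
  move=> [[j1 j2 j3] j4 /(_ _ i5 i6 i7)[j5 [j6 j7 j8]]]; split; last by [].
  have dE : d / 2 ^+ n / 2 = d / 2 ^+ n.+1 by rewrite exprSr invfM mulrA.
  rewrite -dE; split=> //; apply: le_trans i4 _.
  rewrite exprSr -mulrA ler_wpM2l //; exact: exprn_ge0.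
have cau n : nm (A n.+1 - A n) <= d / 2 ^+ n.
  have [[i1 i2 i3 i4 [i5 i6 i7]] okn] := inv n.
  have := nextP _ okn; rewrite -[next (T n)]/(T n.+1) (TE n) (TE n.+1) /step.
  by move=> [_ _ /(_ _ i5 i6 i7)[]].
have [z hz] := C_half_powers_cauchy d0 cau.
(* The distance from a vertex to the limit point z is at most 4 d / 2^n for the first vertex, by the
   Cauchy estimate, and d / 2^n more for the others. *)
have small (e : R) : 0 < e -> exists n, 5 * d / 2 ^+ n < e.
  move=> e0.
  have [N hN] : exists N : nat, 5 * d / e < N%:R.
    exists (Num.bound (5 * d / e)); apply: archi_boundP.
    by rewrite divr_ge0 ?mulr_ge0 // ltW.
  exists N; rewrite ltr_pdivrMr ?exprn_gt0 // -ltr_pdivrMl // mulrC.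
  apply: lt_le_trans hN _; rewrite -natrX ler_nat; exact: ltnW (ltn_expl N (ltnSn 1)).
have zr : nm (z - z0) < r.
  apply: le_lt_trans sr; rewrite leNgt; apply/negP => k.
  have e0 : 0 < nm (z - z0) - s by lra.
  have [n hn] := small _ e0; have [[i1 _ _ _ _] _] := inv n.
  have := nm_tri z z0 (A n); rewrite (nmC z (A n)); have := hz n.
  have : 0 <= d / 2 ^+ n by rewrite divr_ge0 // exprn_ge0.
  move: hn; rewrite -!mulrA; lra.
have [p hp] := fder zr.
apply/eqP; rewrite -nm_eq0 eq_le nm_ge0 andbT; apply/ler_addgt0Pl => e e0; rewrite addr0.
(* The three sides have length at most [dn], and on them the deviation of f from its affine part is
   at most the slope error times 5 [dn]: this is 15 [dn]^2. The summand 1 covers d = 0. *)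
have K0 : 0 < 15 * d ^+ 2 + 1 by have := sqr_ge0 d; lra.
have [dl dl0 hdl] := hp _ (divr_gt0 e0 K0).
have [n hn] := small _ dl0.
have [[i1 i2 i3 i4 [i5 i6 i7]] _] := inv n.
set dn := d / 2 ^+ n in i5 i6 i7; have dn0 : 0 <= dn by rewrite divr_ge0 // exprn_ge0.
have hdn : 5 * dn < dl by rewrite /dn mulrA.
have hA : nm (A n - z) <= 5 * dn by have := hz n; rewrite -mulrA -/dn; lra.
have hB : nm (B n - z) <= 5 * dn.
  by have := nm_tri (B n) z (A n); have := hz n; rewrite -mulrA -/dn; lra.
have hD : nm (D n - z) <= 5 * dn.
  by have := nm_tri (D n) z (A n); rewrite (nmC (D n) (A n)); have := hz n; rewrite -mulrA -/dn; lra.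
pose g w := (f z - p * z) + p * w.
have cg w : {for w, continuous g}.
  apply: contD; first exact: cont_cst.
  apply: contM; first exact: cont_cst.
  exact: rd_cont (cder_id w).
have est w : nm (w - z) <= 5 * dn -> nm (f w - g w) <= e / (15 * d ^+ 2 + 1) * (5 * dn).
  move=> hw; have := hdl (w - z) (le_lt_trans hw hdn).
  rewrite [z + _]addrC subrK dl_conf (_ : f w - f z - (w - z) * p = f w - g w); last by rewrite /g; ring.
  by move=> /le_trans; apply; rewrite ler_wpM2l // ltW // divr_gt0.
have sd x y : nm (x - z) <= 5 * dn -> nm (y - z) <= 5 * dn ->
    nm (x - z0) <= s -> nm (y - z0) <= s -> nm (y - x) <= dn ->
    nm (seg f x y - seg g x y) <= dn * (e / (15 * d ^+ 2 + 1) * (5 * dn)).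
  move=> hx hy hx0 hy0 hxy.
  apply: le_trans (@seg_diff _ _ _ (e / (15 * d ^+ 2 + 1) * (5 * dn)) _ _ _ _) _.
  - exact: le_lt_trans sr.
  - exact: le_lt_trans sr.
  - exact: cg.
  - by move=> t t01; apply: est; exact: lin_cball.
  - by apply: ler_wpM2r => //; apply: mulr_ge0; [exact: ltW (divr_gt0 e0 K0)|exact: mulr_ge0].
have tb : nm (tri f (A n) (B n) (D n)) <= 3 * (dn * (e / (15 * d ^+ 2 + 1) * (5 * dn))).
  have := sd _ _ hA hB i1 i2 i5; have := sd _ _ hB hD i2 i3 i6; have := sd _ _ hD hA i3 i1 i7.
  have <- : tri f (A n) (B n) (D n) - tri g (A n) (B n) (D n) = tri f (A n) (B n) (D n).
    by rewrite tri_affine subr0.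
  rewrite (_ : tri f _ _ _ - tri g _ _ _ = seg f (A n) (B n) - seg g (A n) (B n) +
     (seg f (B n) (D n) - seg g (B n) (D n)) + (seg f (D n) (A n) - seg g (D n) (A n)));
    last by rewrite /tri; ring.
  set u1 := seg f _ _ - _; set u2 := seg f _ _ - _; set u3 := seg f _ _ - _.
  by have := nmD (u3 + u2) u1; have := nmD u3 u2; lra.
apply: le_trans i4 _; apply: le_trans (ler_wpM2l _ tb) _; first exact: exprn_ge0.
rewrite (_ : 4 ^+ n * _ = e * (15 * d ^+ 2 / (15 * d ^+ 2 + 1))).
  by apply: ler_piMr; [exact: ltW|rewrite ler_pdivrMr // mul1r; lra].
rewrite /dn (_ : 4 = 2 * 2 :> R); last by rewrite -natrM.
rewrite exprMn; field.
by rewrite expf_neq0 // gt_eqF.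
Qed.

Lemma ball_primitive :
  exists F : C -> C, forall z, nm (z - z0) < r -> cder F z (f z).
Proof.
exists (seg f z0) => z zr.
have r0 : nm (z0 - z0) < r by apply: le_lt_trans zr; rewrite subrr nm0 nm_ge0.
have /contC cz := fcont zr.
move=> e e0; have /nbhsCP[d d0 hd] := cz _ e0.
exists (Num.min d (r - nm (z - z0))); first by apply: min_gt0 => //; lra.
move=> h; rewrite lt_min => /andP[hd1 hd2].
have zhr : nm (z + h - z0) < r.
  by rewrite addrAC; have := nmD (z - z0) h; lra.
have E : seg f z0 (z + h) - seg f z0 z = seg f z (z + h).
  have := goursat r0 zr zhr; rewrite /tri (seg_rev (scont r0 zhr)) => T.
  by rewrite -[RHS]subr0 -T; ring.
rewrite E dl_conf; pose g (w : C) := f z.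
have cg w : {for w, continuous g} by exact: cont_cst.
have sg : seg g z (z + h) = h * f z.
  by rewrite /seg (ItgE (isI_cst _)) addrC addKr.
rewrite -sg; apply: le_trans (@seg_diff g z (z + h) e zr zhr cg _) _.
  move=> t t01; rewrite /g; apply/ltW/hd.
  have -> : lin z (z + h) t - z = t%:C * h by rewrite /lin; ring.
  move: t01 => /andP[t0 t1]; rewrite nmM nmR ger0_norm //.
  by apply: le_lt_trans hd1; rewrite ler_piMl // nm_ge0.
by rewrite mulrC [z + h]addrC addrK.
Qed.

End Goursat.

Section MeanValue.
Context {R : realType}.
Local Notation C := R[i].
Implicit Types (f g : C -> C) (z w p q h v : C) (phi : R -> C).

Lemma cd_lin f (f1 : C -> C) z w (t : R) : cder f (lin z w t) (f1 (lin z w t)) ->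
  cd (f \o lin z w) t (f1 (lin z w t) * (w - z)).
Proof. exact: cd_ccomp (lin_cd z w t). Qed.

Lemma nm_mv f f1 z w (B : R) :
  (forall t : R, 0 <= t <= 1 -> cder f (lin z w t) (f1 (lin z w t))) ->
  (forall t : R, 0 <= t <= 1 -> nm (f1 (lin z w t)) <= B) ->
  nm (f w - f z) <= B * nm (w - z).
Proof.
move=> d b; have := @curve_mean _ (f \o lin z w) (fun t => f1 (lin z w t) * (w - z))
  (B * nm (w - z)).
rewrite /= lin0 lin1; apply.
- by move=> t t01; exact: cd_cont (cd_lin (d t t01)).
- by move=> t t01; apply: cd_lin; apply: d; lra.
- by move=> t t01; rewrite nmM ler_wpM2r ?nm_ge0 //; apply: b; lra.
Qed.

Lemma lin_dist z w (t : R) : 0 <= t <= 1 -> nm (lin z w t - z) <= nm (w - z).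
Proof.
move=> t01; apply: le_trans (lin_nm z w z t01) _.
rewrite subrr nm0 mulr0 add0r; move: t01 => /andP[t0 t1].
by rewrite ler_piMl // nm_ge0.
Qed.

(** The mean value inequality, applied to f1 and then to f minus its linear part; hence the constant
    B instead of B / 2. *)
Lemma taylor2 f f1 f2 z w (B : R) : 0 <= B ->
  (forall t : R, 0 <= t <= 1 -> cder f (lin z w t) (f1 (lin z w t))) ->
  (forall t : R, 0 <= t <= 1 -> cder f1 (lin z w t) (f2 (lin z w t))) ->
  (forall t : R, 0 <= t <= 1 -> nm (f2 (lin z w t)) <= B) ->
  nm (f w - f z - (w - z) * f1 z) <= B * nm (w - z) ^+ 2.
Proof.
move=> B0 d d1 b.
have h1 (s : R) : 0 <= s <= 1 -> nm (f1 (lin z w s) - f1 z) <= B * nm (w - z).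
  move=> s01; have E (t : R) : lin z (lin z w s) t = lin z w (t * s).
    by rewrite /lin rmorphM /=; ring.
  have ts01 (t : R) : 0 <= t <= 1 -> 0 <= t * s <= 1.
    by move: s01 => /andP[s0 s1] /andP[t0 t1]; rewrite mulr_ge0 //= mulr_ile1.
  apply: le_trans (@nm_mv f1 f2 z (lin z w s) B _ _) _ => [t t01|t t01|].
  - by rewrite E; apply: d1; exact: ts01.
  - by rewrite E; apply: b; exact: ts01.
  - by rewrite ler_wpM2l // lin_dist.
have h2 (t : R) : cder (fun x => f1 z * x) (lin z w t) (f1 z).
  by apply: cder_eq (cderM (cder_cst (f1 z) _) (cder_id _)) _; rewrite mul0r add0r mulr1.
have := @nm_mv (fun x => f x - f1 z * x) (fun x => f1 x - f1 z) z w (B * nm (w - z)).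
rewrite expr2 mulrA => H; apply: le_trans (H _ _) => [|t t01|t t01]; last exact: h1.
- by rewrite le_eqVlt; apply/orP; left; apply/eqP; congr nm; ring.
- exact: cderB (d t t01) (h2 t).
Qed.

Lemma contI_bounded phi : contI phi -> exists2 B : R, 0 <= B &
  forall t : R, 0 <= t <= 1 -> nm (phi t) <= B.
Proof.
move=> c.
have c' : {within `[(0 : R), 1], continuous (fun t : R => nm (phi t))}.
  apply: continuous_in_subspaceT => x /set_mem /=; rewrite in_itv /= => x01.
  suff : {for (x : R), continuous (fun t : R => nm (phi t))} by [].
  have /contC k := c x x01; apply/contR => e /k; apply: filterS => y.
  apply: le_lt_trans; rewrite ler_norml.
  have := nm_tri (phi y) 0 (phi x); have := nm_tri (phi x) 0 (phi y).
  by rewrite !subr0 (nmC (phi x)); lra.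
have [m m01 hm] := EVT_max ler01 c'.
exists (nm (phi m)); first exact: nm_ge0.
by move=> t t01; apply: hm; rewrite in_itv.
Qed.

(** A bound on the second derivative that is uniform in t makes the first-order error in h at most B
    |h|^2 for every t, and integration preserves this bound. *)
Lemma Itg_cder (G G1 G2 : C -> R -> C) (z0 : C) (r B : R) : 0 <= B ->
  (forall z (t : R), nm (z - z0) < r -> 0 <= t <= 1 ->
     [/\ cder (G^~ t) z (G1 z t), cder (G1^~ t) z (G2 z t) & nm (G2 z t) <= B]) ->
  (forall z, nm (z - z0) < r -> contI (G z)) ->
  (forall z, nm (z - z0) < r -> contI (G1 z)) ->
  forall z, nm (z - z0) < r -> cder (fun w => Itg (G w)) z (Itg (G1 z)).
Proof.
move=> B0 H cG cG1 z zr e e0.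
have eB : 0 < e / (B + 1) by rewrite divr_gt0 //; lra.
exists (Num.min (e / (B + 1)) (r - nm (z - z0))); first by apply: min_gt0 => //; lra.
move=> h; rewrite lt_min => /andP[h1 h2].
have zhr : nm (z + h - z0) < r by rewrite addrAC; have := nmD (z - z0) h; lra.
have i1 := isIB (ItgP (cG _ zhr)) (ItgP (cG _ zr)).
have i2 := isIB i1 (isIZ h (ItgP (cG1 _ zr))).
rewrite dl_conf; apply: le_trans (@isI_bound _ _ _ (B * nm h ^+ 2) i2 _) _.
  move=> t t01; have t01' : 0 <= t <= 1 by lra.
  have K (s : R) : 0 <= s <= 1 -> nm (lin z (z + h) s - z0) < r by move=> ?; exact: lin_ball.
  have := @taylor2 (G^~ t) (G1^~ t) (G2^~ t) z (z + h) B B0.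
  have -> : z + h - z = h by rewrite addrC addKr.
  by apply=> s s01; have [] := H _ t (K s s01) t01'.
rewrite expr2 mulrA ler_wpM2r ?nm_ge0 //.
have : nm h * (B + 1) <= e by rewrite -ler_pdivlMr; [exact: ltW|lra].
have := nm_ge0 h; lra.
Qed.

End MeanValue.

Section Circle.
Context {R : realType}.
Local Notation C := R[i].

Lemma cd_expi (t : R) : cd (@expi R) t ('i%C * expi t).
Proof.
apply: cd_pair => /=; rewrite ?mul0r ?mul1r ?sub0r ?add0r ?addr0.
  exact: is_derive_cos.
exact: is_derive_sin.
Qed.

Definition circle (rho t : R) : C := rho%:C * expi (2 * pi * t).

Lemma cd_circle (rho t : R) :
  cd (circle rho) t ((2 * pi)%:C * 'i%C * circle rho t).
Proof.
have h := @cd_affine _ (@expi R) (2 * pi) 0 t _ (cd_expi _).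
have h2 := cdM (cd_cst (rho%:C) t) h.
apply: cd_ext (cd_eq h2 _) => [s|]; first by rewrite /circle addr0.
by rewrite /circle addr0; ring.
Qed.

Lemma nm_circle (rho t : R) : 0 <= rho -> nm (circle rho t) = rho.
Proof. by move=> r0; rewrite nmM nm_expi mulr1 nmR ger0_norm. Qed.

Lemma expi2pi : expi (2 * pi) = 1 :> C.
Proof. by rewrite /expi mulrC mulr_natr cos2pi sin2pi. Qed.

Lemma circle01 (rho : R) : circle rho 1 = circle rho 0.
Proof. by rewrite /circle mulr1 mulr0 expi2pi expi0. Qed.

Lemma circle_cont (rho : R) : contI (circle rho).
Proof. by move=> t _; exact: cd_cont (cd_circle rho t). Qed.

End Circle.

(** * Cauchy's formula on a circle about 0 *)

Section CauchyKernel.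
Context {R : realType} (rho : R) (rho0 : 0 < rho).
Local Notation C := R[i].
Implicit Types (z w : C) (phi : R -> C) (n : nat).

(** On the circle zeta = [circle rho t] one has dzeta / (2 pi i) = zeta dt; with n = 1 and phi = F
    zeta this is the Cauchy integral of F. *)
Definition ker phi n z : C := Itg (fun t => phi t * (circle rho t - z) ^- n).

Lemma circle_sub z (t : R) : nm z < rho -> circle rho t - z != 0.
Proof.
move=> zr; rewrite -nm_gt0; have := nm_tri (circle rho t) 0 z.
by rewrite !subr0 (nm_circle _ (ltW rho0)); lra.
Qed.

Lemma ker_cont phi n z : nm z < rho -> contI phi ->
  contI (fun t => phi t * (circle rho t - z) ^- n).
Proof.
move=> zr c t t01; apply: contM; first exact: c.
apply: contV; first by apply: expf_neq0; exact: circle_sub.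
elim: n => [|n IH]; first by apply: cont_cst.
rewrite (_ : (fun y => _) = (fun y => (circle rho y - z) * (circle rho y - z) ^+ n)); last first.
  by apply/funext => y; rewrite exprS.
by apply: (contM _ IH); apply: contB; [exact: circle_cont|exact: cont_cst].
Qed.

Lemma cder_ker_fun (a b : C) n z : a - z != 0 ->
  cder (fun w => b * (a - w) ^- n) z (b * n%:R * (a - z) ^- n.+1).
Proof.
move=> az; have h1 := cderB (cder_cst a z) (cder_id z).
have h2 := cderV (cderX n h1) (expf_neq0 n az).
apply: cder_eq (cderM (cder_cst b z) h2) _.
case: n {h2} => [|n]; first by rewrite !mulr0n; ring.
by rewrite /= -mulr_natr !exprS; field; rewrite az expf_neq0.
Qed.

Lemma ker_cder phi n z : contI phi -> nm z < rho ->
  cder (ker phi n) z (n%:R * ker phi n.+1 z).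
Proof.
move=> c zr; have [B B0 hB] := contI_bounded c.
(* On the disk of intermediate radius s the distance to the circle is at least d, which bounds the
   second derivative of the kernel uniformly. *)
pose s := (rho + nm z) / 2; have sr : s < rho by rewrite /s; lra.
have zs : nm (z - 0) < s by rewrite subr0 /s; lra.
pose d := rho - s; have d0 : 0 < d by rewrite /d; lra.
have E : (fun w => Itg (fun t => phi t * n%:R * (circle rho t - w) ^- n.+1)) z =
    n%:R * ker phi n.+1 z.
  apply: ItgE; apply: isI_congr (isIZ n%:R (ItgP (@ker_cont phi n.+1 z zr c))) _ => t _.
  by ring.
have lt0 w : nm (w - 0) < s -> nm w < rho by rewrite subr0 => /lt_trans; exact.
pose G w (t : R) := phi t * (circle rho t - w) ^- n.
pose G1 w (t : R) := phi t * n%:R * (circle rho t - w) ^- n.+1.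
pose G2 w (t : R) := phi t * n%:R * n.+1%:R * (circle rho t - w) ^- n.+2.
rewrite -E; apply: (@Itg_cder _ G G1 G2 0 s (B * n%:R * n.+1%:R * d ^- n.+2) _ _ _ _ z zs).
- by rewrite !mulr_ge0 // invr_ge0 exprn_ge0 // ltW.
- move=> w t ws t01; have cw := circle_sub t (lt0 w ws); split.
  + exact: cder_ker_fun.
  + exact: cder_ker_fun.
  + rewrite !nmM nmV nmX -!(rmorph_nat (real_complex R)) !nmR !normr_nat.
    have dw : d <= nm (circle rho t - w).
      have := nm_tri (circle rho t) 0 w; rewrite !subr0 (nm_circle _ (ltW rho0)).
      by move: ws; rewrite subr0 /d; lra.
    apply: ler_pM; rewrite ?invr_ge0 ?exprn_ge0 ?nm_ge0 ?mulr_ge0 ?nm_ge0 //.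
      by rewrite !ler_wpM2r // hB.
    rewrite lef_pV2 ?posrE ?exprn_gt0 //; last exact: lt_le_trans dw.
    by rewrite lerXn2r ?nnegrE ?nm_ge0 // ltW.
- by move=> w /lt0 ws; exact: ker_cont.
- move=> w /lt0 ws; apply: (@ker_cont (fun t => phi t * n%:R) n.+1 w ws) => t t01.
  by apply: contM; [exact: c|exact: cont_cst].
Qed.

Lemma closed_itg (ga g : R -> C) : (forall t : R, 0 <= t <= 1 -> cd ga t (g t)) ->
  ga 1 = ga 0 -> isI g 0.
Proof. by move=> /isI_cd h e; rewrite e subrr in h. Qed.

(** The derivative of the integral in z integrates the differential of -1 / (zeta - z) over the
    closed circle and so vanishes; at z = 0 the integrand is 1. *)
Lemma ker_circle z : nm z < rho -> ker (circle rho) 1 z = 1.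
Proof.
move=> zr; have pi0 : (2 * pi)%:C * 'i%C != 0 :> C.
  by rewrite -nm_gt0 nmM nmi mulr1 nmR normr_gt0 mulf_neq0 // gt_eqF ?pi_gt0.
have k2 w : nm w < rho -> ker (circle rho) 2 w = 0.
  move=> wr.
  have h0 : isI (fun t => ((2 * pi)%:C * 'i%C * circle rho t) * (circle rho t - w) ^- 2) 0.
    apply: (@closed_itg (fun t => - (circle rho t - w)^-1)) => [t t01|]; last first.
      by rewrite circle01.
    have h1 := cdD (cd_circle rho t) (cd_cst (- w) t); rewrite addr0 in h1.
    have h2 := cderN (cder_inv (circle_sub t wr)).
    by apply: cd_eq (cd_ccomp h1 h2) _; ring.
  rewrite -(mulr0 ((2 * pi)%:C * 'i%C)^-1); apply: ItgE.
  apply: isI_congr (isIZ _ h0) _ => t _.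
  by rewrite -[_ * circle rho t * _]mulrA mulKf.
have -> : 1 = ker (circle rho) 1 0.
  symmetry; apply: ItgE; apply: isI_congr (isI_cst 1) _ => t _.
  by rewrite subr0 expr1 mulfV // -nm_gt0 nm_circle // ltW.
apply/eqP; rewrite -subr_eq0 -nm_eq0 eq_le nm_ge0 andbT.
have := @nm_mv _ (ker (circle rho) 1) (fun w => 1%:R * ker (circle rho) 2 w) 0 z 0.
have tr (t : R) : 0 <= t <= 1 -> nm (lin 0 z t) < rho.
  by move=> t01; have := @lin_ball _ 0 z t 0 rho t01; rewrite !subr0; apply; rewrite ?nm0.
rewrite mul0r; apply=> t t01; last by rewrite k2 ?tr // mulr0 nm0.
by apply: ker_cder; [exact: circle_cont|exact: tr].
Qed.

(* The circle of centre [z] shrinks to [z] through the curves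
   [z + l (E - z)]; a second primitive [F] makes the differentiation in [l]
   uniform. *)
Lemma cauchy_formula (F F1 F2 : C -> C) (B : R) : 0 <= B ->
  (forall w, nm w < 8 * rho -> [/\ cder F w (F1 w), cder F1 w (F2 w) & nm (F2 w) <= B]) ->
  forall z, nm z < rho ->
  F z = ker (fun t => F (circle rho t) * circle rho t) 1 z.
Proof.
move=> B0 H z zr; have rho_gt0 : 0 < rho by exact: rho0.
pose E := circle rho.
pose W (t : R) : C := E t * (E t - z)^-1.
have pos : 0 < rho - nm z by lra.
have hr w : nm w < 8 * rho -> {for w, continuous F} by move=> /H[/rd_cont].
have hr1 w : nm w < 8 * rho -> {for w, continuous F1} by move=> /H[_ /rd_cont].
have in8 (l : C) (t : R) : nm (l - 0) < 2 -> nm (z + l * (E t - z)) < 8 * rho.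
  rewrite subr0 => l2; have h1 := nmD z (l * (E t - z)).
  have h2 : nm (l * (E t - z)) <= 2 * (2 * rho).
    rewrite nmM ler_pM ?nm_ge0 //; first exact: ltW.
    by have := nmB (E t) z; rewrite (nm_circle _ (ltW rho0)); lra.
  lra.
have cE : contI E by exact: circle_cont.
have cEz : contI (fun t => E t - z) by move=> t t01; apply: contB; [exact: cE|exact: cont_cst].
have cW : contI W.
  move=> t t01; apply: contM; first exact: cE.
  by apply: contV; [exact: circle_sub|exact: cEz].
have carg (l : C) : contI (fun t => z + l * (E t - z)).
  move=> t t01; apply: contD; first exact: cont_cst.
  by apply: contM; [exact: cont_cst|exact: cEz].
have cF (l : C) : nm (l - 0) < 2 -> contI (fun t => F (z + l * (E t - z))).
  by move=> l2 t t01; apply: (@cont_comp _ _ _ (fun t => z + l * (E t - z)) F);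
    [exact: carg|exact: hr (in8 _ _ l2)].
have cF1 (l : C) : nm (l - 0) < 2 -> contI (fun t => F1 (z + l * (E t - z))).
  by move=> l2 t t01; apply: (@cont_comp _ _ _ (fun t => z + l * (E t - z)) F1);
    [exact: carg|exact: hr1 (in8 _ _ l2)].
have darg (t : R) (l : C) : cder (fun l => z + l * (E t - z)) l (E t - z).
  have := cderD (cder_cst z l) (cderM (cder_id l) (cder_cst (E t - z) l)).
  by move=> /cder_eq; apply; rewrite mul1r mulr0 addr0 add0r.
pose G l (t : R) := F (z + l * (E t - z)) * W t.
pose G1 l (t : R) := F1 (z + l * (E t - z)) * (E t - z) * W t.
pose G2 l (t : R) := F2 (z + l * (E t - z)) * (E t - z) ^+ 2 * W t.
have WB (t : R) : nm (W t) <= rho / (rho - nm z).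
  rewrite nmM nmV (nm_circle _ (ltW rho0)) ler_wpM2l ?(ltW rho0) // lef_pV2 ?posrE //.
    by have := nm_tri (E t) 0 z; rewrite !subr0 (nm_circle _ (ltW rho0)); lra.
  by rewrite nm_gt0; exact: circle_sub.
have J l : nm (l - 0) < 2 -> cder (fun l => Itg (G l)) l (Itg (G1 l)).
  apply: (@Itg_cder _ G G1 G2 0 2 (B * (2 * rho) ^+ 2 * (rho / (rho - nm z)))).
  - by rewrite !mulr_ge0 ?exprn_ge0 ?mulr_ge0 ?invr_ge0 // ltW.
  - move=> k t k2 t01; have [d1 d2 b2] := H _ (in8 k t k2); split.
    + apply: cder_eq (cderM (cder_comp (darg t k) d1) (cder_cst (W t) k)) _.
      by rewrite mulr0 addr0.
    + have d3 := cderM (cder_comp (darg t k) d2) (cder_cst (E t - z) k).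
      apply: cder_eq (cderM d3 (cder_cst (W t) k)) _.
      by rewrite /G2; ring.
    + rewrite /G2 (nmM _ (W t)) (nmM _ (_ ^+ 2)) nmX.
      apply: ler_pM; [by rewrite mulr_ge0 ?exprn_ge0 ?nm_ge0|exact: nm_ge0| |exact: WB].
      apply: ler_pM; [exact: nm_ge0|by rewrite exprn_ge0 ?nm_ge0|exact: b2|].
      have r2 : 0 <= 2 * rho by lra.
      have : nm (E t - z) <= 2 * rho.
        by have := nmB (E t) z; rewrite (nm_circle _ (ltW rho0)); lra.
      by apply: lerXn2r; rewrite nnegrE ?nm_ge0.
  - by move=> k k2 t t01; apply: contM; [exact: cF|exact: cW].
  - move=> k k2 t t01; apply: contM; last exact: cW.
    by apply: contM; [exact: cF1|exact: cEz].
have in2 (t : R) : 0 <= t <= 1 -> nm (t%:C - 0) < 2.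
  by rewrite subr0 nmR => /andP[t0 t1]; rewrite ger0_norm //; lra.
(* For real t > 0 the integrand [G1] is, up to the factor 2 pi i t, the derivative in s of F (z + t
   (E s - z)), a function with equal values at both ends of the circle. *)
have G1_0 (t : R) : 0 < t < 1 -> Itg (G1 t%:C) = 0.
  move=> /andP[t0 t1]; have t2 : nm (t%:C - 0) < 2 by apply: in2; rewrite !ltW.
  have pi0 : t%:C * ((2 * pi)%:C * 'i%C) != 0 :> C.
    rewrite -nm_gt0 !nmM nmi mulr1 !nmR mulr_gt0 ?normr_gt0 ?gt_eqF //.
    by rewrite mulr_gt0 // pi_gt0.
  have h0 : isI (fun s => F1 (z + t%:C * (E s - z)) * (t%:C * ((2 * pi)%:C * 'i%C * E s))) 0.
    apply: (@closed_itg (fun s => F (z + t%:C * (E s - z)))) => [s s01|]; last first.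
      by rewrite /E circle01.
    have h1 := cdD (cd_circle rho s) (cd_cst (- z) s); rewrite addr0 in h1.
    have h2 := cdD (cd_cst z s) (cdM (cd_cst (t%:C) s) h1).
    have [h3 _ _] := H _ (in8 t%:C s t2).
    by apply: cd_eq (cd_ccomp h2 h3) _; rewrite mul0r !add0r.
  rewrite -(mulr0 (t%:C * ((2 * pi)%:C * 'i%C))^-1); apply: ItgE.
  apply: isI_congr (isIZ _ h0) _ => s s01.
  rewrite /G1 /W; have := circle_sub s zr; rewrite -/(E s) => Ez.
  rewrite (_ : F1 _ * (t%:C * _) = (t%:C * ((2 * pi)%:C * 'i%C)) * (F1 (z + t%:C * (E s - z)) * E s)).
    by rewrite mulKf // -[RHS]mulrA [(E s - z) * _]mulrC divfK.
  by ring.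
have e0 : Itg (G 0) = F z.
  rewrite -[RHS]mulr1 -(ker_circle zr); apply: ItgE.
  apply: isI_congr (isIZ (F z) (ItgP (@ker_cont _ 1 z zr cE))) _ => t _.
  by rewrite /G mul0r addr0 expr1.
have e1 : Itg (G 1) = ker (fun t => F (circle rho t) * circle rho t) 1 z.
  by congr Itg; apply/funext => t; rewrite /G /W mul1r addrC subrK expr1 mulrA.
rewrite -e0 -e1; apply/eqP; rewrite -subr_eq0 -nm_eq0 nmC eq_le nm_ge0 andbT.
apply: (@curve_mean _ (fun t : R => Itg (G t%:C)) (fun=> 0) 0).
- move=> t t01; apply: (@cont_comp _ _ _ (fun t : R => t%:C) (fun l => Itg (G l))).
    by apply/contRC; exact: cvg_id.
  exact: rd_cont (J _ (in2 t t01)).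
- move=> t t01; have t01' : 0 <= t <= 1 by lra.
  have h1 := cd_real (is_derive_id t (1 : R)).
  by apply: cd_eq (cd_ccomp h1 (J _ (in2 t t01'))) _; rewrite G1_0 // mul0r.
- by move=> t _; rewrite nm0.
Qed.

End CauchyKernel.

(** * The derivative of a holomorphic function is holomorphic *)

Section HolomorphicDerivative.
Context {R : realType}.
Local Notation C := R[i].
Implicit Types (f g : C -> C) (z w : C).

Lemma cder_shift f z a p : cder f (a + z) p -> cder (fun w => f (a + w)) z p.
Proof.
move=> h; have k := cderD (cder_cst a z) (cder_id z).
by apply: cder_eq (cder_comp k h) _; rewrite add0r mulr1.
Qed.

Lemma cder_shiftN f z a p : cder (fun w => f (a + w)) (z - a) p -> cder f z p.
Proof.
move=> h; have k := cderB (cder_id z) (cder_cst a z).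
apply: rd_ext (cder_eq (cder_comp k h) _) => [w /=|]; first by rewrite addrC subrK.
by rewrite subr0 mulr1.
Qed.

(** Cauchy's formula above needs a locally bounded second derivative, which is not yet known for f.
    It is applied to a primitive F of a primitive of f: the second derivative of F is f, bounded
    near 0 by continuity. Then f is a second derivative of a kernel integral, which can be
    differentiated further. *)
Lemma hol0_derivative f (r : R) : 0 < r ->
  (forall z, nm z < r -> exists p, cder f z p) ->
  exists2 rho : R, 0 < rho & exists f1 f2 : C -> C,
    forall z, nm z < rho -> cder f z (f1 z) /\ cder f1 z (f2 z).
Proof.
move=> r0 df; have df0 z : nm (z - 0) < r -> exists p, cder f z p by rewrite subr0; exact: df.
have [F1 dF1] := ball_primitive df0.
have [F dF] : exists F : C -> C, forall z, nm (z - 0) < r -> cder F z (F1 z).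
  by apply: ball_primitive => z /dF1 h; exists (f z).
have [|p fp] := df 0; first by rewrite nm0.
have /contC/(_ 1 ltr01)/nbhsCP[d d0 hd] := rd_cont fp.
pose rho := Num.min r d / 8; have m0 : 0 < Num.min r d by exact: min_gt0.
have rho0 : 0 < rho by rewrite divr_gt0.
have r8 : 8 * rho = Num.min r d by rewrite /rho; field.
pose B := nm (f 0) + 1; have B0 : 0 <= B by rewrite addr_ge0 ?nm_ge0.
have H w : nm w < 8 * rho -> [/\ cder F w (F1 w), cder F1 w (f w) & nm (f w) <= B].
  rewrite r8 lt_min => /andP[wr wd]; split.
  - by apply: dF; rewrite subr0.
  - by apply: dF1; rewrite subr0.
  - have := hd w; rewrite subr0 => /(_ wd); have := nm_tri (f w) 0 (f 0).
    by rewrite !subr0 /B; lra.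
have w8 w : nm w < rho -> nm w < 8 * rho by have := nm_ge0 w; lra.
pose phi t := F (circle rho t) * circle rho t.
have cphi : contI phi.
  move=> t t01; apply: contM; last exact: circle_cont.
  apply: (@cont_comp _ _ _ (circle rho) F); first exact: circle_cont.
  have [] := H (circle rho t) _; first by rewrite (nm_circle _ (ltW rho0)); lra.
  by move=> /rd_cont.
have FK z : nm z < rho -> F z = ker rho phi 1 z.
  exact: (cauchy_formula rho0 B0 H).
have near_rho (P : C -> Prop) z : nm z < rho -> (forall w, nm w < rho -> P w) ->
    \forall w \near z, P w.
  move=> zr hP; apply/nbhsCP; exists (rho - nm z); first lra.
  by move=> w wz; apply: hP; have := nm_tri w 0 z; rewrite !subr0; lra.
have F1K z : nm z < rho -> F1 z = ker rho phi 2 z.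
  move=> zr; have [h _ _] := H z (w8 z zr).
  have := rd_near (near_rho _ z zr FK) h => h'.
  by have := cder_unique h' (@ker_cder _ _ rho0 phi 1 z cphi zr); rewrite mul1r.
have F2K z : nm z < rho -> f z = 2%:R * ker rho phi 3 z.
  move=> zr; have [_ h _] := H z (w8 z zr).
  have := rd_near (near_rho _ z zr F1K) h => h'.
  exact: cder_unique h' (@ker_cder _ _ rho0 phi 2 z cphi zr).
exists rho => //; exists (fun z => 2%:R * (3%:R * ker rho phi 4 z)).
exists (fun z => 2%:R * (3%:R * (4%:R * ker rho phi 5 z))) => z zr; split.
  have h := cderM (cder_cst 2%:R z) (@ker_cder _ _ rho0 phi 3 z cphi zr).
  have h' := cder_eq h (_ : _ = 2%:R * (3%:R * ker rho phi 4 z)).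
  apply: rd_near (h' _); last by rewrite mul0r add0r.
  by apply: near_rho => // w /F2K.
have h := cderM (cder_cst 2%:R z) (cderM (cder_cst 3%:R z) (@ker_cder _ _ rho0 phi 4 z cphi zr)).
by apply: cder_eq h _; rewrite !mul0r !add0r.
Qed.

Definition hol f z := \forall w \near z, exists p, cder f w p.

Lemma holP f z : hol f z <-> holomorphic_at f z.
Proof.
split; apply: filterS => w; first by move=> [p /cder_derivable].
by move=> /derivable_cder h; exists (derive1 f w).
Qed.

Lemma hol_open f z : hol f z -> \forall w \near z, hol f w.
Proof.
move=> /nbhsCP[e e0 H]; apply/nbhsCP; exists e => // w wz.
apply/nbhsCP; exists (e - nm (w - z)); first lra.
by move=> t tw; apply: H; have := nm_tri t z w; lra.
Qed.

Lemma hol_cder f z : hol f z -> cder f z (derive1 f z).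
Proof. by move=> /holP/nbhs_singleton/derivable_cder. Qed.

Lemma hol_near f g z : (\forall w \near z, f w = g w) -> hol f z -> hol g z.
Proof.
move=> /nbhsCP[e e0 H] /nbhsCP[d d0 K]; apply/nbhsCP.
exists (Num.min e d); first exact: min_gt0.
move=> w; rewrite lt_min => /andP[we /K[p hp]]; exists p.
apply: rd_near hp; apply/nbhsCP; exists (e - nm (w - z)); first lra.
by move=> t tw; apply: H; have := nm_tri t z w; lra.
Qed.

Lemma hol_derive1 f z : hol f z -> hol (derive1 f) z.
Proof.
move=> /nbhsCP[e e0 H].
have dz w : nm w < e -> exists p, cder (fun w => f (z + w)) w p.
  move=> we; have [|p hp] := H (z + w); first by rewrite [z + w]addrC addrK.
  by exists p; exact: cder_shift.
have [rho rho0 [f1 [f2 K]]] := hol0_derivative e0 dz.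
have D w : nm (w - z) < rho -> cder f w (f1 (w - z)) /\ cder (fun w => f1 (w - z)) w (f2 (w - z)).
  move=> /K[k1 k2]; split; first exact: cder_shiftN k1.
  have h := cderB (cder_id w) (cder_cst z w).
  by apply: cder_eq (cder_comp h k2) _; rewrite subr0 mulr1.
apply: (@hol_near (fun w => f1 (w - z))).
  by apply/nbhsCP; exists rho => // w /D[/cder_derive1].
by apply/nbhsCP; exists rho => // w /D[_ h]; exists (f2 (w - z)).
Qed.

End HolomorphicDerivative.

Section Holomorphic.
Context {R : realType}.
Local Notation C := R[i].
Implicit Types (f g : C -> C) (z w a b : C) (n : nat).

Lemma hol_cders f z : hol f z -> \forall w \near z, cder f w (derive1 f w).
Proof. by move=> /hol_open; apply: filterS => w; exact: hol_cder. Qed.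

Lemma hol_continuous f z : hol f z -> {for z, continuous f}.
Proof. by move=> /hol_cder/rd_cont. Qed.

Lemma Re_iM z : complex.Re ('i%C * z) = - complex.Im z.
Proof. by case: z => x y /=; ring. Qed.

Lemma Im_iM z : complex.Im ('i%C * z) = complex.Re z.
Proof. by case: z => x y /=; ring. Qed.

(** By the Cauchy-Riemann equations the partial derivatives of Re f and Im f are, up to sign, the
    real and imaginary parts of f', again a holomorphic function. *)
Lemma hol_smn n f z : hol f z ->
  smn n (@complex.Re R \o f) z /\ smn n (@complex.Im R \o f) z.
Proof.
elim: n f => [|n IH] f hf.
  have c : \forall w \near z, {for w, continuous f}.
    by apply: filterS (hol_open hf) => w; exact: hol_continuous.
  split; apply: smn0; apply: filterS c => w; [exact: cont_Re|exact: cont_Im].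
have [h1 h2] := IH _ (hol_derive1 hf); have d := hol_cders hf.
have h3 : smn n (fun w => -1 * complex.Im (derive1 f w)) z.
  by apply: smnM h2; exact: smn_cst.
split; [apply: smn_rdS h1 h3|apply: smn_rdS h2 h1]; apply: filterS d => w hw.
  apply: rd_eq (rdRe hw) erefl _; congr (_%:C).
  by rewrite Re_iM mulN1r.
apply: rd_eq (rdIm hw) erefl _; congr (_%:C).
exact: Im_iM.
Qed.

Lemma hol_sm2 f z : hol f z -> sm2 f z.
Proof.
move=> hf; have h := hol_open hf.
by split; apply: (@sm_ind _ (hol f)) => // w n hw;
  [exact: (hol_smn n hw).1|exact: (hol_smn n hw).2].
Qed.

Lemma hol_cst (a z : C) : hol (fun=> a) z.
Proof. by apply: filterE => w; exists 0; exact: cder_cst. Qed.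

Lemma hol_id z : hol id z.
Proof. by apply: filterE => w; exists 1; exact: cder_id. Qed.

Lemma holD f g z : hol f z -> hol g z -> hol (fun w => f w + g w) z.
Proof. by apply: filterS2 => w [p hp] [q hq]; exists (p + q); exact: cderD. Qed.

Lemma holB f g z : hol f z -> hol g z -> hol (fun w => f w - g w) z.
Proof. by apply: filterS2 => w [p hp] [q hq]; exists (p - q); exact: cderB. Qed.

Lemma holM f g z : hol f z -> hol g z -> hol (fun w => f w * g w) z.
Proof. by apply: filterS2 => w [p hp] [q hq]; eexists; exact: cderM hp hq. Qed.

Lemma holX n f z : hol f z -> hol (fun w => f w ^+ n) z.
Proof. by apply: filterS => w [p hp]; eexists; exact: cderX hp. Qed.

Lemma hol_comp f g z : hol f z -> hol g (f z) -> hol (g \o f) z.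
Proof.
move=> hf hg; have := cont_near (hol_continuous hf) hg.
by apply: filterS2 hf => w [p hp] [q hq]; eexists; exact: cder_comp hp hq.
Qed.

Lemma near_neq0 f z : {for z, continuous f} -> f z != 0 -> \forall w \near z, f w != 0.
Proof.
move=> /contC c f0; have p : 0 < nm (f z) by rewrite nm_gt0.
apply: filterS (c _ p) => w h; apply/eqP => w0; move: h.
by rewrite w0 sub0r nmN ltxx.
Qed.

Lemma holV f z : hol f z -> f z != 0 -> hol (fun w => (f w)^-1) z.
Proof.
move=> hf f0; have := near_neq0 (hol_continuous hf) f0.
by apply: filterS2 hf => w [p hp] w0; eexists; exact: cderV hp w0.
Qed.

Lemma hol_expz f z (m : int) : hol f z -> f z != 0 -> hol (fun w => f w ^ m) z.
Proof.
move=> hf f0; case: m => n; first exact: holX.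
by apply: holV; [exact: holX|exact: expf_neq0].
Qed.

Lemma hol_primitive f z : hol f z ->
  exists F : C -> C, \forall w \near z, cder F w (f w).
Proof.
move=> /nbhsCP[e e0 H]; have [F dF] := ball_primitive H.
by exists F; apply/nbhsCP; exists e.
Qed.

Lemma cder0_near f z : (\forall w \near z, cder f w 0) -> \forall w \near z, f w = f z.
Proof.
move=> /nbhsCP[e e0 H]; apply/nbhsCP; exists e => // w we.
apply/eqP; rewrite -subr_eq0 -nm_eq0 eq_le nm_ge0 andbT.
have := @nm_mv _ f (fun=> 0) z w 0; rewrite mul0r; apply=> t t01; last by rewrite nm0.
by apply: H; apply: lin_ball => //; rewrite subrr nm0.
Qed.

(* The two partial derivatives of |f|^2 are twice the real and imaginary
   parts of f' times the conjugate of f. *)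
Lemma unimodular_near_cst f z (c : R) : hol f z -> (\forall w \near z, nm (f w) = c) ->
  0 < c -> \forall w \near z, f w = f z.
Proof.
move=> hf hc c0; apply: cder0_near.
have d := hol_cders hf; have nc := near_near_C hc; apply: filterS2 d nc => w dw cw.
suff -> : 0 = derive1 f w by [].
move: dw; set p := derive1 f w => dw.
have fw : nm (f w) = c by exact: nbhs_singleton cw.
have h := rdD (rdM (rdRe dw) (rdRe dw)) (rdM (rdIm dw) (rdIm dw)).
have h0 : rd (fun w => (complex.Re (f w))%:C * (complex.Re (f w))%:C
     + (complex.Im (f w))%:C * (complex.Im (f w))%:C) w 0 0.
  apply: rd_near (rd_cst (c ^+ 2)%:C w); apply: filterS cw => t ht.
  by rewrite -ht nm_sqr /sqmod -!rmorphM -rmorphD /= !expr2.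
have [e1 e2] := rd_unique h h0; move: e1 e2.
move: fw; case: (f w) => x y; case: p {dw h} => u v /= fw.
rewrite !mul0r !mul1r !sub0r !add0r ?addr0 -!rmorphM -!rmorphD /=.
move=> /(congr1 (@complex.Re R)) /= e1 /(congr1 (@complex.Re R)) /= e2.
have s0 : 0 < x * x + y * y.
  have : nm (x +i* y) ^+ 2 = x * x + y * y by rewrite nm_sqr /sqmod /= !expr2.
  by move=> <-; rewrite fw exprn_gt0.
have A : x * u + y * v = 0 by lra.
have B : y * u - x * v = 0 by lra.
have u0 : (x * x + y * y) * u = 0.
  rewrite (_ : _ * u = x * (x * u + y * v) + y * (y * u - x * v)); last ring.
  by rewrite A B !mulr0 addr0.
have v0 : (x * x + y * y) * v = 0.
  rewrite (_ : _ * v = y * (x * u + y * v) - x * (y * u - x * v)); last ring.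
  by rewrite A B !mulr0 subr0.
move: u0 v0 => /eqP; rewrite mulf_eq0 gt_eqF //= => /eqP ->.
by move=> /eqP; rewrite mulf_eq0 gt_eqF //= => /eqP ->.
Qed.

End Holomorphic.

(** * Holomorphic inverse functions and roots *)

Section InverseFunction.
Context {R : realType}.
Local Notation C := R[i].
Implicit Types (f g : C -> C) (z w a b : C) (n : nat).

Lemma half_powers_small (s e : R) : 0 <= s -> 0 < e -> exists n, s / 2 ^+ n < e.
Proof.
move=> s0 e0; have [N hN] : exists N : nat, s / e < N%:R.
  by exists (Num.bound (s / e)); apply: archi_boundP; rewrite divr_ge0 // ltW.
exists N; rewrite ltr_pdivrMr ?exprn_gt0 // -ltr_pdivrMl // mulrC.
apply: lt_le_trans hN _; rewrite -natrX ler_nat; exact: ltnW (ltn_expl N (ltnSn 1)).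
Qed.

(* Newton's iteration z - (f z - y) / p, with a fixed slope p. *)
Lemma newton_surj f b (p : C) (s : R) : 0 < s -> p != 0 ->
  (forall z w, nm (z - b) < s -> nm (w - b) < s ->
     nm (f w - f z - p * (w - z)) <= nm p / 2 * nm (w - z)) ->
  forall y, nm (y - f b) < nm p * (s / 8) ->
  exists2 z, nm (z - b) < s & f z = y.
Proof.
move=> s0 p0 H y hy; have np : 0 < nm p by rewrite nm_gt0.
pose N z := z - (f z - y) / p.
have NN z w : nm (z - b) < s -> nm (w - b) < s -> nm (N w - N z) <= nm (w - z) / 2.
  move=> zs ws; rewrite -(ler_pM2l np) mulrA -[in leRHS]mulrAC.
  apply: le_trans (H z w zs ws); rewrite -nmM -nmN le_eqVlt; apply/orP; left.
  by apply/eqP; congr nm; rewrite /N; field.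
(* The first step has length d < s / 8 and each step is at most half the previous one: the iterates
   stay within 2 d of b, and the limit within 4 d. *)
pose d := nm (N b - b); have d0 : 0 <= d by exact: nm_ge0.
have ds : d < s / 8.
  rewrite -(ltr_pM2l np) -nmM; apply: le_lt_trans hy; rewrite le_eqVlt; apply/orP; left.
  by apply/eqP; congr nm; rewrite /N; field.
pose u n := iter n N b.
have inv n : nm (u n - b) <= 2 * d * (1 - 1 / 2 ^+ n) /\ nm (u n.+1 - u n) <= d / 2 ^+ n.
  elim: n => [|n [i1 i2]].
    by rewrite expr0 !divr1; split; [rewrite /= !subrr nm0 mulr0|exact: lexx].
  have pn : 0 < (2 : R) ^+ n by rewrite exprn_gt0.
  have q0 : 0 < 1 / (2 : R) ^+ n by rewrite divr_gt0.
  have qS : 1 / (2 : R) ^+ n.+1 = 1 / 2 ^+ n / 2.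
    by rewrite exprSr; field; rewrite gt_eqF.
  have dE k : d / 2 ^+ k = d * (1 / 2 ^+ k) by rewrite mul1r.
  rewrite dE in i2; rewrite dE qS.
  set q := 1 / 2 ^+ n in q0 i1 i2 *.
  have j1 : nm (u n.+1 - b) <= 2 * d * (1 - q / 2).
    by have := nm_tri (u n.+1) b (u n); lra.
  have dq : 0 <= d * q by rewrite mulr_ge0 // ltW.
  split=> //; have := NN (u n) (u n.+1); rewrite -/(u n.+1) -[N (u n.+1)]/(u n.+2).
  by move=> /(_ _ _)/le_trans => K; apply: (K _ _ _); lra.
have [z hz] := C_half_powers_cauchy d0 (fun n => (inv n).2).
have zs : nm (z - b) < s.
  have := hz 0%N; rewrite expr0 divr1 /= nmC; lra.
exists z => //; apply/eqP; rewrite -subr_eq0 -nm_eq0 eq_le nm_ge0 andbT.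
apply/ler_addgt0Pl => e e0; rewrite addr0.
(* The residual at z is at most 7 |p| d / 2^n: one unit for the residual at [u n], and 6 = 3/2 * 4
   for the passage from [u n] to z. *)
have [n hn] := @half_powers_small (8 * nm p * d) e (mulr_ge0 (mulr_ge0 (ler0n _ _) (ltW np)) d0) e0.
have [i1 i2] := inv n; have q0 : 0 < 1 / (2 : R) ^+ n by rewrite divr_gt0 // exprn_gt0.
have us : nm (u n - b) < s.
  apply: le_lt_trans i1 _; have : 0 <= d * (1 / 2 ^+ n) by rewrite mulr_ge0 // ltW.
  by lra.
have E1 : f (u n) - y = - (p * (u n.+1 - u n)) by rewrite /u /= -/(u n) /N; field.
have h1 : nm (f (u n) - y) <= nm p * (d / 2 ^+ n).
  by rewrite E1 nmN nmM ler_pM2l.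
have h2 : nm (f z - f (u n)) <= 3 / 2 * nm p * (4 * d / 2 ^+ n).
  have k := H (u n) z us zs.
  have k2 := nmD (f z - f (u n) - p * (z - u n)) (p * (z - u n)).
  rewrite subrK nmM in k2; have hzn := hz n; rewrite nmC in hzn.
  have : nm p * nm (z - u n) <= nm p * (4 * d / 2 ^+ n) by rewrite ler_pM2l.
  lra.
have := nm_tri (f z) y (f (u n)); move: hn h1 h2; rewrite -!mulrA.
set q := (2 ^+ n)^-1; have : 0 <= nm p * (d * q).
  by rewrite !mulr_ge0 ?nm_ge0 // invr_ge0 exprn_ge0.
lra.
Qed.

(** On a disk where |f' - p| < |p| / 2 the map f - p z is Lipschitz with constant |p| / 2. Hence |f
    w - f z| is at least |p| / 2 * |w - z|, which gives injectivity and the control of the inverse,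
    while Newton's iteration gives openness. *)
Lemma inverse_function f a : hol f a -> derive1 f a != 0 ->
  exists2 r : R, 0 < r & exists G : C -> C,
    [/\ forall z, nm (z - a) < r -> hol f z /\ derive1 f z != 0,
        forall z, nm (z - a) < r -> G (f z) = z,
        forall z, nm (z - a) < r -> hol G (f z) &
        open (f @` [set z | nm (z - a) < r])].
Proof.
move=> hf; have /contC := hol_continuous (hol_derive1 hf).
move: (derive1 f a) => p cp p0; have np : 0 < nm p by rewrite nm_gt0.
have /nbhsCP[r1 r10 H1] := cp _ (half_pos np).
have /nbhsCP[r2 r20 H2] := hol_open hf.
pose r := Num.min r1 r2; have r0 : 0 < r by exact: min_gt0.
have B1 z : nm (z - a) < r -> nm (derive1 f z - p) < nm p / 2.
  by rewrite lt_min => /andP[/H1].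
have B2 z : nm (z - a) < r -> hol f z by rewrite lt_min => /andP[_ /H2].
have lip z w : nm (z - a) < r -> nm (w - a) < r ->
    nm (f w - f z - p * (w - z)) <= nm p / 2 * nm (w - z).
  move=> za wa; have K (t : R) : 0 <= t <= 1 -> nm (lin z w t - a) < r.
    by move=> t01; exact: lin_ball.
  have -> : f w - f z - p * (w - z) = (f w - p * w) - (f z - p * z) by ring.
  apply: (@nm_mv _ (fun x => f x - p * x) (fun x => derive1 f x - p)) => t /K k.
    apply: cderB; first exact: hol_cder (B2 _ k).
    by apply: cder_eq (cderM (cder_cst p _) (cder_id _)) _; rewrite mul0r add0r mulr1.
  exact: ltW (B1 _ k).
have inj z w : nm (z - a) < r -> nm (w - a) < r ->
    nm p / 2 * nm (w - z) <= nm (f w - f z).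
  move=> za wa; have := nmD (f w - f z) (- (f w - f z - p * (w - z))).
  rewrite nmN (_ : _ + - _ = p * (w - z)); last by ring.
  by rewrite nmM; have := lip z w za wa; lra.
pose G y := xget a [set z | nm (z - a) < r /\ f z = y].
have GK z : nm (z - a) < r -> G (f z) = z.
  move=> za; have [ga gE] : nm (G (f z) - a) < r /\ f (G (f z)) = f z.
    by apply: (@xgetPex _ a [set x | nm (x - a) < r /\ f x = f z]); exists z.
  have := inj _ _ za ga; rewrite gE subrr nm0 pmulr_rle0 ?half_pos // => h.
  by apply/eqP; rewrite -subr_eq0 -nm_eq0 eq_le h nm_ge0.
have loc b : nm (b - a) < r -> exists2 d : R, 0 < d & forall y, nm (y - f b) < d ->
    exists2 z, nm (z - a) < r & f z = y.
  move=> ba; have s0 : 0 < r - nm (b - a) by lra.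
  have inr z : nm (z - b) < r - nm (b - a) -> nm (z - a) < r.
    by have := nm_tri z a b; lra.
  exists (nm p * ((r - nm (b - a)) / 8)); first by rewrite mulr_gt0 // divr_gt0.
  move=> y /(newton_surj s0 p0 (fun z w hz hw => lip z w (inr z hz) (inr w hw)))[z hz <-].
  by exists z => //; exact: inr.
exists r; first exact: r0.
exists G; split.
- move=> z za; split; first exact: B2.
  rewrite -nm_gt0; have := B1 z za; have := nm_tri p 0 (derive1 f z).
  by rewrite !subr0 (nmC p (derive1 f _)); lra.
- exact: GK.
- move=> z za; have [d d0 hd] := loc z za.
  apply/nbhsCP; exists d => // y /hd[w wa <-]; exists (derive1 f w)^-1.
  have p1 : derive1 f w != 0.
    rewrite -nm_gt0; have := B1 w wa; have := nm_tri p 0 (derive1 f w).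
    by rewrite !subr0 (nmC p (derive1 f _)); lra.
  have p1n : 0 < nm (derive1 f w) by rewrite nm_gt0.
  move=> e e0; have c0 : 0 < e * nm (derive1 f w) * (nm p / 2).
    by rewrite !mulr_gt0 // divr_gt0.
  have [d1 d10 h1] := hol_cder (B2 w wa) c0.
  have [d2 d20 h2] := loc w wa.
  exists (Num.min d2 (d1 * (nm p / 2))).
    by apply: min_gt0 => //; rewrite mulr_gt0 // divr_gt0.
  move=> h; rewrite lt_min => /andP[k1 k2].
  have [|x xa xE] := h2 (f w + h); first by rewrite addrC addKr.
  have hE : h = f x - f w by rewrite xE addrC addKr.
  rewrite -xE !GK // dl_conf.
  have xw : nm p / 2 * nm (x - w) <= nm h by rewrite hE; exact: inj.
  have := h1 (x - w); rewrite [w + _]addrC subrK dl_conf -hE => /(_ _) K.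
  have xd1 : nm (x - w) < d1.
    by rewrite -(ltr_pM2l (half_pos np)); apply: le_lt_trans xw _; rewrite mulrC.
  have {}K := K xd1.
  have -> : x - w - h * (derive1 f w)^-1 = - ((h - (x - w) * derive1 f w) / derive1 f w).
    by field.
  rewrite nmN nmM nmV ler_pdivrMr //; apply: le_trans K _.
  have : e * nm (derive1 f w) * (nm p / 2 * nm (x - w)) <= e * nm (derive1 f w) * nm h.
    by rewrite ler_wpM2l // mulr_ge0 ?nm_ge0 // ltW.
  lra.
- rewrite openE => _ [z za <-]; have [d d0 hd] := loc z za.
  by apply/nbhsCP; exists d => // y /hd[x xa <-]; exists x.
Qed.

(** The root is the composition of f with the local inverse of z^n at a root b of f(a); the
    derivative n b^(n-1) is nonzero because b is. *)
Lemma hol_root f a n : (0 < n)%N -> hol f a -> f a != 0 ->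
  exists g : C -> C, hol g a /\ \forall w \near a, g w ^+ n = f w.
Proof.
move=> n0 hf f0; pose b : C := n.-root (f a).
have bn : b ^+ n = f a by exact: rootCK.
have b0 : b != 0 by apply: contra_neq f0 => b0; rewrite -bn b0 expr0n eqn0Ngt n0.
have hX : hol (fun z => z ^+ n) b by apply: holX; exact: hol_id.
have dX : derive1 (fun z : C => z ^+ n) b != 0.
  rewrite (cder_derive1 (cderX n (cder_id b))) mulr1 mulrn_eq0 negb_or -lt0n n0 /=.
  exact: expf_neq0.
have [r r0 [G [_ GK GH oG]]] := inverse_function hX dX.
have bb : nm (b - b) < r by rewrite subrr nm0.
exists (G \o f); split.
  by apply: hol_comp => //; rewrite -bn; exact: GH.
have nG : nbhs (f a) ((fun z : C => z ^+ n) @` [set z | nm (z - b) < r]).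
  by apply: open_nbhs_nbhs; split=> //; exists b.
have := cont_near (hol_continuous hf) nG; apply: filterS => w [z zb E].
rewrite /= -E; exact: (congr1 (fun x => x ^+ n) (GK z zb)).
Qed.

End InverseFunction.

(** * The conformal coordinate at a zero or a pole *)

Section ConeCoordinate.
Context {R : realType}.
Local Notation C := R[i].
Implicit Types (f g : C -> C) (z w a b : C) (n : nat).

Lemma nbhsC_and z (P Q : C -> Prop) : nbhs z P -> nbhs z Q -> nbhs z (fun w => P w /\ Q w).
Proof. by move=> p q; apply: filterI. Qed.

Lemma cd_of_real (t : R) : cd (fun s : R => s%:C : C) t 1.
Proof. by apply: cd_eq (cd_real (is_derive_id t (1 : R))) _. Qed.

Lemma cd_real_comp f (t : R) p : cder f t%:C p -> cd (fun s : R => f s%:C) t p.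
Proof. by move=> h; apply: cd_eq (cd_ccomp (cd_of_real t) h) _; rewrite mulr1. Qed.

Lemma cder_scale f (c w : C) p : cder f (c * w) p -> cder (fun z => f (c * z)) w (p * c).
Proof.
move=> h; have k := cderM (cder_cst c w) (cder_id w).
by apply: cder_eq (cder_comp k h) _; rewrite mul0r add0r mulr1.
Qed.

(* k(w) is the integral of 4 t^(n-1) f(t^4 w) over [0, 1]; differentiating
   t^n f(t^4 w) in t yields the equation. *)
Lemma euler_equation f n : (0 < n)%N -> hol f 0 -> exists k : C -> C,
  hol k 0 /\ \forall w \near (0 : C), n%:R / 4 * k w + w * derive1 k w = f w.
Proof.
(* From here on [n.+1] is the former n, so that t^(n-1) becomes [t%:C ^+ n]. *)
case: n => // n _ hf; have h1 := hol_derive1 hf; have h2 := hol_derive1 h1.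
have /contC/(_ 1 ltr01)/nbhsCP[d2 d20 H2] := hol_continuous h2.
have /nbhsCP[d0 d00 H0] := hol_cders hf.
have /nbhsCP[d1 d10 H1] := hol_cders h1.
have /contC := hol_continuous h2; move: (derive1 (derive1 f)) H1 H2 => f2 H1 H2 _.
move: (derive1 f) {h1 h2} H0 H1 => f1 H0 H1.
pose d := Num.min d0 (Num.min d1 d2).
have d_gt0 : 0 < d by do 2! apply: min_gt0 => //.
pose B := 4 * (nm (f2 0) + 1); have B0 : 0 <= B.
  by have := nm_ge0 (f2 0); rewrite /B; lra.
pose G w (t : R) := 4 * t%:C ^+ n * f (t%:C ^+ 4 * w).
pose G1 w (t : R) := 4 * t%:C ^+ n * (f1 (t%:C ^+ 4 * w) * t%:C ^+ 4).
pose G2 w (t : R) := 4 * t%:C ^+ n * (f2 (t%:C ^+ 4 * w) * t%:C ^+ 4 * t%:C ^+ 4).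
have tn (t : R) k : 0 <= t <= 1 -> nm (t%:C ^+ k) <= 1.
  by move=> /andP[t0 t1]; rewrite nmX nmR ger0_norm // exprn_ile1.
have small w (t : R) : nm (w - 0) < d -> 0 <= t <= 1 -> nm (t%:C ^+ 4 * w - 0) < d.
  rewrite !subr0 => wd t01; apply: le_lt_trans wd; rewrite nmM.
  by rewrite ler_piMl ?nm_ge0 // tn.
have ct k : contI (fun t : R => t%:C ^+ k).
  by move=> t _; exact: cd_cont (cd_real_comp (cderX k (cder_id _))).
have carg w : contI (fun t : R => t%:C ^+ 4 * w).
  by move=> t t01; apply: contM; [exact: ct|exact: cont_cst].
have c4 k : contI (fun t : R => 4 * t%:C ^+ k).
  by move=> t t01; apply: contM; [exact: cont_cst|exact: ct].
have K0 w (t : R) : nm (w - 0) < d -> 0 <= t <= 1 ->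
    cder f (t%:C ^+ 4 * w) (f1 (t%:C ^+ 4 * w)).
  by move=> wd t01; apply: H0; have := small w t wd t01; rewrite !lt_min => /and3P[].
have K1 w (t : R) : nm (w - 0) < d -> 0 <= t <= 1 ->
    cder f1 (t%:C ^+ 4 * w) (f2 (t%:C ^+ 4 * w)).
  by move=> wd t01; apply: H1; have := small w t wd t01; rewrite !lt_min => /and3P[].
have cG w : nm (w - 0) < d -> contI (G w).
  move=> wd t t01; apply: contM; first exact: c4.
  by apply: (@cont_comp _ _ _ (fun t : R => t%:C ^+ 4 * w) f);
    [exact: carg|exact: rd_cont (K0 w t wd t01)].
have cG1 w : nm (w - 0) < d -> contI (G1 w).
  move=> wd t t01; apply: contM; first exact: c4.
  apply: contM; last exact: ct.
  by apply: (@cont_comp _ _ _ (fun t : R => t%:C ^+ 4 * w) f1);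
    [exact: carg|exact: rd_cont (K1 w t wd t01)].
have nm4 : nm (4 : C) = 4 by rewrite -(rmorph_nat (real_complex R)) nmR ger0_norm.
have J w : nm (w - 0) < d -> cder (fun w => Itg (G w)) w (Itg (G1 w)).
  apply: (@Itg_cder _ G G1 G2 0 d B B0 _ cG cG1) => z t zd t01; split.
  - by apply: cder_eq (cderM (cder_cst _ z) (cder_scale (K0 z t zd t01))) _;
      rewrite mul0r add0r.
  - have k := cderM (cder_scale (K1 z t zd t01)) (cder_cst (t%:C ^+ 4) z).
    by apply: cder_eq (cderM (cder_cst _ z) k) _; rewrite mul0r add0r mulr0 addr0.
  - rewrite /G2 (nmM (4 * _)) (nmM 4) (nmM (_ * t%:C ^+ 4) (t%:C ^+ 4)) (nmM (f2 _) (t%:C ^+ 4)) nm4 /B.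
    have b1 := tn t n t01; have b2 := tn t 4%N t01.
    have b3 : nm (f2 (t%:C ^+ 4 * z)) <= nm (f2 0) + 1.
      have := small z t zd t01; rewrite !lt_min => /and3P[_ _ /H2 h].
      by have := nm_tri (f2 (t%:C ^+ 4 * z)) 0 (f2 0); rewrite !subr0; lra.
    rewrite -mulrA ler_pM2l //; apply: le_trans (ler_piMl _ b1) _.
      by rewrite !mulr_ge0 ?nm_ge0.
    apply: le_trans (ler_piMr _ b2) _; first by rewrite !mulr_ge0 ?nm_ge0.
    by apply: le_trans (ler_piMr _ b2) _; rewrite ?nm_ge0.
exists (fun w => Itg (G w)); split.
  by apply/nbhsCP; exists d => // w /J h; eexists; exact: h.
apply/nbhsCP; exists d => // w wd; rewrite (cder_derive1 (J w wd)).
pose P (t : R) := t%:C ^+ n.+1 * f (t%:C ^+ 4 * w).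
have dP (t : R) : 0 <= t <= 1 -> cd P t (n.+1%:R / 4 * G w t + w * G1 w t).
  move=> t01; have k1 := cderX n.+1 (cder_id t%:C).
  have k2 := cderM (cderX 4 (cder_id t%:C)) (cder_cst w t%:C).
  have k3 := cder_comp k2 (K0 w t wd t01).
  have k4 := cderM k1 k3.
  apply: cd_eq (cd_real_comp k4) _; rewrite /G /G1 /= !mulr1 mulr0 addr0.
  rewrite -[_ *+ n.+1]mulr_natr -[_ *+ 4]mulr_natr [t%:C ^+ n.+1]exprS.
  move: (f _) (f1 _) (n.+1%:R : C) => a b N; move: (t%:C ^+ n) (t%:C) => Tn T.
  by field.
have i1 := isI_cd dP; rewrite /P /= rmorph1 rmorph0 !expr1n !expr0n /= !mul0r !mul1r subr0 in i1.
have i2 := isID (isIZ (n.+1%:R / 4) (ItgP (cG w wd))) (isIZ w (ItgP (cG1 w wd))).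
exact: (isI_unique i2 i1 (fun _ _ => erefl)).
Qed.

(* With L^(m+4) = ((m+4)/4 k)^4, where (m+4)/4 k + w k' = f, the coordinate
   is z = w L: then z^((m+4)/4) is (m+4)/4 times the primitive of
   w^(m/4) f. *)
Lemma cone_coordinate f n : (0 < n)%N -> hol f 0 -> f 0 != 0 -> exists z : C -> C,
  [/\ hol z 0, z 0 = 0, derive1 z 0 != 0 &
   \forall w \near (0 : C), w != 0 ->
     derive1 z w ^+ 4 * z w ^ (n%:Z - 4) = w ^ (n%:Z - 4) * f w ^+ 4].
Proof.
move=> n0 hf f0; have [k [hk kE]] := euler_equation n0 hf.
pose e w := n%:R / 4 * k w; have he : hol e 0 by apply: holM hk; exact: hol_cst.
have e0 : e 0 = f 0 by have := nbhs_singleton kE; rewrite mul0r addr0.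
have n0C : (n%:R : C) != 0 by rewrite pnatr_eq0 -lt0n.
have [L [hL LE]] : exists g : C -> C, hol g 0 /\ \forall w \near 0, g w ^+ n = e w ^+ 4.
  apply: hol_root => //; first exact: holX.
  by rewrite e0 expf_neq0.
have L0 : L 0 != 0.
  apply/eqP => L0; have := nbhs_singleton LE; rewrite L0 e0 expr0n eqn0Ngt n0 /=.
  by move/esym/eqP; rewrite expf_eq0 /= (negbTE f0).
have hz : hol (fun w => w * L w) 0 by apply: holM hL; exact: hol_id.
have dz := hol_cders hz; have dL := hol_cders hL; have dk := hol_cders hk.
exists (fun w => w * L w); split.
- exact: hz.
- by rewrite mul0r.
- rewrite (cder_derive1 (cderM (cder_id 0) (hol_cder hL))) mul1r mul0r addr0.
  exact: L0.
have nL := near_neq0 (hol_continuous hL) L0.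
have ne : \forall w \near (0 : C), e w != 0.
  by apply: near_neq0 (hol_continuous he) _; rewrite e0.
have LE' := near_near_C LE.
have F1 := nbhsC_and (nbhsC_and dL dk) (nbhsC_and nL ne).
have /nbhsCP[d d0 Hd] := nbhsC_and F1 (nbhsC_and LE' kE).
apply/nbhsCP; exists d => // w /Hd [[[dLw dkw] [Lw ew]] [LEw kEw]] w0.
rewrite (cder_derive1 (cderM (cder_id w) dLw)) mul1r.
have de : cder e w (n%:R / 4 * derive1 k w).
  by apply: cder_eq (cderM (cder_cst _ w) dkw) _; rewrite mul0r add0r.
have E1 := nbhs_singleton LEw.
have E2 := cder_unique (rd_near LEw (cderX n dLw)) (cderX 4 de).
move: (derive1 L w) {dLw} E2 => l E2; move: kEw; rewrite -/(e w).
move: (derive1 k w) E2 {dkw de} => k' E2.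
move: (L w) (e w) (f w) Lw ew E1 E2 => y x u y0 x0 E1 E2 E3.
have E5 : n%:R * (y ^+ n.-1 * l) = n%:R * (x ^+ 3 * k').
  rewrite mulr_natl E2 -mulr_natl /= ; by field.
(* With y, x, u, l for L, e, f, L', this reads z' L^n = e^3 f L. It combines f = e + w k' with the
   derivative of L^n = e^4. Its fourth power, divided by e^12 = L^(3n), is the equation sought. *)
have E4 : (y + w * l) * y ^+ n = x ^+ 3 * u * y.
  have A : n%:R * (w * l * y ^+ n) = w * y * (n%:R * (y ^+ n.-1 * l)).
    have yS : y ^+ n = y ^+ n.-1 * y by rewrite -exprSr prednK.
    by rewrite yS; ring.
  by apply: (mulfI n0C); rewrite mulrDl mulrDr A E5 E1 -E3; ring.
have xy : x ^+ 12 = y ^+ n ^+ 3 by rewrite E1 -exprM.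
have E6 : (y + w * l) ^+ 4 * y ^+ n = u ^+ 4 * y ^+ 4.
  apply: (mulfI (expf_neq0 12 x0)); rewrite {1}xy.
  rewrite (_ : _ * (_ * _) = ((y + w * l) * y ^+ n) ^+ 4); last by ring.
  by rewrite E4; ring.
have zE (a : C) : a != 0 -> a ^ (n%:Z - 4) = a ^+ n / a ^+ 4.
  by move=> a0; rewrite expfzDr.
rewrite !zE ?mulf_neq0 // !exprMn.
move: (y + w * l) E6 => t E6.
rewrite (_ : t ^+ 4 * _ = w ^+ n / w ^+ 4 * (t ^+ 4 * y ^+ n) / y ^+ 4).
  by rewrite E6; field; rewrite w0 y0.
by field; rewrite w0 y0.
Qed.

End ConeCoordinate.

(** * The radial map between a cone and a punctured disk *)

Section Radial.
Context {R : realType}.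
Local Notation C := R[i].
Implicit Types (z w v : C) (A b : R).

(* z |-> A |z|^(b - 1) z *)
Definition rad A b z : C := (A * powR (sqmod z) ((b - 1) / 2))%:C * z.

Lemma sqmod_gt0 z : (0 < sqmod z) = (z != 0).
Proof. by rewrite -nm_sqr exprn_even_gt0 //= nm_eq0. Qed.

Lemma rad0 A b : rad A b 0 = 0.
Proof. by rewrite /rad mulr0. Qed.

Lemma powR_expR (x y : R) : powR (expR x) y = expR (y * x).
Proof. by rewrite /powR gt_eqF ?expR_gt0 // expRK. Qed.

(** Writing positive numbers as exponentials reduces identities between real powers to rational
    identities between exponents. *)
Lemma pos_expR (x : R) : 0 < x -> exists y, x = expR y.
Proof. by move=> x0; exists (ln x); rewrite lnK. Qed.

Lemma sqmod_rad A b z : 0 < A -> z != 0 ->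
  sqmod (rad A b z) = A ^+ 2 * powR (sqmod z) b.
Proof.
move=> A0; rewrite -sqmod_gt0 => s0; rewrite /rad sqmodM.
rewrite -[sqmod _%:C]nm_sqr nmR real_normK ?num_real //.
have [a ->] := pos_expR A0; have [l ->] := pos_expR s0.
by rewrite !powR_expR !expr2 -!expRD; congr expR; field.
Qed.

Lemma rad_neq0 A b z : 0 < A -> z != 0 -> rad A b z != 0.
Proof.
move=> A0 z0; rewrite -sqmod_gt0 sqmod_rad // mulr_gt0 ?exprn_gt0 // powR_gt0 //.
by rewrite sqmod_gt0.
Qed.

Lemma radK A b z : 0 < A -> 0 < b -> rad (powR A (- b^-1)) b^-1 (rad A b z) = z.
Proof.
move=> A0 b0; have [->|z0] := eqVneq z 0; first by rewrite !rad0.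
have s0 : 0 < sqmod z by rewrite sqmod_gt0.
have E : powR A (- b^-1) * powR (A ^+ 2 * powR (sqmod z) b) ((b^-1 - 1) / 2)
    * (A * powR (sqmod z) ((b - 1) / 2)) = 1.
  have [a ->] := pos_expR A0; have [l ->] := pos_expR s0.
  rewrite !powR_expR expr2 -!expRD powR_expR -!expRD -[RHS]expR0; congr expR; field.
  by rewrite gt_eqF.
by rewrite {1}/rad sqmod_rad // /rad mulrA -rmorphM /= E mul1r.
Qed.

Lemma rad_cont0 A b : 0 < A -> 0 < b -> {for 0, continuous (rad A b)}.
Proof.
move=> A0 b0; apply/contC => e e0; rewrite rad0.
have p : 0 < e ^+ 2 / A ^+ 2 by rewrite divr_gt0 // exprn_gt0.
have d0 : 0 < powR (e ^+ 2 / A ^+ 2) b^-1 by rewrite powR_gt0.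
apply/nbhsCP; exists (Num.sqrt (powR (e ^+ 2 / A ^+ 2) b^-1)); first by rewrite sqrtr_gt0.
move=> z; rewrite !subr0 => zd; have [->|z0] := eqVneq z 0; first by rewrite rad0 nm0.
rewrite -(ltr_pXn2r (_ : (0 < 2)%N)) ?nnegrE ?nm_ge0 ?(ltW e0) // nm_sqr sqmod_rad //.
rewrite mulrC -ltr_pdivlMr ?exprn_gt0 //.
have zd2 : sqmod z < powR (e ^+ 2 / A ^+ 2) b^-1.
  by move: zd; rewrite /nm ltr_sqrt.
have := @gt0_ltr_powR _ b b0 (sqmod z) (powR (e ^+ 2 / A ^+ 2) b^-1).
rewrite !nnegrE => /(_ _ _ zd2); rewrite -powRrM mulVf ?gt_eqF // powRr1 ?(ltW p) //.
by apply; rewrite ltW // sqmod_gt0.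
Qed.

Lemma sm_sqmod z : sm (@sqmod R) z.
Proof. by apply: smD; apply: smM; (exact: sm_Re || exact: sm_Im). Qed.

Lemma sm2_rad A b z : z != 0 -> sm2 (rad A b) z.
Proof.
rewrite -sqmod_gt0 => s0.
have h : sm (fun w => A * powR (sqmod w) ((b - 1) / 2)) z.
  by apply: smM; [exact: sm_cst|apply: sm_powR s0 _; exact: sm_sqmod].
split.
  apply: sm_near (smM h (sm_Re z)); apply: filterE => -[x y].
  by rewrite /rad /=; simpc => /=; rewrite ?mul0r ?subr0.
apply: sm_near (smM h (sm_Im z)); apply: filterE => -[x y].
by rewrite /rad /=; simpc => /=; rewrite ?mul0r ?addr0.
Qed.

Lemma rad_cont A b z : 0 < A -> 0 < b -> {for z, continuous (rad A b)}.
Proof.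
move=> A0 b0; have [->|z0] := eqVneq z 0; first exact: rad_cont0.
exact: sm2_cont (sm2_rad A b z0).
Qed.

Lemma rd_sqmod z : rd (fun w => (sqmod w)%:C) z (2 * complex.Re z)%:C (2 * complex.Im z)%:C.
Proof.
have h := rdD (rdM (rd_Re z) (rd_Re z)) (rdM (rd_Im z) (rd_Im z)).
apply: rd_ext (rd_eq h _ _) => [w||].
- by rewrite -!rmorphM -rmorphD /sqmod !expr2.
- by rewrite !mulr1 !mul1r !mul0r !mulr0 !addr0 rmorphM rmorph_nat /=; ring.
- by rewrite !mulr1 !mul1r !mul0r !mulr0 !add0r rmorphM rmorph_nat /=; ring.
Qed.

Definition rad_diff A b z v : C :=
  (A * powR (sqmod z) ((b - 1) / 2))%:C *
    (v + ((b - 1) / sqmod z * complex.Re (v * z^*%C))%:C * z).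

Lemma rd_rad A b z : z != 0 -> rd (rad A b) z (rad_diff A b z 1) (rad_diff A b z 'i%C).
Proof.
rewrite -sqmod_gt0 => s0.
have h1 := rdM (rd_cst A%:C z) (rd_powR ((b - 1) / 2) s0 (rd_sqmod z)).
have h := rdM h1 (cder_id z).
have E : powR (sqmod z) ((b - 1) / 2 - 1) = powR (sqmod z) ((b - 1) / 2) / sqmod z.
  move: (sqmod z) s0 => s /pos_expR[l ->].
  by rewrite !powR_expR -expRN -expRD; congr expR; ring.
have e1 : complex.Re (1 * z^*%C) = complex.Re z by case: (z) => x y /=; ring.
have e2 : complex.Re ('i%C * z^*%C) = complex.Im z by case: (z) => x y /=; ring.
have sC : (sqmod z)%:C != 0 :> C by rewrite -nm_gt0 nmR normr_gt0 gt_eqF.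
move: (complex.Re z) (complex.Im z) e1 e2 h => x y e1 e2 h.
apply: rd_ext (rd_eq h _ _) => [w||]; first by rewrite -rmorphM.
- rewrite /rad_diff E e1 mul0r add0r; move: (sqmod z) sC => s sC.
  move: (powR _ _) => P; rewrite !rmorphM !fmorphV rmorphB rmorph1 /= (rmorph_nat _ 2).
  by field.
- rewrite /rad_diff E e2 mul0r add0r; move: (sqmod z) sC => s sC.
  move: (powR _ _) => P; rewrite !rmorphM !fmorphV rmorphB rmorph1 /= (rmorph_nat _ 2).
  by field.
Qed.

Lemma rad_diffE A b z v : z != 0 ->
  dl (rad_diff A b z 1) (rad_diff A b z 'i%C) v = rad_diff A b z v.
Proof.
move=> z0; rewrite /dl /rad_diff.
have -> : complex.Re (v * z^*%C) = complex.Re v * complex.Re (1 * z^*%C) +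
    complex.Im v * complex.Re ('i%C * z^*%C) by case: (v) (z) => a c [x y] /=; ring.
move: (complex.Re (1 * _)) (complex.Re ('i%C * _)) => x y.
rewrite [in RHS](complexE v); move: (complex.Re v) (complex.Im v) => a c.
rewrite !rmorphM !rmorphD !rmorphM /=; ring.
Qed.

(** The differential stretches by P = A |z|^(b-1) in the tangential direction and by b P in the
    radial one. *)
Lemma jac_rad A b z : 0 < A -> 0 < b -> z != 0 -> 0 < jacobian_det (rad A b) z.
Proof.
move=> A0 b0 z0; rewrite (rd_jacobian (rd_rad A b z0)).
have s0 : 0 < sqmod z by rewrite sqmod_gt0.
rewrite /rad_diff; set P := A * _; have P0 : 0 < P by rewrite mulr_gt0 // powR_gt0.
have -> : complex.Re (1 * z^*%C) = complex.Re z by case: (z) => x y /=; ring.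
have -> : complex.Re ('i%C * z^*%C) = complex.Im z by case: (z) => x y /=; ring.
rewrite [X in 0 < X](_ : _ = P ^+ 2 * b); first by rewrite mulr_gt0 ?exprn_gt0.
have : sqmod z != 0 by rewrite gt_eqF.
have : complex.Re z ^+ 2 + complex.Im z ^+ 2 = sqmod z by [].
case: (z) => x y /=; move: (sqmod _) => s sE sn.
rewrite !mul0r ?subr0 ?addr0 ?add0r.
rewrite -sE in sn *; field; exact: sn.
Qed.

(* With A = 1/b and b = theta / 2 pi, the cone metric in the coordinate
   A |z|^(b-1) z is |z|^(2(b-1)) |dz|^2. *)
Lemma cone_sqlen_rad theta z v : 0 < theta -> z != 0 ->
  let b := theta / (2 * pi) in
  cone_sqlen theta (rad b^-1 b z) (rad_diff b^-1 b z v) =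
    powR (sqmod z) (b - 1) * sqmod v.
Proof.
move=> t0 z0 b; have b0 : 0 < b by rewrite divr_gt0 // mulr_gt0 // pi_gt0.
have s0 : 0 < sqmod z by rewrite sqmod_gt0.
rewrite /cone_sqlen -/b sqmod_rad ?invr_gt0 //.
rewrite /rad /rad_diff; set P := b^-1 * _.
have PE : P ^+ 2 = b ^- 2 * powR (sqmod z) (b - 1).
  rewrite /P exprMn exprVn; congr (_ * _).
  by have [l ->] := pos_expR s0; rewrite !powR_expR expr2 -expRD; congr expR; field.
have sE : powR (sqmod z) b = sqmod z * powR (sqmod z) (b - 1).
  by have [l ->] := pos_expR s0; rewrite !powR_expR -expRD; congr expR; ring.
have zE : z * z^*%C = (sqmod z)%:C by case: (z) => x y; rewrite /sqmod /=; simpc; congr (_ +i* _); ring.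
have -> : P%:C * (v + ((b - 1) / sqmod z * complex.Re (v * z^*%C))%:C * z) * (P%:C * z)^*%C =
   (P ^+ 2)%:C * (v * z^*%C + ((b - 1) * complex.Re (v * z^*%C))%:C).
  have -> : (P%:C * z)^*%C = P%:C * z^*%C by rewrite (rmorphM conjc) /= oppr0.
  rewrite (_ : _ * _ = (P ^+ 2)%:C * (v * z^*%C + ((b - 1) / sqmod z * complex.Re (v * z^*%C))%:C * (z * z^*%C))).
    rewrite zE -rmorphM; congr (_ * (_ + _%:C)); field; by rewrite gt_eqF.
  by rewrite rmorphXn /=; ring.
have -> : sqmod v = sqmod (v * z^*%C) / sqmod z.
  by rewrite sqmodM -[sqmod z^*%C]nm_sqr nm_conj nm_sqr mulfK // gt_eqF.
rewrite sE; move: (v * z^*%C) => [x y]; rewrite PE /sqmod /=.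
rewrite !mul0r ?subr0 ?addr0 ?add0r -/(sqmod z); field.
by rewrite !gt_eqF // powR_gt0.
Qed.

End Radial.

(** * Winding numbers and orientation *)

Section IntervalInduction.
Context {R : realType}.

(* Compactness and connectedness of a segment at once. *)
Lemma itv_ind (Q : R -> R -> Prop) (a b : R) : a <= b ->
  (forall x y z, a <= x -> x <= y -> y <= z -> z <= b -> Q x y -> Q y z -> Q x z) ->
  (forall t, a <= t <= b -> exists2 d : R, 0 < d &
     forall x y, a <= x -> x <= y -> y <= b -> `|x - t| < d -> `|y - t| < d -> Q x y) ->
  Q a b.
Proof.
move=> ab tr loc; pose E := [set s | a <= s <= b /\ Q a s].
have Ea : E a.
  split; first by rewrite lexx.
  have [|d d0 H] := loc a; first by rewrite lexx.
  by apply: H; rewrite ?subrr ?normr0.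
have ubE : ubound E b by move=> s [/andP[]].
have hs : has_sup E by split; [exists a|exists b].
set s := sup E.
have as_ : a <= s by apply: ub_le_sup; [exists b|].
have sb : s <= b by apply: ge_sup => //; exists a.
have [|d d0 H] := loc s; first by rewrite as_.
have [x Ex xs] : exists2 x, E x & s - d < x by exact: sup_adherent.
have xs' : x <= s by apply: ub_le_sup; [exists b|].
case: Ex => /andP[ax xb] Qx.
pose y := Num.min b (s + d / 2).
have sy : s <= y by rewrite /y le_min sb /=; lra.
have yb : y <= b by rewrite /y ge_min lexx.
have yd : y <= s + d / 2 by rewrite /y ge_min lexx orbT.
have xy : x <= y by exact: le_trans sy.
have Qy : Q a y.
  apply: (tr a x y) => //; apply: H => //.
    by rewrite ler0_norm; lra.
  by rewrite ger0_norm; lra.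
have Ey : E y by split=> //; rewrite yb andbT; exact: le_trans sy.
have ys : y <= s by apply: ub_le_sup; [exists b|].
suff -> : b = y by [].
by move: ys; rewrite /y; case: (leP b (s + d / 2)) => // _; lra.
Qed.

End IntervalInduction.

(** * Curves winding once about 0 *)

Section Winding.
Context {R : realType}.
Local Notation C := R[i].
Implicit Types (f g h : C -> C) (z w p q : C) (ga : R -> C).

Lemma polar_exists w : w != 0 -> exists a : R, w = (nm w)%:C * expi a.
Proof.
move=> w0; have n0 : 0 < nm w by rewrite nm_gt0.
pose x := complex.Re w / nm w; pose y := complex.Im w / nm w.
have xy : x ^+ 2 + y ^+ 2 = 1.
  by rewrite /x /y !expr_div_n -mulrDl nm_sqr -/(sqmod w) divff // -nm_sqr expf_neq0 // gt_eqF.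
have x1 : -1 <= x <= 1.
  by rewrite -ler_norml -(@ler_pXn2r _ 2) ?nnegrE // expr1n real_normK ?num_real // -xy lerDl sqr_ge0.
have sE : sin (acos x) = `|y|.
  rewrite sin_acos // (_ : 1 - x ^+ 2 = y ^+ 2); last by rewrite -xy; ring.
  by rewrite sqrtr_sqr.
have wE : w = (nm w)%:C * (x +i* y).
  rewrite /x /y [LHS](_ : w = complex.Re w +i* complex.Im w); last by case: (w).
  by simpc; congr (_ +i* _); field; rewrite gt_eqF.
have [y0|y0] := leP 0 y.
  exists (acos x); rewrite {1}wE /expi acosK ?sE ?ger0_norm //.
exists (- acos x); rewrite {1}wE /expi cosN sinN acosK ?sE ?ltr0_norm ?opprK //.
Qed.

Lemma sin_atan (x : R) : sin (atan x) = x * (Num.sqrt (1 + x ^+ 2))^-1.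
Proof.
have c0 : cos (atan x) != 0.
  by rewrite cos_atan invr_eq0 gt_eqF // sqrtr_gt0 ltr_pwDl ?sqr_ge0.
by rewrite -cos_atan -[in X in X * _](atanK x) /tan divfK.
Qed.

Lemma polar_right w : 0 < complex.Re w ->
  w = (nm w)%:C * expi (atan (complex.Im w / complex.Re w)).
Proof.
case: w => x y /= x0; rewrite /expi cos_atan sin_atan /nm /sqmod /=.
have s0 : 0 < 1 + (y / x) ^+ 2 by rewrite ltr_pwDl ?sqr_ge0.
have -> : x ^+ 2 + y ^+ 2 = x ^+ 2 * (1 + (y / x) ^+ 2) by field; rewrite gt_eqF.
rewrite sqrtrM ?sqr_ge0 // sqrtr_sqr gtr0_norm //.
have S0 : Num.sqrt (1 + (y / x) ^+ 2) != 0 by rewrite gt_eqF ?sqrtr_gt0.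
by simpc; congr (_ +i* _); field; rewrite ?S0 ?gt_eqF.
Qed.

(** The condition that [orientation_preserving_at] puts on the image of one circle, stated for any
    curve so that it can be followed along homotopies. *)
Definition wind1 ga := exists rho a : R -> R,
  [/\ continuous a, a (2 * pi) = a 0 + 2 * pi &
    forall t, 0 <= t <= 2 * pi -> 0 < rho t /\ ga t = (rho t)%:C * expi (a t)].

(** The argument of a curve has to be continuous on the whole line, whereas the perturbing factor is
    controlled on [0, 2 pi] only. *)
Definition cl2pi (t : R) := 2 * pi * clamp (t / (2 * pi)).

Lemma pi2_gt0 : 0 < 2 * pi :> R.
Proof. by rewrite mulr_gt0 // pi_gt0. Qed.

Lemma cl2pi_itv t : 0 <= cl2pi t <= 2 * pi.
Proof.
have := pi2_gt0; have /andP[c0 c1] := clamp_itv (t / (2 * pi)) => p.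
by rewrite /cl2pi; apply/andP; split; [apply: mulr_ge0 => //; exact: ltW|apply: ler_piMr => //; exact: ltW].
Qed.

Lemma cl2pi_id t : 0 <= t <= 2 * pi -> cl2pi t = t.
Proof.
move=> /andP[t0 t1]; have p := pi2_gt0; rewrite /cl2pi clamp_id.
  by rewrite mulrC divfK // gt_eqF.
apply/andP; split; first by apply: divr_ge0 => //; exact: ltW.
by rewrite ler_pdivrMr // mul1r.
Qed.

Lemma cl2pi_continuous t : {for t, continuous cl2pi}.
Proof.
apply: (@cont_comp _ _ _ (fun s : R => clamp (s / (2 * pi))) (fun s : R => 2 * pi * s)).
  apply: (@cont_comp _ _ _ (fun s : R => s / (2 * pi)) clamp); last exact: clamp_continuous.
  by apply: cvgM; [exact: cvg_id|exact: cvg_cst].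
by apply: cvgM; [exact: cvg_cst|exact: cvg_id].
Qed.

(** A factor W at distance less than 1 from 1 stays in the right half-plane, where the arctangent of
    Im W / Re W is a continuous argument. It takes the same value at both ends, and the constant
    [al] adds a constant argument. *)
Lemma wind1_perturb ga ga' (W : R -> C) (al : C) : wind1 ga -> al != 0 ->
  (forall t, 0 <= t <= 2 * pi -> {for t, continuous W}) -> W (2 * pi) = W 0 ->
  (forall t, 0 <= t <= 2 * pi -> nm (W t - 1) < 1 /\ ga' t = al * ga t * W t) ->
  wind1 ga'.
Proof.
move=> [rho [a [ca a2 H]]] al0 cW W2 HW.
have [b bE] := polar_exists al0; have nal : 0 < nm al by rewrite nm_gt0.
have p := pi2_gt0.
have ReW t : 0 <= t <= 2 * pi -> 0 < complex.Re (W t).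
  move=> /HW[h _]; have := le_lt_trans (Re_nm _) h; rewrite raddfB /= ltr_norml; lra.
pose V t := W (cl2pi t).
have cV t : {for t, continuous V}.
  by apply: (@cont_comp _ _ _ cl2pi W); [exact: cl2pi_continuous|apply: cW; exact: cl2pi_itv].
have ReV t : 0 < complex.Re (V t) by apply: ReW; exact: cl2pi_itv.
exists (fun t => nm al * rho t * nm (W t)).
exists (fun t => b + a t + atan (complex.Im (V t) / complex.Re (V t))); split.
- move=> t; apply: cvgD; first by apply: cvgD; [exact: cvg_cst|exact: ca].
  apply: (@cont_comp _ _ _ (fun t => complex.Im (V t) / complex.Re (V t)) atan).
    apply: cvgM; first exact: cont_Im.
    by apply: cvgV; [rewrite gt_eqF|exact: cont_Re].
  exact: continuous_atan.
- have -> : V (2 * pi) = V 0.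
    by rewrite /V !cl2pi_id ?lexx ?ltW //= ltW.
  by rewrite a2; ring.
- move=> t t01; have [r0 gE] := H t t01; have [Wn ->] := HW t t01.
  have R0 := ReW t t01; split.
    rewrite !mulr_gt0 // nm_gt0; apply/eqP => W0; move: R0; by rewrite W0 ltxx.
  rewrite /V cl2pi_id // gE [in LHS](polar_right R0) {1}bE.
  by rewrite !expiD !rmorphM /=; ring.
Qed.

Lemma wind1_eq ga ga' : (forall t, 0 <= t <= 2 * pi -> ga t = ga' t) -> wind1 ga -> wind1 ga'.
Proof.
by move=> E [rho [a [ca a2 H]]]; exists rho, a; split=> // t t01; rewrite -E //; exact: H.
Qed.

Lemma wind1_neq0 ga t : wind1 ga -> 0 <= t <= 2 * pi -> ga t != 0.
Proof.
move=> [rho [a [_ _ H]]] /H[r0 ->]; rewrite mulf_neq0 ?expi_neq0 //.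
by rewrite -nm_gt0 nmR normr_gt0 gt_eqF.
Qed.

Lemma expi_cont (t : R) : {for t, continuous (@expi R)}.
Proof. by apply: cont_complex; [exact: continuous_cos|exact: continuous_sin]. Qed.

Lemma orient_near f g z : (\forall w \near z, f w = g w) ->
  orientation_preserving_at f z -> orientation_preserving_at g z.
Proof.
move=> /nbhsCP[d d0 E] [e e0 H]; exists (Num.min e d).
  by rewrite lt_min e0.
move=> r; rewrite lt_min => /andP[r0 /andP[re rd]].
have /H : 0 < r < e by rewrite r0.
apply: (@wind1_eq (fun t => f (z + r%:C * expi t) - f z)) => t _.
rewrite !E ?subrr ?nm0 //.
by rewrite addrC addKr nmM nm_expi mulr1 nmR gtr0_norm.
Qed.

(** The differential of h is v |-> al v + be conj(v), and its determinant is |al|^2 - |be|^2, so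
    |be| < |al|. On small increments xi of f, the increment of h is therefore al xi W with |W - 1| <
    1. *)
Lemma orient_comp f h z p q : orientation_preserving_at f z ->
  (\forall w \near z, {for w, continuous f}) ->
  (\forall w \near f z, {for w, continuous h}) -> rd h (f z) p q ->
  0 < complex.Re p * complex.Im q - complex.Im p * complex.Re q ->
  orientation_preserving_at (h \o f) z.
Proof.
move=> [e e0 H] /nbhsCP[e1 e10 cf] /nbhsCP[e2 e20 ch] rh det.
pose al := (p - 'i%C * q) / 2; pose be := (p + 'i%C * q) / 2.
have two : (2 : C) != 0 by rewrite pnatr_eq0.
have LE v : dl p q v = al * v + be * v^*%C.
  rewrite /al /be; have ii : 'i%C * 'i%C = -1 :> C by rewrite -expr2 sqr_i.
  case: v => x y; rewrite /dl /=.
  have -> : x +i* y = x%:C + 'i%C * y%:C by rewrite [LHS]complexE.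
  have -> : x -i* y = x%:C - 'i%C * y%:C by rewrite [LHS]complexE /= rmorphN mulrN.
  rewrite [RHS](_ : _ = x%:C * p + y%:C * (- ('i%C * 'i%C) * q)); last by field.
  by rewrite ii opprK mul1r.
have sq : sqmod al - sqmod be = complex.Re p * complex.Im q - complex.Im p * complex.Re q.
  have -> : al = 2^-1%:C * (p - 'i%C * q) by rewrite fmorphV rmorph_nat mulrC.
  have -> : be = 2^-1%:C * (p + 'i%C * q) by rewrite fmorphV rmorph_nat mulrC.
  by case: (p) (q) => a b [c d]; rewrite /sqmod /=; field.
have ab : nm be < nm al.
  rewrite -(@ltr_pXn2r _ 2) ?nnegrE ?nm_ge0 // !nm_sqr; move: det; rewrite -sq; lra.
have nal : 0 < nm al by apply: le_lt_trans ab; exact: nm_ge0.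
have al0 : al != 0 by rewrite -nm_gt0.
have ep0 : 0 < (nm al - nm be) / 2 by lra.
have [d d0 hd] := rh _ ep0.
have m0 : 0 < Num.min d e2 by rewrite lt_min d0.
have cfz : {for z, continuous f} by apply: cf; rewrite subrr nm0.
have /contC/(_ _ m0)/nbhsCP[d1 d10 hd1] := cfz.
exists (Num.min e (Num.min e1 d1)); first by rewrite !lt_min e0 e10.
move=> r; rewrite !lt_min => /andP[r0 /and3P[re re1 rd1]].
have /H W1 : 0 < r < e by rewrite r0.
change (wind1 (fun t => (h \o f) (z + r%:C * expi t) - (h \o f) z)).
pose xi t := f (z + r%:C * expi t) - f z.
have {}W1 : wind1 xi := W1.
have rt (t : R) : nm (z + r%:C * expi t - z) = r.
  by rewrite addrC addKr nmM nm_expi mulr1 nmR gtr0_norm.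
have xis t : nm (xi t) < d /\ nm (xi t) < e2.
  by have := hd1 (z + r%:C * expi t); rewrite rt => /(_ rd1); rewrite lt_min => /andP[].
have cxi (t : R) : {for t, continuous xi}.
  apply: contB; last exact: cont_cst.
  apply: (@cont_comp _ _ _ (fun t => z + r%:C * expi t) f).
    apply: contD; first exact: cont_cst.
    by apply: contM; [exact: cont_cst|exact: expi_cont].
  by apply: cf; rewrite rt.
have chf (t : R) : {for t, continuous (fun t => h (f z + xi t))}.
  apply: (@cont_comp _ _ _ (fun t => f z + xi t) h).
    by apply: contD; [exact: cont_cst|exact: cxi].
  by apply: ch; rewrite addrC addKr; have [] := xis t.
pose W t := (h (f z + xi t) - h (f z)) / (al * xi t).
apply: (@wind1_perturb _ _ W al W1 al0) => [t t01||t t01].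
- have x0 := wind1_neq0 W1 t01.
  apply: contM; first by apply: contB; [exact: chf|exact: cont_cst].
  apply: contV; first exact: mulf_neq0.
  by apply: contM; [exact: cont_cst|exact: cxi].
- by rewrite /W /xi expi0 expi2pi.
- have x0 := wind1_neq0 W1 t01; split; last first.
    have xE : f z + xi t = f (z + r%:C * expi t) by rewrite /xi addrC subrK.
    by rewrite /W xE [RHS]mulrC divfK //; exact: mulf_neq0.
  have nx : 0 < nm (xi t) by rewrite nm_gt0.
  rewrite -(ltr_pM2r (_ : 0 < nm (al * xi t))); last by rewrite nmM mulr_gt0.
  rewrite -nmM mul1r (nmM al).
  rewrite (_ : (W t - 1) * (al * xi t) =
    (h (f z + xi t) - h (f z) - dl p q (xi t)) + be * (xi t)^*%C); last first.
    by rewrite LE /W mulrBl divfK; [rewrite mul1r; ring|exact: mulf_neq0].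
  apply: le_lt_trans (nmD _ _) _.
  have := hd (xi t) (xis t).1; rewrite (nmM be) nm_conj.
  have : 0 < nm (xi t) * ((nm al - nm be) / 2) by rewrite mulr_gt0.
  lra.
Qed.

(** For s and s' close together the quotient of the two curves is within 1 of 1 for all t, and the
    perturbation lemma applies; interval induction covers [0, 1]. *)
Lemma wind1_homotopy (Ga : R -> R -> C) :
  (forall s0 t0 e : R, 0 <= s0 <= 1 -> 0 <= t0 <= 2 * pi -> 0 < e ->
     exists2 d : R, 0 < d & forall s t, 0 <= s <= 1 -> 0 <= t <= 2 * pi ->
       `|s - s0| < d -> `|t - t0| < d -> nm (Ga s t - Ga s0 t0) < e) ->
  (forall s t : R, 0 <= s <= 1 -> 0 <= t <= 2 * pi -> Ga s t != 0) ->
  (forall s (t : R), 0 <= s <= 1 -> {for t, continuous (Ga s)}) ->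
  (forall s : R, 0 <= s <= 1 -> Ga s (2 * pi) = Ga s 0) ->
  wind1 (Ga 0) -> wind1 (Ga 1).
Proof.
move=> J N c per; have p := pi2_gt0.
apply: (@itv_ind _ (fun s s' => wind1 (Ga s) -> wind1 (Ga s')) 0 1 ler01).
  by move=> x y z _ _ _ _ h1 h2 h; exact: h2 (h1 h).
move=> s0 s01.
(* A radius independent of t, by a second interval induction over [0, 2 pi]. *)
have [d d0 hd] : exists2 d : R, 0 < d & forall s s' t : R, 0 <= s <= 1 -> 0 <= s' <= 1 ->
    `|s - s0| < d -> `|s' - s0| < d -> 0 <= t <= 2 * pi ->
    nm (Ga s' t - Ga s t) < nm (Ga s t).
  apply: (@itv_ind _ (fun t t' => exists2 d : R, 0 < d & forall s s' ta : R, 0 <= s <= 1 ->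
    0 <= s' <= 1 -> `|s - s0| < d -> `|s' - s0| < d -> t <= ta <= t' ->
    nm (Ga s' ta - Ga s ta) < nm (Ga s ta)) 0 (2 * pi) (ltW p)).
    move=> x y z _ xy yz _ [d1 d10 h1] [d2 d20 h2]; exists (Num.min d1 d2).
      by rewrite lt_min d10.
    move=> s s' ta hs hs'; rewrite !lt_min => /andP[k1 k2] /andP[k3 k4] /andP[xt tz].
    by have [ty|ty] := leP ta y; [apply: h1|apply: h2]; rewrite // ?xt ?ty ?tz ?ltW.
  move=> t0 t01; have g0 : 0 < nm (Ga s0 t0) by rewrite nm_gt0 N.
  have e0 : 0 < nm (Ga s0 t0) / 4 by lra.
  have [d d0 H] := J s0 t0 _ s01 t01 e0.
  exists d => // x y x0 xy yb xd yd; exists d => // s s' ta hs hs' sd sd' /andP[xta tay].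
  have ta01 : 0 <= ta <= 2 * pi by rewrite (le_trans x0 xta) (le_trans tay yb).
  have tad : `|ta - t0| < d by move: xd yd; rewrite !ltr_norml; lra.
  have := H s ta hs ta01 sd tad; have := H s' ta hs' ta01 sd' tad.
  have := nm_tri (Ga s' ta) (Ga s ta) (Ga s0 t0); rewrite (nmC (Ga s0 t0) (Ga s ta)).
  have := nm_tri (Ga s0 t0) 0 (Ga s ta); rewrite !subr0 (nmC (Ga s0 t0) (Ga s ta)).
  lra.
exists d => // s s' s1 ss' s2 sd sd' W1.
have hs : 0 <= s <= 1 by rewrite s1 (le_trans ss' s2).
have hs' : 0 <= s' <= 1 by rewrite s2 (le_trans s1 ss').
apply: (@wind1_perturb _ _ (fun t => Ga s' t / Ga s t) 1 W1 (oner_neq0 _)) => [t t01||t t01].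
- apply: contM; first exact: c.
  by apply: contV; [exact: N|exact: c].
- by rewrite !per.
- have g0 := N s t hs t01; split; last by rewrite mul1r mulrC divfK.
  rewrite -{1}(divff g0) -mulrBl nmM nmV ltr_pdivrMr ?nm_gt0 // mul1r.
  exact: hd.
Qed.

(* The circles of radius r about the points of a small disk are homotopic,
   and so are the circles of different radii about one point. *)
Lemma orient_isolated f z0 (e : R) : 0 < e ->
  (forall z, nm (z - z0) < e -> {for z, continuous f}) ->
  (forall z w, nm (z - z0) < e -> nm (w - z0) < e -> f z = f w -> z = w) ->
  (forall z, nm (z - z0) < e -> z != z0 -> orientation_preserving_at f z) ->
  orientation_preserving_at f z0.
Proof.
move=> e0 cf inj H; exists e => // r /andP[r0 re].
change (wind1 (fun t => f (z0 + r%:C * expi t) - f z0)).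
(* An auxiliary centre whose distance to z0 leaves room for circles of radius r. A small circle
   about z1, where the orientation is known, is first enlarged to radius r and then moved to the
   centre z0. *)
pose z1 := z0 + ((e - r) / 2)%:C.
have er : 0 < (e - r) / 2 by lra.
have z1e : nm (z1 - z0) = (e - r) / 2.
  by rewrite /z1 addrC addKr nmR gtr0_norm.
have z10 : z1 != z0 by rewrite -subr_eq0 -nm_gt0 z1e.
have [|e1 e10 H1] := H z1 _ z10; first by rewrite z1e; lra.
pose r1 := Num.min (e1 / 2) r.
have r10 : 0 < r1 by rewrite lt_min r0 andbT; lra.
have r1r : r1 <= r by rewrite ge_min lexx orbT.
have W1 : wind1 (fun t => f (z1 + r1%:C * expi t) - f z1).
  by apply: H1; rewrite r10 /= /r1 gt_min; apply/orP; left; lra.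
have key (s : R -> R) (zz : R -> C) : (forall u : R, 0 <= u <= 1 -> 0 < s u) ->
    (forall u : R, 0 <= u <= 1 -> nm (zz u - z0) + s u < e) ->
    (forall u : R, {for u, continuous s}) -> (forall u : R, {for u, continuous zz}) ->
    wind1 (fun t => f (zz 0 + (s 0)%:C * expi t) - f (zz 0)) ->
    wind1 (fun t => f (zz 1 + (s 1)%:C * expi t) - f (zz 1)).
  move=> s_gt0 se cs cz.
  have din (u t : R) : 0 <= u <= 1 -> nm (zz u + (s u)%:C * expi t - z0) < e.
    move=> u01; apply: le_lt_trans (se u u01); rewrite addrAC.
    apply: le_trans (nmD _ _) _.
    by rewrite (nmM _ (expi t)) nm_expi mulr1 nmR gtr0_norm // s_gt0.
  have din0 (u : R) : 0 <= u <= 1 -> nm (zz u - z0) < e.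
    by move=> u01; have := se u u01; have := s_gt0 u u01; lra.
  apply: (@wind1_homotopy (fun u t => f (zz u + (s u)%:C * expi t) - f (zz u))).
  - move=> u0 t0 ep u01 t01 ep0; have ep20 : 0 < ep / 2 by lra.
    have /contC/(_ _ ep20)/nbhsCP[d1 d10 k1] := cf _ (din u0 t0 u01).
    have /contC/(_ _ ep20)/nbhsCP[d2 d20 k2] := cf _ (din0 u0 u01).
    have d30 : 0 < Num.min d1 d2 / 3 by rewrite divr_gt0 // lt_min d10.
    have /contC/(_ _ d30)/nbhsRP[a1 a10 l1] := cz u0.
    have /contR/(_ _ d30)/nbhsRP[a2 a20 l2] := cs u0.
    have su := s_gt0 u0 u01.
    have d40 : 0 < Num.min d1 d2 / 3 / s u0 by rewrite divr_gt0.
    have /contC/(_ _ d40)/nbhsRP[a3 a30 l3] := @expi_cont t0.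
    exists (Num.min a1 (Num.min a2 a3)); first by rewrite !lt_min a10 a20.
    move=> u t hu ht; rewrite !lt_min => /and3P[/l1 b1 /l2 b2 _] /and3P[_ _ /l3 b3].
    have m1 : Num.min d1 d2 <= d1 by rewrite ge_min lexx.
    have m2 : Num.min d1 d2 <= d2 by rewrite ge_min lexx orbT.
    have c2 : nm (f (zz u) - f (zz u0)) < ep / 2 by apply: k2; lra.
    have c1 : nm (f (zz u + (s u)%:C * expi t) - f (zz u0 + (s u0)%:C * expi t0)) < ep / 2.
      apply: k1; rewrite (_ : _ - _ = (zz u - zz u0) + ((s u - s u0)%:C * expi t)
          + (s u0)%:C * (expi t - expi t0)); last by rewrite rmorphB; ring.
      have n1 := nmD (zz u - zz u0 + (s u - s u0)%:C * expi t) ((s u0)%:C * (expi t - expi t0)).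
      have n2 := nmD (zz u - zz u0) ((s u - s u0)%:C * expi t).
      rewrite (nmM _ (expi t)) nm_expi mulr1 nmR in n2.
      rewrite (nmM (s u0)%:C) nmR (gtr0_norm su) in n1.
      move: b3; rewrite ltr_pdivlMr // mulrC; lra.
    move: c1 c2; set A := f (zz u + _); set B := f (zz u0 + _); set C1 := f (zz u); set C2 := f (zz u0).
    move=> c1 c2; rewrite (_ : _ - _ = (A - B) - (C1 - C2)); last ring.
    have := nmB (A - B) (C1 - C2); lra.
  - move=> u t hu ht; rewrite subr_eq0; apply/eqP => /(inj _ _ (din u t hu) (din0 u hu)).
    move=> /(congr1 (fun x => x - zz u)); rewrite addrC addKr subrr => /eqP.
    by rewrite mulf_eq0 (negbTE (expi_neq0 t)) orbF -nm_eq0 nmR normr_eq0 gt_eqF // s_gt0.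
  - move=> u t hu; apply: contB; last exact: cont_cst.
    apply: (@cont_comp _ _ _ (fun t => zz u + (s u)%:C * expi t) f); last exact: cf (din u t hu).
    apply: contD; first exact: cont_cst.
    by apply: contM; [exact: cont_cst|exact: expi_cont].
  - by move=> u hu; rewrite expi0 expi2pi.
have W2 : wind1 (fun t => f (z1 + r%:C * expi t) - f z1).
  have := key (fun u => (r - r1) * u + r1) (fun=> z1).
  rewrite mulr0 add0r mulr1 subrK; apply=> //.
  - move=> u /andP[u0 u1]; have : 0 <= (r - r1) * u by rewrite mulr_ge0 ?subr_ge0.
    by lra.
  - move=> u /andP[u0 u1]; rewrite z1e.
    have : (r - r1) * u <= r - r1 by rewrite ler_piMr // subr_ge0.
    lra.
  - by move=> u; exact: cont_affine.
  - by move=> u; exact: cont_cst.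
have := key (fun=> r) (fun u => z1 + u%:C * (z0 - z1)).
rewrite mul0r addr0 mul1r [z1 + _]addrC subrK; apply=> // u.
- move=> /andP[u0 u1]; rewrite (_ : _ - z0 = (1 - u)%:C * (z1 - z0)); last first.
    by rewrite rmorphB /=; ring.
  rewrite nmM nmR z1e ger0_norm ?subr_ge0 //.
  have : (1 - u) * ((e - r) / 2) <= (e - r) / 2 by apply: ler_piMl; lra.
  lra.
- exact: cst_continuous.
- exact: cd_cont (cd_line z1 (z0 - z1) u).
Qed.

End Winding.

(** * Local systems and characters of H_1 *)

Section Transport.
Context {R : realType} {M : topologicalType}.
Local Notation C := R[i].
Implicit Types (S : set M) (th : M -> M -> C) (ga p : R -> M) (f : R -> C) (a b t : R)
  (al be : C) (x y : M).

(* [th x y] compares a germ chosen at [x], continued to a neighbouring [y],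
   with the germ chosen at [y]. *)
Definition local_system S th := forall x, S x -> \forall y \near x,
  th x y != 0 /\ \forall z \near y, th x z = th x y * th y z.

Definition parallel th ga a b f := forall t0, a <= t0 <= b ->
  exists2 d : R, 0 < d & forall t, a <= t <= b -> `|t - t0| < d ->
    f t = f t0 * th (ga t0) (ga t).

(* Parallel transport along [ga] takes [al] at time [a] to [be] at time [b]. *)
Definition PT th ga a b al be := exists f, [/\ parallel th ga a b f, f a = al & f b = be].

Lemma clamp_le0 t : t <= 0 -> clamp t = 0.
Proof.
move=> t0; rewrite /clamp max_l // ge_min; apply/orP; left; exact: t0.
Qed.

Lemma clamp_ge1 t : 1 <= t -> clamp t = 1.
Proof. by move=> t1; rewrite /clamp (min_r t1) max_r. Qed.

Lemma near_path (ga : R -> M) (t : R) (P : M -> Prop) : continuous ga ->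
  (\forall y \near ga t, P y) ->
  exists2 d : R, 0 < d & forall s : R, `|s - t| < d -> P (ga s).
Proof. by move=> c h; apply/nbhsRP; exact: cont_near (c t) h. Qed.

Lemma lsys_refl S th x : local_system S th -> S x -> th x x = 1.
Proof.
move=> L /L/nbhs_singleton[n0 /nbhs_singleton] h.
by apply: (mulfI n0); rewrite -h mulr1.
Qed.

Lemma parallel_sub th ga a b a' b' f : a <= a' -> b' <= b -> parallel th ga a b f ->
  parallel th ga a' b' f.
Proof.
move=> aa bb H t0 /andP[h1 h2]; have [|d d0 K] := H t0.
  by rewrite (le_trans aa h1) (le_trans h2 bb).
exists d => // t /andP[k1 k2]; apply: K.
by rewrite (le_trans aa k1) (le_trans k2 bb).
Qed.

Lemma parallel_affine th ga a b c d a' b' f : parallel th ga a b f ->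
  (forall t, a' <= t <= b' -> a <= c * t + d <= b) ->
  parallel th (fun t => ga (c * t + d)) a' b' (fun t => f (c * t + d)).
Proof.
move=> H K t0 t01; have [e e0 h] := H _ (K t0 t01).
exists (e / (`|c| + 1)); first by rewrite divr_gt0 // ltr_wpDl.
move=> t t1 tt; apply: h; first exact: K.
rewrite (_ : _ - _ = c * (t - t0)); last by ring.
rewrite normrM; apply: le_lt_trans (_ : `|c| * `|t - t0| <= (`|c| + 1) * `|t - t0|) _.
  by rewrite ler_wpM2r // lerDl.
by rewrite mulrC -ltr_pdivlMr // ltr_wpDl.
Qed.

Lemma parallel_eq th ga ga' a b f f' : (forall t, a <= t <= b -> ga t = ga' t) ->
  (forall t, a <= t <= b -> f t = f' t) ->
  parallel th ga a b f -> parallel th ga' a b f'.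
Proof.
move=> E E' H t0 t01; have [d d0 h] := H t0 t01; exists d => // t t1 tt.
by rewrite -!E // -!E' //; exact: h.
Qed.

Lemma PT_eq th ga ga' a b al be : (forall t, a <= t <= b -> ga t = ga' t) ->
  PT th ga a b al be -> PT th ga' a b al be.
Proof.
move=> E [f [h1 h2 h3]]; exists f; split=> //; exact: parallel_eq h1.
Qed.

Lemma PT_scale th ga a b c al be : PT th ga a b al be -> PT th ga a b (c * al) (c * be).
Proof.
move=> [f [h <- <-]]; exists (fun t => c * f t); split=> // t0 /h[d d0 k].
by exists d => // t /k{}k /k ->; rewrite mulrA.
Qed.

Lemma PT_exp th ga a b al be n : PT th ga a b al be ->
  PT (fun x y => th x y ^+ n) ga a b (al ^+ n) (be ^+ n).
Proof.
move=> [f [h <- <-]]; exists (fun t => f t ^+ n); split=> // t0 /h[d d0 k].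
by exists d => // t /k{}k /k ->; rewrite exprMn.
Qed.

Lemma PT_trans th ga a b c al be ka : a <= b -> b <= c ->
  PT th ga a b al be -> PT th ga b c be ka -> PT th ga a c al ka.
Proof.
move=> ab bc [f [h fa fb]] [g [k gb gc]].
exists (fun t => if t <= b then f t else g t); split.
- move=> t0 /andP[t1 t2].
  have [tb|tb|tb] := ltgtP t0 b.
  + have [|d d0 H] := h t0; first by rewrite t1 ltW.
    exists (Num.min d (b - t0)); first by rewrite lt_min d0 subr_gt0.
    move=> t /andP[s1 s2]; rewrite lt_min => /andP[td tb'].
    have tb2 : t <= b by move: tb'; rewrite ltr_norml; lra.
    by rewrite tb2; apply: H => //; rewrite s1.
  + have [|d d0 H] := k t0; first by rewrite t2 ltW.
    exists (Num.min d (t0 - b)); first by rewrite lt_min d0 subr_gt0.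
    move=> t /andP[s1 s2]; rewrite lt_min => /andP[td tb'].
    have tb2 : b < t by move: tb'; rewrite ltr_norml; lra.
    by rewrite leNgt tb2 /=; apply: H => //; rewrite s2 ltW.
  + have [|d d0 H] := h b; first by rewrite ab lexx.
    have [|e e0 K] := k b; first by rewrite bc lexx.
    rewrite {}tb; exists (Num.min d e); first by rewrite lt_min d0.
    move=> t /andP[s1 s2]; rewrite lt_min => /andP[td te].
    case: (leP t b) => tb2; first by apply: H => //; rewrite s1.
    by rewrite fb -gb; apply: K => //; rewrite s2 ltW.
- by rewrite ab.
- case: (leP c b) => cb //; have cE : c = b by apply/eqP; rewrite eq_le cb.
  by rewrite cE fb -gb -cE.
Qed.

Lemma PT_refl S th ga a al : local_system S th -> S (ga a) -> PT th ga a a al al.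
Proof.
move=> L Sa; exists (fun=> al); split=> // t0 /andP[t1 t2]; exists 1 => // t /andP[t3 t4] _.
have -> : t0 = a by apply/eqP; rewrite eq_le t1 t2.
have -> : t = a by apply/eqP; rewrite eq_le t3 t4.
by rewrite (lsys_refl L Sa) mulr1.
Qed.

(** Near t0 the function t |-> th (ga t0) (ga t) is itself a nonvanishing solution of the transport
    equation. Interval induction derives existence and uniqueness from these local solutions. *)
Lemma parallel_germ S th ga t0 : local_system S th -> continuous ga -> S (ga t0) ->
  exists2 d : R, 0 < d & (forall t, `|t - t0| < d -> th (ga t0) (ga t) != 0) /\
   forall a b, `|a - t0| < d -> `|b - t0| < d ->
    parallel th ga a b (fun t => th (ga t0) (ga t)).
Proof.
move=> L c S0; have [d d0 H] := near_path c (L _ S0).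
exists d => //; split=> [t /H[]//|a b ad bd s0 /andP[s1 s2]].
have sd : `|s0 - t0| < d by move: ad bd; rewrite !ltr_norml; lra.
have [n0 /(near_path c)[e e0 K]] := H _ sd.
by exists e => // t _ /K.
Qed.

Lemma PT_exists S th ga a b al : local_system S th -> continuous ga -> a <= b ->
  (forall t, a <= t <= b -> S (ga t)) -> exists be, PT th ga a b al be.
Proof.
move=> L c ab SS; move: al.
apply: (@itv_ind _ (fun s s' => forall al, exists be, PT th ga s s' al be) a b ab).
  move=> x y z _ xy yz _ h1 h2 al; have [be k1] := h1 al; have [ka k2] := h2 be.
  by exists ka; exact: PT_trans xy yz k1 k2.
move=> t tab; have [d d0 [n0 H]] := parallel_germ L c (SS t tab).
exists d => // x y ax xy yb xd yd al.
have := PT_scale (al / th (ga t) (ga x)) (ex_intro _ _ (And3 (H x y xd yd) erefl erefl)).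
by rewrite divfK ?n0 // => h; eexists; exact: h.
Qed.

(** Locally f and g are multiples of one and the same nonvanishing function, so the relation f = k g
    propagates. *)
Lemma parallel_ratio S th ga a b f g (k : C) : local_system S th -> continuous ga -> a <= b ->
  (forall t, a <= t <= b -> S (ga t)) ->
  parallel th ga a b f -> parallel th ga a b g -> f a = k * g a -> f b = k * g b.
Proof.
move=> L c ab SS hf hg; apply: (@itv_ind _ (fun s s' => f s = k * g s -> f s' = k * g s') a b ab).
  by move=> x y z _ _ _ _ h1 h2 /h1/h2.
move=> t tab; have [d d0 [n0 _]] := parallel_germ L c (SS t tab).
have [d1 d10 h1] := hf t tab; have [d2 d20 h2] := hg t tab.
exists (Num.min d (Num.min d1 d2)); first by rewrite !lt_min d0 d10.
move=> x y ax xy yb; rewrite !lt_min => /and3P[xd xd1 xd2] /and3P[yd yd1 yd2] E.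
have xab : a <= x <= b by rewrite ax (le_trans xy yb).
have yab : a <= y <= b by rewrite yb (le_trans ax xy).
have Et : f t = k * g t.
  by apply: (mulIf (n0 x xd)); rewrite -mulrA -h1 // -h2.
by rewrite (h1 y) // (h2 y) // Et mulrA.
Qed.

Lemma PT_ratio S th ga a b al be al' be' k : local_system S th -> continuous ga -> a <= b ->
  (forall t, a <= t <= b -> S (ga t)) ->
  PT th ga a b al be -> PT th ga a b al' be' -> al = k * al' -> be = k * be'.
Proof.
move=> L c ab SS [f [hf <- <-]] [g [hg <- <-]]; exact: (parallel_ratio L c ab SS hf hg).
Qed.

Lemma PT_unique S th ga a b al be be' : local_system S th -> continuous ga -> a <= b ->
  (forall t, a <= t <= b -> S (ga t)) ->
  PT th ga a b al be -> PT th ga a b al be' -> be = be'.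
Proof.
move=> L c ab SS h h'; have := PT_ratio L c ab SS h h'.
by move=> /(_ 1); rewrite !mul1r; apply.
Qed.

Lemma PT_neq0 S th ga a b al be : local_system S th -> continuous ga -> a <= b ->
  (forall t, a <= t <= b -> S (ga t)) -> PT th ga a b al be -> al != 0 -> be != 0.
Proof.
move=> L c ab SS [f [hf <- <-]].
apply: (@itv_ind _ (fun s s' => f s != 0 -> f s' != 0) a b ab).
  by move=> x y z _ _ _ _ h1 h2 /h1/h2.
move=> t tab; have [d d0 [n0 _]] := parallel_germ L c (SS t tab).
have [d1 d10 h1] := hf t tab.
exists (Num.min d d1); first by rewrite lt_min d0.
move=> x y ax xy yb; rewrite !lt_min => /andP[xd xd1] /andP[yd yd1].
have xab : a <= x <= b by rewrite ax (le_trans xy yb).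
have yab : a <= y <= b by rewrite yb (le_trans ax xy).
rewrite (h1 x) // (h1 y) // !mulf_eq0 !negb_or => /andP[-> _] /=; exact: n0.
Qed.

Definition trans th p : C := xget 1 [set be | PT th p 0 1 1 be].

Lemma simplex1_S S p t : simplex1 S p -> S (p t).
Proof. by move=> [_ _]; apply; exists t. Qed.

Lemma simplex1_cont S p : simplex1 S p -> continuous p.
Proof. by case. Qed.

Lemma transP S th p : local_system S th -> simplex1 S p -> PT th p 0 1 1 (trans th p).
Proof.
move=> L sp; apply: xgetPex.
by apply: (PT_exists 1 L (simplex1_cont sp) ler01) => t _; exact: simplex1_S sp.
Qed.

Lemma trans_eq S th p al be : local_system S th -> simplex1 S p -> PT th p 0 1 al be ->
  be = al * trans th p.
Proof.
move=> L sp h; apply: (PT_ratio L (simplex1_cont sp) ler01 _ h (transP L sp)).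
  by move=> t _; exact: simplex1_S sp.
by rewrite mulr1.
Qed.

Lemma trans_neq0 S th p : local_system S th -> simplex1 S p -> trans th p != 0.
Proof.
move=> L sp; apply: (PT_neq0 L (simplex1_cont sp) ler01 _ (transP L sp)).
  by move=> t _; exact: simplex1_S sp.
exact: oner_neq0.
Qed.

Lemma trans_exp S th p n : local_system S th ->
  (forall x, S x -> \forall y \near x, th x y ^+ n = 1) ->
  simplex1 S p -> trans th p ^+ n = 1.
Proof.
move=> L h1 sp; have [f [hf f0 <-]] := transP L sp.
suff : f 0 ^+ n = 1 -> f 1 ^+ n = 1 by rewrite f0 expr1n; exact.
apply: (@itv_ind _ (fun s s' => f s ^+ n = 1 -> f s' ^+ n = 1) 0 1 ler01).
  by move=> x y z _ _ _ _ k1 k2 /k1/k2.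
move=> t tab; have [d d0 K] := near_path (simplex1_cont sp) (h1 _ (simplex1_S t sp)).
have [d1 d10 H] := hf t tab.
exists (Num.min d d1); first by rewrite lt_min d0.
move=> x y ax xy yb; rewrite !lt_min => /andP[xd xd1] /andP[yd yd1].
have xab : 0 <= x <= 1 by rewrite ax (le_trans xy yb).
have yab : 0 <= y <= 1 by rewrite yb (le_trans ax xy).
by rewrite (H x) // (H y) // !exprMn !K.
Qed.

(* Some path in [S] from [x] to [y] has parallel transport [be]. *)
Definition conn S th x y be := exists p, [/\ simplex1 S p, p 0 = x, p 1 = y & PT th p 0 1 1 be].

Lemma conn_refl S th x : local_system S th -> S x -> conn S th x x 1.
Proof.
move=> L Sx; exists (fun=> x); split=> //.
  by split=> // [t|y [t _ <-] //]; exact: cst_continuous.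
exists (fun=> 1); split=> // t0 _; exists 1 => // t _ _.
by rewrite (lsys_refl L Sx) mulr1.
Qed.

Lemma conn_sym S th x y be : local_system S th -> conn S th x y be -> conn S th y x be^-1.
Proof.
move=> L [p [sp p0 p1 hp]].
have be0 : be != 0.
  apply: (PT_neq0 L (simplex1_cont sp) ler01 _ hp); last exact: oner_neq0.
  by move=> t _; exact: simplex1_S sp.
exists (fun t => p (-1 * t + 1)); split.
- split.
  + by move=> t; apply: (@cont_comp _ _ _ (fun t : R => -1 * t + 1) p);
      [exact: cont_affine|exact: simplex1_cont sp _].
  + move=> t; case: sp => _ e _; rewrite e [RHS]e; congr p.
    have [t0|t0] := leP t 0.
      by rewrite (clamp_le0 t0) mulr0 add0r !clamp_ge1 ?lexx //; lra.
    have [t1|t1] := leP 1 t; last by rewrite (@clamp_id _ t) // !ltW.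
    by rewrite (clamp_ge1 t1) mulr1 addNr !clamp_le0 ?lexx //; lra.
  + by move=> z [t _ <-]; exact: simplex1_S sp.
- by rewrite mulr0 add0r.
- by rewrite mulr1 addNr.
case: hp => f [hf f0 f1].
have rg t : 0 <= t <= 1 -> 0 <= -1 * t + 1 <= 1 by lra.
have h : PT th (fun t => p (-1 * t + 1)) 0 1 be 1.
  exists (fun t => f (-1 * t + 1)); split; first exact: parallel_affine hf rg.
    by rewrite mulr0 add0r.
  by rewrite mulr1 addNr.
by have := PT_scale (be^-1) h; rewrite mulVf // mulr1.
Qed.

Definition join_path p q t := if t <= 1 / 2 then p (2 * t + 0) else q (2 * t + -1).

Lemma join_path_simplex S p q : simplex1 S p -> simplex1 S q -> p 1 = q 0 ->
  simplex1 S (join_path p q).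
Proof.
move=> sp sq pq; have cp := simplex1_cont sp; have cq := simplex1_cont sq; split.
- move=> t.
  have c1 : {for t, continuous (fun t : R => p (2 * t + 0))}.
    by apply: (@cont_comp _ _ _ (fun t : R => 2 * t + 0) p); [exact: cont_affine|exact: cp].
  have c2 : {for t, continuous (fun t : R => q (2 * t + -1))}.
    by apply: (@cont_comp _ _ _ (fun t : R => 2 * t + -1) q); [exact: cont_affine|exact: cq].
  have [t2|t2|t2] := ltgtP t (1 / 2).
  + apply: near_continuous c1; apply/nbhsRP; exists (1 / 2 - t); first lra.
    move=> s; rewrite ltr_norml /join_path => /andP[s1 s2].
    by have -> : s <= 1 / 2 by lra.
  + apply: near_continuous c2; apply/nbhsRP; exists (t - 1 / 2); first lra.
    move=> s; rewrite ltr_norml /join_path => /andP[s1 s2].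
    by rewrite leNgt (_ : 1 / 2 < s); last lra.
  + have E1 : join_path p q t = p (2 * t + 0) by rewrite /join_path t2 lexx.
    have E2 : join_path p q t = q (2 * t + -1).
      by rewrite E1 t2 (_ : 2 * (1 / 2) + 0 = 1 :> R) ?pq; [congr q; lra|lra].
    move=> A; rewrite /= => hA.
    have /nbhsRP[d1 d10 h1] : nbhs t (fun s => A (p (2 * s + 0))) by apply: c1; rewrite -E1.
    have /nbhsRP[d2 d20 h2] : nbhs t (fun s => A (q (2 * s + -1))) by apply: c2; rewrite -E2.
    suff : nbhs t (fun s => A (join_path p q s)) by [].
    apply/nbhsRP; exists (Num.min d1 d2); first by rewrite lt_min d10.
    move=> s; rewrite lt_min => /andP[/h1 k1 /h2 k2].
    by rewrite /join_path; case: ifP.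
- move=> t; have [_ ep _] := sp; have [_ eq _] := sq; rewrite /join_path.
  have [t2|t2] := leP t (1 / 2).
    have -> : clamp t <= 1 / 2.
      by rewrite /clamp ge_max; apply/andP; split; [lra|rewrite ge_min t2].
    rewrite ep [RHS]ep; congr p; have [t0|t0] := leP t 0.
      by rewrite (clamp_le0 t0) mulr0 add0r !clamp_le0 ?lexx //; lra.
    by rewrite (@clamp_id _ t) //; lra.
  have -> : (clamp t <= 1 / 2) = false.
    by apply/negbTE; rewrite -ltNge /clamp lt_max lt_min t2 orbC /=; apply/orP; left; lra.
  rewrite eq [RHS]eq; congr q; have [t1|t1] := leP 1 t.
    by rewrite (clamp_ge1 t1) mulr1 !clamp_ge1 //; lra.
  by rewrite (@clamp_id _ t) //; lra.
- by move=> z [t _ <-]; rewrite /join_path; case: ifP => _; [exact: simplex1_S sp|exact: simplex1_S sq].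
Qed.

Lemma conn_trans S th x y z be ka : local_system S th -> conn S th x y be ->
  conn S th y z ka -> conn S th x z (be * ka).
Proof.
move=> L [p [sp p0 p1 hp]] [q [sq q0 q1 hq]].
have pq : p 1 = q 0 by rewrite p1 q0.
have h12 : 1 / 2 <= 1 :> R by lra.
exists (join_path p q); split; first exact: join_path_simplex.
- by rewrite /join_path (_ : 0 <= 1 / 2); [rewrite mulr0 addr0|lra].
- by rewrite /join_path (_ : (1 <= 1 / 2) = false); [rewrite -q1; congr q; lra|lra].
have {}hq := PT_scale be hq; rewrite mulr1 in hq.
case: hp => f [hf f0 f1]; case: hq => g [hg g0 g1].
apply: (@PT_trans th _ 0 (1 / 2) 1 1 be); [lra|lra| |].
- apply: (@PT_eq th (fun t => p (2 * t + 0))).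
    by move=> t /andP[t0 t1]; rewrite /join_path t1.
  exists (fun t => f (2 * t + 0)); split.
  + by apply: parallel_affine hf _ => t; lra.
  + by rewrite mulr0 addr0.
  + by rewrite -f1; congr f; lra.
- apply: (@PT_eq th (fun t => q (2 * t + -1))).
    move=> t /andP[t0 t1]; rewrite /join_path; case: ifP => // t2.
    have -> : t = 1 / 2 by lra.
    by rewrite (_ : 2 * (1 / 2) + 0 = 1 :> R) ?pq; [congr q; lra|lra].
  exists (fun t => g (2 * t + -1)); split.
  + by apply: parallel_affine hg _ => t; lra.
  + by rewrite -g0; congr g; lra.
  + by rewrite -g1; congr g; lra.
Qed.

Lemma conn_loop S th x be : local_system S th -> conn S th x x be ->
  exists ga, loop S ga /\ PT th ga 0 1 1 be.
Proof. by move=> L [p [sp p0 p1 hp]]; exists p; split=> //; split=> //; rewrite p0 p1. Qed.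

(** Trivial holonomy makes the transport from a base point to x independent of the path, and A x is
    this transport. As S may be disconnected, each path class needs its own base point. *)
Lemma global_section S th : local_system S th ->
  (forall x, S x -> \forall y \near x, conn S th x y (th x y)) ->
  (forall ga be, loop S ga -> PT th ga 0 1 1 be -> be = 1) ->
  exists A : M -> C, forall x, S x -> A x != 0 /\ \forall y \near x, A y = A x * th x y.
Proof.
move=> L lc triv.
have cS x y be : conn S th x y be -> S x /\ S y.
  by move=> [p [sp <- <- _]]; split; exact: simplex1_S sp.
have cn x y be : conn S th x y be -> be != 0.
  move=> [p [sp _ _ h]]; apply: (PT_neq0 L (simplex1_cont sp) ler01 _ h); last exact: oner_neq0.
  by move=> t _; exact: simplex1_S sp.
(* [cl x] is the path class of x and [B x] its base point, which must depend on the class only. *)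
pose cl x := [set y | exists be, conn S th y x be].
pose B x := xget x (cl x).
have Bx x : S x -> exists be, conn S th (B x) x be.
  by move=> Sx; apply: (@xgetPex _ x (cl x)); exists x; exists 1; exact: conn_refl.
have clE x y be : conn S th x y be -> cl x = cl y.
  move=> h; apply/seteqP; split=> z [k hk]; eexists; first exact: conn_trans hk h.
  by exact: (conn_trans L hk (conn_sym L h)).
have BE x y be : conn S th x y be -> B x = B y.
  move=> h; rewrite /B -(clE _ _ _ h); have [Sx _] := cS _ _ _ h.
  have ne : exists z, cl x z by exists x; exists 1; exact: conn_refl.
  (* The default argument of [xget] has no effect on a nonempty set, although [B] passes a different
     one at each point. *)
  have : forall u v : M, xget u (cl x) = xget v (cl x).
    move=> u v; rewrite /xget; case: pselect => // -[].
    by have [z hz] := ne; exists z; apply/asboolP.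
  exact.
pose A x := xget 1 [set be | conn S th (B x) x be].
have Ax x : S x -> conn S th (B x) x (A x).
  by move=> Sx; apply: (@xgetPex _ 1 [set be | conn S th (B x) x be]); exact: Bx.
exists A => x Sx; split; first exact: cn (Ax x Sx).
apply: filterS (lc x Sx) => y h; have [_ Sy] := cS _ _ _ h.
have h1 := conn_trans L (Ax x Sx) h; rewrite (BE _ _ _ h) in h1.
have h2 := conn_trans L h1 (conn_sym L (Ax y Sy)).
have [ga [lga hga]] := conn_loop L h2.
have := triv _ _ lga hga => e; apply: (mulIf (invr_neq0 (cn _ _ _ (Ax y Sy)))).
by rewrite e mulfV // (cn _ _ _ (Ax y Sy)).
Qed.

End Transport.

Section Subdivision.
Context {R : realType}.

(** Subdivisions of two adjacent intervals concatenate, so interval induction applies to the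
    existence of a subdivision. *)
Lemma subdivide (P : R -> R -> Prop) :
  (forall t, 0 <= t <= 1 -> exists2 d : R, 0 < d & forall x y, 0 <= x -> x <= y -> y <= 1 ->
     `|x - t| < d -> `|y - t| < d -> P x y) ->
  exists N (t : nat -> R), subdivision N t /\ forall j, (j <= N)%N -> P (t j) (t j.+1).
Proof.
move=> loc.
suff [N [t [t0 t1 tm tP]]] : exists N (t : nat -> R), [/\ t 0%N = 0, t N.+1 = 1,
    forall j, (j <= N)%N -> t j <= t j.+1 & forall j, (j <= N)%N -> P (t j) (t j.+1)].
  by exists N, t; split.
apply: (@itv_ind _ (fun a b => exists N (t : nat -> R), [/\ t 0%N = a, t N.+1 = b,
    forall j, (j <= N)%N -> t j <= t j.+1 & forall j, (j <= N)%N -> P (t j) (t j.+1)])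
    0 1 ler01).
  move=> x y z _ _ _ _ [N [t [t0 t1 tm tP]]] [N' [t' [t0' t1' tm' tP']]].
  pose u j := if (j <= N)%N then t j else t' (j - N.+1)%N.
  have uE j : (j <= N.+1)%N -> u j = t j.
    rewrite leq_eqVlt => /orP[/eqP ->|]; last by rewrite /u ltnS => ->.
    by rewrite /u ltnn subnn t0' t1.
  have uE' j : (N < j)%N -> u j = t' (j - N.+1)%N by rewrite /u ltnNge => /negbTE ->.
  have step j : (j <= N + N'.+1)%N -> (u j = t j /\ u j.+1 = t j.+1 /\ (j <= N)%N) \/
      (u j = t' (j - N.+1)%N /\ u j.+1 = t' (j - N.+1).+1 /\ (j - N.+1 <= N')%N).
    move=> jN; have [jl|jl] := leqP j N; [left|right].
      by rewrite !uE // ltnW.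
    rewrite (uE' j jl) (uE' j.+1 (ltnW jl)) (subSn jl); split=> //; split=> //.
    by rewrite leq_subLR addSnnS.
  exists (N + N'.+1)%N, u; split.
  - by rewrite uE.
  - by rewrite uE' ?ltnS ?leq_addr // subSS addKn.
  - by move=> j /step[[-> [-> /tm]]|[-> [-> /tm']]].
  - by move=> j /step[[-> [-> /tP]]|[-> [-> /tP']]].
move=> s /loc[d d0 H]; exists d => // x y x0 xy y1 xd yd.
exists 0%N, (fun j => if j == 0%N then x else y); split=> //= j; rewrite leqn0 => /eqP -> //=.
exact: H.
Qed.

End Subdivision.

(** * Flat sections over a singular triangle *)

Section Triangle.
Context {R : realType} {M : topologicalType}.
Local Notation C := R[i].
Implicit Types (S : set M) (th : M -> M -> C) (sigma : R * R -> M) (x y : R * R) (t s : R).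

Definition tri2 : set (R * R) := [set x | [/\ 0 <= x.1, 0 <= x.2 & x.1 + x.2 <= 1]].

Definition scal t x : R * R := (t * x.1, t * x.2).

Definition close (d : R) x y := `|x.1 - y.1| < d /\ `|x.2 - y.2| < d.

Lemma scal_tri t x : 0 <= t <= 1 -> tri2 x -> tri2 (scal t x).
Proof.
move=> /andP[t0 t1] [x1 x2 x12]; split; rewrite /= ?mulr_ge0 //.
by rewrite -mulrDr; apply: mulr_ile1 => //; apply: addr_ge0.
Qed.

Lemma within_close sigma x (P : M -> Prop) : {within tri2, continuous sigma} -> tri2 x ->
  (\forall z \near sigma x, P z) ->
  exists2 d : R, 0 < d & forall y, tri2 y -> close d y x -> P (sigma y).
Proof.
move=> /subspace_continuousP c Dx hP; have := c x Dx _ hP.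
rewrite /= /within /=; case=> -[A B] /= [/nbhsRP[a a0 hA] /nbhsRP[b b0 hB]] sub.
exists (Num.min a b); first by rewrite lt_min a0.
move=> y Dy [y1 y2]; apply: (sub y) => //; split=> /=.
  by apply: hA; apply: lt_le_trans y1 _; rewrite ge_min lexx.
by apply: hB; apply: lt_le_trans y2 _; rewrite ge_min lexx orbT.
Qed.

Definition ray sigma x t := sigma (scal (clamp t) x).

Lemma ray_simplex S sigma x : simplex2 S sigma -> tri2 x -> simplex1 S (ray sigma x).
Proof.
move=> [c sS] Dx; have Dr t : tri2 (scal (clamp t) x) by exact: scal_tri (clamp_itv t) Dx.
split.
- move=> t A /=; rewrite /ray => hA.
  have [d d0 H] := within_close c (Dr t) hA.
  have k (u : R) : {for t, continuous (fun s : R => clamp s * u)}.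
    by apply: cvgM; [exact: clamp_continuous|exact: cvg_cst].
  suff : nbhs t (fun s => A (sigma (scal (clamp s) x))) by [].
  have /contR/(_ _ d0) k1 := k x.1; have /contR/(_ _ d0) k2 := k x.2.
  by apply: filterS2 k1 k2 => s s1 s2; apply: H (Dr s) (conj s1 s2).
- by move=> t; rewrite /ray (clamp_id (clamp_itv t)).
- by move=> z [t _ <-]; apply: sS; exists (scal (clamp t) x); first exact: Dr.
Qed.

Lemma scal_close t x y d : 0 <= t <= 1 -> close d x y -> close d (scal t x) (scal t y).
Proof.
move=> /andP[t0 t1] [h1 h2]; have k (a b : R) : `|a - b| < d -> `|t * a - t * b| < d.
  move=> h; rewrite -mulrBr normrM ger0_norm //; apply: le_lt_trans h.
  by rewrite ler_piMl.
by split; apply: k.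
Qed.

(* Parallel transport along the rays from the vertex (0, 0). *)
Lemma triangle_parallel S th sigma : local_system S th -> simplex2 S sigma ->
  exists F : R * R -> C, forall x, tri2 x -> F x != 0 /\
    exists2 d : R, 0 < d & forall y, tri2 y -> close d y x ->
      F y = F x * th (sigma x) (sigma y).
Proof.
move=> L ss; have [c sS] := ss.
have SD x : tri2 x -> S (sigma x) by move=> Dx; apply: sS; exists x.
pose F x := trans th (ray sigma x); exists F => x0 D0.
have rS x : tri2 x -> simplex1 S (ray sigma x) by exact: ray_simplex ss.
split; first exact: trans_neq0 L (rS _ D0).
(* The ray to s x is a reparametrised initial piece of the ray to x; hence F is parallel along each
   ray. *)
have Fray x : tri2 x -> exists f : R -> C, [/\ parallel th (ray sigma x) 0 1 f &
    forall s, 0 <= s <= 1 -> f s = F (scal s x)].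
  move=> Dx; have [f [hf f0 f1]] := transP L (rS x Dx).
  exists f; split=> // s s01.
  have : PT th (ray sigma (scal s x)) 0 1 1 (f s).
    apply: (@PT_eq _ _ th (fun t => ray sigma x (s * t + 0))).
      move=> t t01; rewrite /ray addr0 (@clamp_id _ t) // (@clamp_id _ (s * t)).
        by rewrite /scal /= !mulrA [s * t]mulrC.
      by move: s01 t01 => /andP[s0 s1] /andP[t0 t1]; rewrite mulr_ge0 // mulr_ile1.
    exists (fun t => f (s * t + 0)); split.
    - apply: parallel_affine hf _ => t /andP[t0 t1]; move: s01 => /andP[s0 s1].
      by rewrite addr0 mulr_ge0 // mulr_ile1.
    - by rewrite mulr0 addr0.
    - by rewrite mulr1 addr0.
  by move=> /(trans_eq L (rS _ (scal_tri s01 Dx))); rewrite mul1r.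
pose Par x := exists2 d : R, 0 < d & forall y, tri2 y -> close d y x ->
      F y = F x * th (sigma x) (sigma y).
have s1 : scal 1 x0 = x0 by rewrite /scal !mul1r; case: (x0).
suff : Par (scal 1 x0) by rewrite s1.
have Z : scal 0 x0 = (0, 0) by rewrite /scal !mul0r.
have D00 : tri2 (0, 0) by split; rewrite /= ?addr0.
have germ x : tri2 x -> exists2 d : R, 0 < d & forall y, tri2 y -> close d y x ->
    th (sigma x) (sigma y) != 0 /\ exists2 e : R, 0 < e & forall z, tri2 z -> close e z y ->
      th (sigma x) (sigma z) = th (sigma x) (sigma y) * th (sigma y) (sigma z).
  move=> Dx; have [d d0 H] := within_close c Dx (L _ (SD x Dx)).
  exists d => // y Dy /(H y Dy)[n0 k]; split=> //.
  exact: (within_close c Dy k).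
(* Comparison along a ray inside a neighbourhood of [sigma x]. *)
have along x d w la : tri2 x -> tri2 w -> 0 <= la <= 1 ->
    (forall y, tri2 y -> close d y x -> th (sigma x) (sigma y) != 0 /\
      exists2 e : R, 0 < e & forall z, tri2 z -> close e z y ->
      th (sigma x) (sigma z) = th (sigma x) (sigma y) * th (sigma y) (sigma z)) ->
    close d (scal la w) x -> close d w x ->
    F w = F (scal la w) / th (sigma x) (sigma (scal la w)) * th (sigma x) (sigma w).
  move=> Dx Dw la01 g cl cw; have [f [hf fE]] := Fray w Dw.
  have /andP[la0 la1] := la01.
  have w1 : scal 1 w = w by rewrite /scal !mul1r; case: (w).
  have lam t : la <= t <= 1 -> close d (scal t w) x.
    move=> /andP[lt t1]; case: cl => /= c1 c2; case: cw => k1 k2; split => /=.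
      have [w0 _ _] := Dw; have : la * w.1 <= t * w.1 by rewrite ler_wpM2r.
      have : t * w.1 <= w.1 by rewrite ler_piMl.
      by move: c1 k1; rewrite !ltr_norml; lra.
    have [_ w0 _] := Dw; have : la * w.2 <= t * w.2 by rewrite ler_wpM2r.
    have : t * w.2 <= w.2 by rewrite ler_piMl.
    by move: c2 k2; rewrite !ltr_norml; lra.
  have hg : parallel th (ray sigma w) la 1 (fun t => th (sigma x) (ray sigma w t)).
    move=> t t01; have t01' : 0 <= t <= 1 by move: t01 => /andP[? ->]; rewrite (le_trans la0).
    have [_ [e e0 H]] := g _ (scal_tri t01' Dw) (lam t t01).
    exists e => // u u01 ut; have u01' : 0 <= u <= 1 by move: u01 => /andP[? ->]; rewrite (le_trans la0).
    rewrite /ray !clamp_id //; apply: H; first exact: scal_tri.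
    have [w0 w2 w12] := Dw; split => /=; rewrite -mulrBl normrM.
      by rewrite [`|w.1|]ger0_norm //; apply: le_lt_trans ut; apply: ler_piMr => //; lra.
    by rewrite [`|w.2|]ger0_norm //; apply: le_lt_trans ut; apply: ler_piMr => //; lra.
  have := @parallel_ratio _ _ S th (ray sigma w) la 1 f _
    (F (scal la w) / th (sigma x) (sigma (scal la w))) L (simplex1_cont (rS w Dw)) la1
    (fun t _ => simplex1_S t (rS w Dw)) (parallel_sub la0 (lexx _) hf) hg.
  rewrite !fE ?lexx ?ler01 // /ray !clamp_id ?lexx ?ler01 // w1 => -> //.
  by rewrite divfK //; have [] := g _ (scal_tri la01 Dw) cl.
have P0 : Par (scal 0 x0).
  rewrite Z; have [d d0 H] := germ _ D00; exists d => // y Dy yd.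
  have y0 : scal 0 y = (0, 0) by rewrite /scal !mul0r.
  have h00 : close d (scal 0 y) (0, 0) by rewrite y0; split; rewrite /= subrr normr0.
  have := along _ d y 0 D00 Dy _ H h00 yd; rewrite lexx ler01 y0 => -> //.
  by rewrite (lsys_refl L (SD _ D00)) divr1.
suff : Par (scal 0 x0) -> Par (scal 1 x0) by exact.
apply: (@itv_ind _ (fun s s' => Par (scal s x0) -> Par (scal s' x0)) 0 1 ler01).
  by move=> x y z _ _ _ _ h1 h2 /h1/h2.
move=> t t01; have Dt := scal_tri t01 D0; have [d d0 H] := germ _ Dt.
have d20 : 0 < d / 2 by rewrite divr_gt0.
exists (d / 2) => // s s' sge ss' s'1 sd sd' [e e0 K].
(* The ratio la = s / s' used below requires s' > 0. The homothety [la] takes s' x0 to s x0 and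
   points y near s' x0 to points near s x0, where F is known to be parallel; [along] then compares y
   with la y on a common ray. *)
have [s'0|s'0] := leP s' 0.
  have -> : s' = s by apply/eqP; rewrite eq_le ss' (le_trans s'0 sge).
  by exists e.
have s01 : 0 <= s <= 1 by rewrite sge (le_trans ss' s'1).
have s'01 : 0 <= s' <= 1 by rewrite s'1 ltW.
have [x01 x02 x012] := D0.
have cl u : `|u - t| < d / 2 -> close (d / 2) (scal u x0) (scal t x0).
  move=> ut; split => /=; rewrite -mulrBl normrM.
    by rewrite [`|x0.1|]ger0_norm //; apply: le_lt_trans ut; apply: ler_piMr => //; lra.
  by rewrite [`|x0.2|]ger0_norm //; apply: le_lt_trans ut; apply: ler_piMr => //; lra.
have tr x y z : close (d / 2) x y -> close (d / 2) y z -> close d x z.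
  by move=> [h1 h2] [h3 h4]; split; [move: h1 h3|move: h2 h4]; rewrite !ltr_norml; lra.
have w x y : close (d / 2) x y -> close d x y by move=> [h1 h2]; split; lra.
pose la := s / s'.
have la01 : 0 <= la <= 1.
  by apply/andP; split; [apply: divr_ge0 => //; exact: ltW|rewrite ler_pdivrMr // mul1r].
have laS : scal la (scal s' x0) = scal s x0 by rewrite /scal /= /la !mulrA divfK // gt_eqF.
have [n1 [e1 e10 H1]] := H _ (scal_tri s01 D0) (w _ _ (cl s sd)).
have [n2 [e2 e20 H2]] := H _ (scal_tri s'01 D0) (w _ _ (cl s' sd')).
exists (Num.min (d / 2) (Num.min e (Num.min e1 e2))); first by rewrite !lt_min d20 e0 e10.
move=> y Dy [y1 y2].
have clm a : Num.min (d / 2) (Num.min e (Num.min e1 e2)) <= a -> close a y (scal s' x0).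
  by move=> m; split; apply: lt_le_trans m.
have m1 : Num.min (d / 2) (Num.min e (Num.min e1 e2)) <= d / 2 by rewrite ge_min lexx.
have m2 : Num.min (d / 2) (Num.min e (Num.min e1 e2)) <= e by rewrite !ge_min lexx ?orbT.
have m3 : Num.min (d / 2) (Num.min e (Num.min e1 e2)) <= e1 by rewrite !ge_min lexx ?orbT.
have m4 : Num.min (d / 2) (Num.min e (Num.min e1 e2)) <= e2 by rewrite !ge_min lexx ?orbT.
have cly a : Num.min (d / 2) (Num.min e (Num.min e1 e2)) <= a -> close a (scal la y) (scal s x0).
  by move=> m; rewrite -laS; apply: scal_close => //; exact: clm.
have Dly := scal_tri la01 Dy.
rewrite (along _ d y la Dt Dy la01 H (tr _ _ _ (cly _ m1) (cl s sd)) (tr _ _ _ (clm _ m1) (cl s' sd'))).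
have := along _ d (scal s' x0) la Dt (scal_tri s'01 D0) la01 H.
rewrite laS => /(_ (w _ _ (cl s sd)) (w _ _ (cl s' sd'))) ->.
rewrite (K _ Dly (cly _ m2)) (H1 _ Dly (cly _ m3)) (H2 _ Dy (clm _ m4)).
have [n3 _] := H _ Dly (tr _ _ _ (cly _ m1) (cl s sd)).
rewrite (H1 _ Dly (cly _ m3)) mulf_eq0 negb_or in n3; have /andP[_ n4] := n3.
by field; rewrite n1 n4.
Qed.

End Triangle.

(** * The character of H_1 defined by a local system *)

Section Character.
Context {R : realType} {M : topologicalType}.
Local Notation C := R[i].
Implicit Types (S : set M) (th : M -> M -> C) (p : R -> M) (sigma : R * R -> M)
  (c a b : (R -> M) -> int).

(** The transport of an open path depends on the germs chosen at its ends. These being fixed once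
    for all, it is a number, and the product is multiplicative on all chains, cycles or not. *)
Definition char_of th c : C := \big[*%R/1]_(p \in [set: R -> M]) (trans th p ^ c p).

Definition chain1 S c := finite_set [set p | c p != 0] /\ forall p, c p != 0 -> simplex1 S p.

Lemma char_of_fin th c (A : set (R -> M)) : (forall p, ~ A p -> c p = 0) ->
  char_of th c = \big[*%R/1]_(p \in A) (trans th p ^ c p).
Proof.
move=> cA; symmetry; apply: fsbig_widen => // p [_ nA] /=.
by rewrite cA // expr0z.
Qed.

Lemma char_ofD S th a b : local_system S th -> chain1 S a -> chain1 S b ->
  char_of th (a + b) = char_of th a * char_of th b.
Proof.
move=> L [fa sa] [fb sb]; pose A := [set p | a p != 0] `|` [set p | b p != 0].
have fA : finite_set A by rewrite finite_setU.
have nA p : ~ A p -> a p = 0 /\ b p = 0.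
  move=> /not_orP[/negP + /negP]; rewrite !negbK => /eqP -> /eqP ->; by [].
rewrite (@char_of_fin th a A) => [|p /nA[] //].
rewrite (@char_of_fin th b A) => [|p /nA[] //].
rewrite (@char_of_fin th (a + b) A) => [|p /nA[e1 e2]]; last first.
  by have -> : (a + b) p = a p + b p by []; rewrite e1 e2.
rewrite -fsbig_split //; apply: eq_fsbigr => p /set_mem Ap.
have -> : (a + b) p = a p + b p by [].
rewrite expfzDr //.
by apply: trans_neq0 L _; case: Ap => [/sa|/sb].
Qed.

Lemma char_ofN th a : finite_set [set p | a p != 0] -> char_of th (- a) = (char_of th a)^-1.
Proof.
move=> fa; have nA p : ~ [set p | a p != 0] p -> a p = 0.
  by move=> /negP; rewrite negbK => /eqP.
rewrite !(@char_of_fin th _ [set p | a p != 0]) //; last first.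
  by move=> p /nA e; have -> : (- a) p = - a p by []; rewrite e oppr0.
rewrite !fsbig_finite // -prodfV; apply: eq_bigr => p _.
have -> : (- a) p = - a p by [].
by rewrite invr_expz.
Qed.

Lemma single_chain S p : simplex1 S p -> chain1 S (single p).
Proof.
move=> sp; split; last by move=> p'; rewrite /single; have [->|] := eqVneq p' p.
apply: (@sub_finite_set _ _ [set p]); last exact: finite_set1.
by move=> p' /=; rewrite /single; have [->|] := eqVneq p' p.
Qed.

Lemma chainN S a : chain1 S a -> chain1 S (- a).
Proof.
move=> [fa sa]; have E p : (- a) p = - a p by [].
split; last by move=> p; rewrite E oppr_eq0; exact: sa.
by apply: sub_finite_set fa => p /=; rewrite E oppr_eq0.
Qed.

Lemma chainD S a b : chain1 S a -> chain1 S b -> chain1 S (a + b).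
Proof.
move=> [fa sa] [fb sb]; have E p : (a + b) p = a p + b p by [].
have sub p : (a + b) p != 0 -> a p != 0 \/ b p != 0.
  by rewrite E; have [->|] := eqVneq (a p) 0; [rewrite add0r; right|left].
split; last by move=> p /sub[/sa|/sb].
have : finite_set ([set p | a p != 0] `|` [set p | b p != 0]) by rewrite finite_setU.
by apply: sub_finite_set => p /sub.
Qed.

Lemma char_of_single th p : char_of th (single p) = trans th p.
Proof.
rewrite (@char_of_fin th _ [set p]); last first.
  by move=> p' /= np; rewrite /single; have [/np|] := eqVneq p' p.
by rewrite fsbig_set1 /single eqxx expr1z.
Qed.

(** For a flat section F over the triangle, the transport of an edge is the quotient of the values
    of F at its ends; over the boundary these quotients cancel. *)
Lemma char_of_boundary S th sigma : local_system S th -> simplex2 S sigma ->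
  char_of th (boundary2 sigma) = 1.
Proof.
move=> L ss; have [F HF] := triangle_parallel L ss.
have edge (u0 v0 u1 v1 : R) : (forall t : R, 0 <= t <= 1 -> tri2 (u0 + t * u1, v0 + t * v1)) ->
    let p t := sigma (u0 + clamp t * u1, v0 + clamp t * v1) in
    simplex1 S p /\ trans th p = F (u0 + u1, v0 + v1) / F (u0, v0).
  move=> D p; have [cs sS] := ss.
  have sp : simplex1 S p.
    split.
    - move=> t A hA; have [d d0 H] := within_close cs (D _ (clamp_itv t)) hA.
      have k (u v : R) : {for t, continuous (fun s : R => v + clamp s * u)}.
        apply: cvgD; first exact: cvg_cst.
        by apply: cvgM; [exact: clamp_continuous|exact: cvg_cst].
      suff : nbhs t (fun s => A (p s)) by [].
      have /contR/(_ _ d0) k1 := k u1 u0; have /contR/(_ _ d0) k2 := k v1 v0.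
      by apply: filterS2 k1 k2 => s s1 s2; apply: H (D _ (clamp_itv s)) (conj s1 s2).
    - by move=> t; rewrite /p (clamp_id (clamp_itv t)).
    - by move=> z [t _ <-]; apply: sS; exists (u0 + clamp t * u1, v0 + clamp t * v1);
        first exact: D (clamp_itv t).
  split=> //.
  have h : PT th p 0 1 (F (u0, v0)) (F (u0 + u1, v0 + v1)).
    exists (fun t => F (u0 + clamp t * u1, v0 + clamp t * v1)); split.
    - move=> t t01; have [_ [d d0 H]] := HF _ (D _ (clamp_itv t)).
      have k (u v : R) : {for t, continuous (fun s : R => v + clamp s * u)}.
        apply: cvgD; first exact: cvg_cst.
        by apply: cvgM; [exact: clamp_continuous|exact: cvg_cst].
      have /contR/(_ _ d0)/nbhsRP[d1 d10 k1] := k u1 u0.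
      have /contR/(_ _ d0)/nbhsRP[d2 d20 k2] := k v1 v0.
      exists (Num.min d1 d2); first by rewrite lt_min d10.
      move=> s _; rewrite lt_min => /andP[/k1 s1 /k2 s2].
      by apply: H (D _ (clamp_itv s)) (conj s1 s2).
    - by rewrite clamp_id ?lexx ?ler01 // !mul0r !addr0.
    - by rewrite (@clamp_id _ 1) ?lexx ?ler01 // !mul1r.
  have F0 : F (u0, v0) != 0.
    have := D 0; rewrite lexx ler01 !mul0r !addr0 => /(_ isT) D0.
    exact: (HF _ D0).1.
  by rewrite (trans_eq L sp h) mulrC mulKf.
have [s1 t1] : simplex1 S (fun t => sigma (1 - clamp t, clamp t)) /\
    trans th (fun t => sigma (1 - clamp t, clamp t)) = F (0, 1) / F (1, 0).
  have := edge 1 0 (-1) 1; rewrite /= subrr add0r.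
  rewrite (_ : (fun t => sigma (1 + clamp t * -1, _)) = (fun t => sigma (1 - clamp t, clamp t))).
    by apply=> t t01; split => /=; lra.
  by apply/funext => t; rewrite mulrN1 mulr1 add0r.
have [s2 t2] : simplex1 S (fun t => sigma (0, clamp t)) /\
    trans th (fun t => sigma (0, clamp t)) = F (0, 1) / F (0, 0).
  have := edge 0 0 0 1; rewrite /= !add0r.
  rewrite (_ : (fun t => sigma (0 + clamp t * 0, _)) = (fun t => sigma (0, clamp t))).
    by apply=> t t01; split => /=; lra.
  by apply/funext => t; rewrite mulr0 mulr1 !add0r.
have [s3 t3] : simplex1 S (fun t => sigma (clamp t, 0)) /\
    trans th (fun t => sigma (clamp t, 0)) = F (1, 0) / F (0, 0).
  have := edge 0 0 1 0; rewrite /= !add0r.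
  rewrite (_ : (fun t => sigma (0 + clamp t * 1, _)) = (fun t => sigma (clamp t, 0))).
    by apply=> t t01; split => /=; lra.
  by apply/funext => t; rewrite mulr0 mulr1 !add0r.
have c1 := single_chain s1; have c2 := single_chain s2; have c3 := single_chain s3.
have c12 := chainD c1 (chainN c2).
rewrite /boundary2 (char_ofD L c12 c3) (char_ofD L c1 (chainN c2)) char_ofN; last exact: c2.1.
rewrite !char_of_single t1 t2 t3.
have n00 : F (0, 0) != 0 by apply: (HF _ _).1; split; rewrite /= ?addr0.
have n10 : F (1, 0) != 0 by apply: (HF _ _).1; split; rewrite /= ?addr0.
have n01 : F (0, 1) != 0 by apply: (HF _ _).1; split; rewrite /= ?add0r.
by field; rewrite n00 n10 n01.
Qed.

Lemma char_of_H1 S th : local_system S th -> H1_character S (char_of th).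
Proof.
move=> L; split; last by move=> sigma; exact: char_of_boundary.
by move=> a b [fa sa _] [fb sb _]; exact: (char_ofD L).
Qed.

Lemma char_of_mu n S th : local_system S th ->
  (forall x, S x -> \forall y \near x, th x y ^+ n = 1) ->
  forall c, cycle1 S c -> char_of th c ^+ n = 1.
Proof.
move=> L h c [fc sc _].
have nA p : ~ [set p | c p != 0] p -> c p = 0 by move=> /negP; rewrite negbK => /eqP.
rewrite (char_of_fin th nA) fsbig_finite // -prodrXl big1_seq // => p /=.
rewrite in_fset_set // => /set_mem /= /sc sp.
by rewrite exprnP exprz_exp mulrC -exprz_exp -exprnP (trans_exp L h sp) exp1rz.
Qed.

Lemma single_cycle S p : loop S p -> cycle1 S (single p).
Proof.
move=> [sp e]; have [f s] := single_chain sp; split=> // x.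
apply: fsbig1 => p' _; rewrite /single; have [->|] := eqVneq p' p; last by rewrite mul0r.
by rewrite e subrr mulr0.
Qed.

End Character.

(** * Charts and metrics *)

Section PlaneMaps.
Context {R : realType}.
Local Notation C := R[i].
Implicit Types (f g : C -> C) (z v w p q : C).

Definition det2 p q : R := complex.Re p * complex.Im q - complex.Im p * complex.Re q.

Lemma det2_dl p q p' q' : det2 (dl p' q' p) (dl p' q' q) = det2 p' q' * det2 p q.
Proof. by rewrite /det2 /dl; case: p q p' q' => a b [c d] [a' b'] [c' d'] /=; ring. Qed.

Lemma dl_comp p q p' q' v : dl (dl p' q' p) (dl p' q' q) v = dl p' q' (dl p q v).
Proof. by rewrite [dl p q v]/dl dlD !dlZ. Qed.

Lemma dl_id v : dl 1 'i%C v = v.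
Proof. by rewrite /dl [in RHS](complexE v) mulr1 mulrC [X in _ + X]mulrC. Qed.

(* A linear map that multiplies lengths by a constant and preserves the
   orientation is complex linear. *)
Lemma conformal_dl p q (k : R) : (forall v, sqmod (dl p q v) = k * sqmod v) ->
  0 < det2 p q -> q = 'i%C * p.
Proof.
move=> H d; have h1 := H 1; have h2 := H 'i%C.
have h3 := H (1 +i* 1); rewrite {1}/dl /= !mul1r in h3; rewrite dl1 in h1; rewrite dli in h2.
move: p q d {H} h1 h2 h3 => [a b] [c e]; rewrite /det2 /sqmod /= => d h1 h2 h3.
have o : a * c + b * e = 0 by move: h1 h2 h3; rewrite !expr2; lra.
have ka : a * a + b * b = k by move: h1; rewrite !expr2; lra.
have kc : c * c + e * e = k by move: h2; rewrite !expr2; lra.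
have dk : (a * e - b * c) * (a * e - b * c) = k * k.
  rewrite -{1}ka -kc.
  have -> : (a * a + b * b) * (c * c + e * e) = (a * e - b * c) * (a * e - b * c) +
    (a * c + b * e) * (a * c + b * e) by ring.
  by rewrite o; ring.
have k0 : 0 <= k by rewrite -ka addr_ge0 // -expr2 sqr_ge0.
have dE : a * e - b * c = k by nra.
have z0 : (c + b) ^+ 2 + (e - a) ^+ 2 = 0 by rewrite !expr2; lra.
move/eqP: z0; rewrite paddr_eq0 ?sqr_ge0 // !sqrf_eq0 => /andP[/eqP h4 /eqP h5].
by simpc; congr (_ +i* _); lra.
Qed.

Lemma sm2_diff f z : sm2 f z -> exists p q, [/\ rd f z p q,
  jacobian_det f z = det2 p q & forall v, differential f z v = dl p q v].
Proof.
move=> /sm2_rd[p [q h]]; exists p, q; split=> //; first exact: rd_jacobian.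
by move=> v; exact: rd_differential.
Qed.

Lemma sqmod_dl_cder p v : sqmod (dl p ('i%C * p) v) = sqmod p * sqmod v.
Proof. by rewrite dl_conf sqmodM mulrC. Qed.

Lemma det2_cder p : det2 p ('i%C * p) = sqmod p.
Proof. by case: p => a b; rewrite /det2 /sqmod /=; ring. Qed.

End PlaneMaps.

Section ChartLemmas.
Context {R : realType} {M : topologicalType}.
Local Notation C := R[i].
Implicit Types (S : set M) (phi psi chi w : chart R M) (x y : M) (v z : C).

Lemma chart_icoordK phi x : is_chart phi -> dom phi x -> icoord phi (phi x) = x.
Proof. by case=> _ _ + _ _; apply. Qed.

Lemma chart_dom_near phi x : is_chart phi -> dom phi x -> \forall y \near x, dom phi y.
Proof. by case=> o _ _ _ _ d; apply: open_nbhs_nbhs. Qed.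

Lemma chart_near phi x (P : C -> Prop) : is_chart phi -> dom phi x ->
  (\forall z \near phi x, P z) -> \forall y \near x, P (phi y).
Proof. by case=> _ _ _ c _ d; apply: cont_near; exact: c. Qed.

Lemma icoord_near phi x (P : M -> Prop) : is_chart phi -> dom phi x ->
  (\forall y \near x, P y) ->
  \forall z \near phi x, [/\ dom phi (icoord phi z), phi (icoord phi z) = z & P (icoord phi z)].
Proof.
move=> [ho hi K c ci] d Px.
have n1 : \forall z \near phi x, (phi @` dom phi) z.
  by apply: open_nbhs_nbhs; split=> //; exists x.
have n2 : \forall z \near phi x, P (icoord phi z).
  by apply: (@cont_near _ _ (icoord phi) (phi x) P (ci x d)); rewrite K.
by apply: filterS2 n1 n2 => _ [y dy <-]; rewrite K.
Qed.

Lemma chart_near_iff phi x (P : M -> Prop) : is_chart phi -> dom phi x ->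
  (\forall z \near phi x, P (icoord phi z)) -> \forall y \near x, P y.
Proof.
move=> cp d h; have := chart_near cp d h; have := chart_dom_near cp d.
by apply: filterS2 => y dy; rewrite chart_icoordK.
Qed.

Lemma transition_val phi psi x : is_chart phi -> dom phi x -> transition phi psi (phi x) = psi x.
Proof. by move=> cp d; rewrite /transition /= chart_icoordK. Qed.

Lemma transition_cont phi psi x : is_chart phi -> is_chart psi -> dom phi x -> dom psi x ->
  {for phi x, continuous (transition phi psi)}.
Proof.
move=> [_ _ K _ ci] [_ _ _ c _] d d'; apply: cont_comp; first exact: ci.
by rewrite K //; exact: c.
Qed.

Lemma transition_comp phi psi chi x : is_chart phi -> is_chart psi -> dom phi x -> dom psi x ->
  \forall z \near phi x, (transition psi chi \o transition phi psi) z = transition phi chi z.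
Proof.
move=> cp cs d d'; have := icoord_near cp d (chart_dom_near cs d').
by apply: filterS => z [dz e dz']; rewrite /transition /= chart_icoordK.
Qed.

Lemma transition_id phi x : is_chart phi -> dom phi x ->
  \forall z \near phi x, z = transition phi phi z.
Proof.
move=> cp d; have := icoord_near cp d (chart_dom_near cp d).
by apply: filterS => z [_ e _]; rewrite /transition /= e.
Qed.

Lemma chart_open_image phi (D : set M) : is_chart phi -> open D -> D `<=` dom phi ->
  open (phi @` D).
Proof.
move=> cp oD sD; rewrite openE => _ [x Dx <-].
have nD : \forall y \near x, D y by exact: open_nbhs_nbhs.
by have := icoord_near cp (sD x Dx) nD; apply: filterS => z [_ e Dz]; exists (icoord phi z).
Qed.

(* Smooth compatibility at one point. *)
Definition scp phi psi x := [/\ sm2 (transition phi psi) (phi x),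
  sm2 (transition psi phi) (psi x) & 0 < jacobian_det (transition phi psi) (phi x)].

Lemma smooth_compatP S phi psi : open S -> is_chart phi -> is_chart psi ->
  smooth_compat S phi psi <-> forall x, (dom phi `&` dom psi `&` S) x -> scp phi psi x.
Proof.
move=> oS cp cs; set D := dom phi `&` dom psi `&` S.
have oD : open D.
  by case: cp cs => ho _ _ _ _ [ho' _ _ _ _]; apply: openI => //; apply: openI.
have oD1 : open (phi @` D) by apply: chart_open_image => // x [[]].
have oD2 : open (psi @` D) by apply: chart_open_image => // x [[]].
split=> [[h1 h2 h3] x Dx|H].
  split; last exact: h3.
    by move/(smooth_mapP _ oD1): h1; apply; exists x.
  by move/(smooth_mapP _ oD2): h2; apply; exists x.
split; first by apply/(smooth_mapP _ oD1) => _ [x /H[h _ _] <-].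
  by apply/(smooth_mapP _ oD2) => _ [x /H[_ h _] <-].
by move=> x /H[].
Qed.

Lemma rd_transition_comp phi psi chi x p q p' q' : is_chart phi -> is_chart psi ->
  dom phi x -> dom psi x -> rd (transition phi psi) (phi x) p q ->
  rd (transition psi chi) (psi x) p' q' ->
  rd (transition phi chi) (phi x) (dl p' q' p) (dl p' q' q).
Proof.
move=> cp cs d d' h h'; apply: rd_near (transition_comp chi cp cs d d') _.
by apply: rd_comp h _; rewrite (transition_val psi cp d); exact: h'.
Qed.

Lemma scp_trans phi psi chi x : is_chart phi -> is_chart psi -> is_chart chi ->
  dom phi x -> dom psi x -> dom chi x -> scp phi psi x -> scp psi chi x ->
  scp phi chi x /\ forall v, differential (transition phi chi) (phi x) v =
    differential (transition psi chi) (psi x) (differential (transition phi psi) (phi x) v).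
Proof.
move=> cp cs cc d d' d'' [h1 h2 h3] [k1 k2 k3].
have [p [q [r1 j1 D1]]] := sm2_diff h1; have [p' [q' [r2 j2 D2]]] := sm2_diff k1.
have r := rd_transition_comp cp cs d d' r1 r2.
split; last by move=> v; rewrite D1 D2 (rd_differential _ r) dl_comp.
split.
- apply: sm2_near (transition_comp chi cp cs d d') _.
  by apply: (sm2_comp h1); rewrite (transition_val psi cp d); exact: k1.
- apply: sm2_near (transition_comp phi cc cs d'' d') _.
  by apply: (sm2_comp k2); rewrite (transition_val psi cc d''); exact: h2.
- rewrite (rd_jacobian r) -/(det2 _ _) det2_dl -j1 -j2; exact: mulr_gt0.
Qed.

Lemma scp_sym phi psi x : is_chart phi -> is_chart psi -> dom phi x -> dom psi x ->
  scp phi psi x -> scp psi phi x /\ forall v,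
    differential (transition psi phi) (psi x) (differential (transition phi psi) (phi x) v) = v.
Proof.
move=> cp cs d d' [h1 h2 h3].
have [p [q [r1 j1 D1]]] := sm2_diff h1; have [p' [q' [r2 j2 D2]]] := sm2_diff h2.
have r := rd_transition_comp cp cs d d' r1 r2.
have r' : rd (transition phi phi) (phi x) 1 'i%C.
  apply: rd_near (transition_id cp d) _.
  by apply: rd_eq (cder_id (phi x)) _ _; rewrite ?mulr1.
have [e1 e2] := rd_unique r r'.
split; last by move=> v; rewrite D1 D2 -dl_comp e1 e2 dl_id.
split; [exact: h2|exact: h1|]; have : det2 (dl p' q' p) (dl p' q' q) = 1.
  by rewrite e1 e2 /det2 /=; ring.
by rewrite det2_dl -j1 -j2 => h; rewrite -(pmulr_lgt0 _ h3) h.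
Qed.

(** The two derivatives are inverse to each other, hence nonzero, and the Jacobian determinant is
    the squared modulus of the derivative. *)
Lemma scp_hol phi psi x : is_chart phi -> is_chart psi -> dom phi x -> dom psi x ->
  hol (transition phi psi) (phi x) -> hol (transition psi phi) (psi x) ->
  scp phi psi x /\ derive1 (transition phi psi) (phi x) != 0.
Proof.
move=> cp cs d d' h1 h2.
have c1 := hol_cder h1; have c2 := hol_cder h2.
have r := rd_transition_comp cp cs d d' c1 c2.
have r' : rd (transition phi phi) (phi x) 1 'i%C.
  apply: rd_near (transition_id cp d) _.
  by apply: rd_eq (cder_id (phi x)) _ _; rewrite ?mulr1.
have [e1 _] := rd_unique r r'; rewrite dl_conf in e1.
have n0 : derive1 (transition phi psi) (phi x) != 0.
  by apply/eqP => e; move/eqP: e1; rewrite e mul0r eq_sym oner_eq0.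
split; last exact: n0.
split; [exact: hol_sm2|exact: hol_sm2|].
rewrite (rd_jacobian c1) -/(det2 _ _) det2_cder.
by rewrite -nm_sqr exprn_gt0 // nm_gt0.
Qed.

Implicit Types (g : metric R M) (N : M -> C -> R).

(* [metric_in_coordinate] at one point. *)
Definition mic g w N x := forall phi, mcharts g phi -> dom phi x ->
  scp phi w x /\ forall v, sqlen g phi x v = N x (differential (transition phi w) (phi x) v).

Lemma metric_in_coordinateP S g w N : open S -> is_chart w ->
  (forall phi, mcharts g phi -> is_chart phi) ->
  metric_in_coordinate S g w N <-> forall x, dom w x -> S x -> mic g w N x.
Proof.
move=> oS cw cg; split=> [H x dw Sx phi gphi dphi|H phi gphi].
  have [/(smooth_compatP oS (cg _ gphi) cw) h1 h2] := H phi gphi.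
  by split=> [|v]; [exact: h1|exact: h2].
split; first by apply/(smooth_compatP oS (cg _ gphi) cw) => x [[d1 d2] d3]; have [] := H x d2 d3 phi gphi d1.
by move=> x v [[d1 d2] d3]; have [_] := H x d2 d3 phi gphi d1; exact.
Qed.

Definition covered S g := (forall phi, mcharts g phi -> is_chart phi) /\
  forall x, S x -> exists2 phi, mcharts g phi & dom phi x.

Lemma coordinate_change S g w N w' N' x : covered S g -> is_chart w -> is_chart w' ->
  S x -> dom w x -> dom w' x -> mic g w N x -> mic g w' N' x ->
  scp w w' x /\ forall v, N x v = N' x (differential (transition w w') (w x) v).
Proof.
move=> [cg cov] cw cw' Sx d d' m m'; have [phi gphi dphi] := cov x Sx.
have cp := cg _ gphi.
have [s1 e1] := m phi gphi dphi; have [s2 e2] := m' phi gphi dphi.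
have [s3 i3] := scp_sym cp cw dphi d s1.
have [s4 e4] := scp_trans cw cp cw' d dphi d' s3 s2.
split=> // v; rewrite e4 -e2 e1; congr (N x _).
have [_ i4] := scp_sym cw cp d dphi s3.
by rewrite i4.
Qed.

Lemma mic_change g w N w' N' x : (forall phi, mcharts g phi -> is_chart phi) ->
  is_chart w -> is_chart w' -> dom w x -> dom w' x -> mic g w N x -> scp w w' x ->
  (forall v, N x v = N' x (differential (transition w w') (w x) v)) -> mic g w' N' x.
Proof.
move=> cg cw cw' d d' m s e phi gphi dphi; have cp := cg _ gphi.
have [s1 e1] := m phi gphi dphi.
have [s2 e2] := scp_trans cp cw cw' dphi d d' s1 s.
by split=> // v; rewrite e1 e e2.
Qed.

Lemma conformal_change w w' x (la la' : R) : is_chart w -> is_chart w' -> dom w x -> dom w' x ->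
  0 < la -> 0 < la' -> scp w w' x ->
  (forall v, la * sqmod v = la' * sqmod (differential (transition w w') (w x) v)) ->
  exists p, cder (transition w w') (w x) p /\ la = la' * sqmod p.
Proof.
move=> cw cw' d d' l l' [h1 h2 h3] H; have [p [q [r1 j1 D1]]] := sm2_diff h1.
have K v : sqmod (dl p q v) = la / la' * sqmod v.
  by rewrite -D1 mulrAC H mulrC mulKf // gt_eqF.
rewrite j1 in h3; have qE := conformal_dl K h3.
exists p; split; first by rewrite qE in r1.
have := K 1; rewrite dl1 => ->; rewrite /sqmod /= expr1n expr0n /= addr0 mulr1.
by rewrite mulrC divfK // gt_eqF.
Qed.

End ChartLemmas.

(** * Developing charts and holonomy *)

Section Developing.
Context {R : realType} {M : topologicalType}.
Local Notation C := R[i].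
Implicit Types (S : set M) (w z : chart R M) (x y : M) (g : metric R M) (u b : C).

(* [z = drot z w x * w + b] near [x] when [z] and [w] are developing charts. *)
Definition drot z w x : C := derive1 (transition w z) (w x).

Lemma affine_drot z w x u b : is_chart w -> dom w x ->
  (\forall y \near x, z y = u * w y + b) -> drot z w x = u.
Proof.
move=> cw d H; apply: cder_derive1.
have h : cder (fun t => u * t + b) (w x) u.
  have := cderD (cderM (cder_cst u (w x)) (cder_id (w x))) (cder_cst b (w x)).
  by move=> /cder_eq; apply; rewrite mul0r add0r mulr1 addr0.
apply: rd_near h; have := icoord_near cw d H.
by apply: filterS => t [_ e h]; rewrite /transition /= h e.
Qed.

Lemma near_near_M (x : M) (P : M -> Prop) : (\forall y \near x, P y) ->
  \forall y \near x, \forall z \near y, P z.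
Proof. by move=> /nbhs_interior. Qed.

Lemma affine_drot_near z w x u b : is_chart w -> dom w x ->
  (\forall y \near x, z y = u * w y + b) -> \forall y \near x, drot z w y = u.
Proof.
move=> cw d /near_near_M H; have := chart_dom_near cw d.
by apply: filterS2 H => y Hy dy; exact: affine_drot cw dy Hy.
Qed.

Definition conformal_at g w (la : M -> R) x := mic g w (fun y v => la y * sqmod v) x.

Lemma conformal_transition S g w w' (la la' : M -> R) x : covered S g -> is_chart w ->
  is_chart w' -> S x -> dom w x -> dom w' x -> 0 < la x -> 0 < la' x ->
  conformal_at g w la x -> conformal_at g w' la' x ->
  exists p, cder (transition w w') (w x) p /\ la x = la' x * sqmod p.
Proof.
move=> cov cw cw' Sx d d' l l' m m'.
have [s e] := coordinate_change cov cw cw' Sx d d' m m'.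
exact: (conformal_change cw cw' d d' l l' s e).
Qed.

Lemma conformal_hol S g w w' (la la' : M -> R) x : open S -> covered S g -> is_chart w ->
  is_chart w' -> S x -> dom w x -> dom w' x ->
  (forall y, S y -> dom w y -> 0 < la y /\ conformal_at g w la y) ->
  (forall y, S y -> dom w' y -> 0 < la' y /\ conformal_at g w' la' y) ->
  hol (transition w w') (w x) /\
  \forall y \near x, la y = la' y * sqmod (derive1 (transition w w') (w y)).
Proof.
move=> oS cov cw cw' Sx d d' H H'.
have nS : \forall y \near x, S y by exact: open_nbhs_nbhs.
have nn : \forall y \near x, S y /\ dom w y /\ dom w' y.
  have := chart_dom_near cw d; have := chart_dom_near cw' d'.
  by apply: filterS3 nS => y ? ? ?; split.
have K y : S y /\ dom w y /\ dom w' y ->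
    exists p, cder (transition w w') (w y) p /\ la y = la' y * sqmod p.
  move=> [Sy [dy dy']]; have [l m] := H y Sy dy; have [l' m'] := H' y Sy dy'.
  exact: conformal_transition cov cw cw' Sy dy dy' l l' m m'.
split; last by apply: filterS nn => y /K[p [h ->]]; rewrite (cder_derive1 h).
have := icoord_near cw d nn; apply: filterS => t [_ e /K[p [h _]]].
by exists p; rewrite e in h.
Qed.

Lemma dev_conformal S g z : open S -> covered S g -> developing_chart S g z ->
  forall y, S y -> dom z y -> 0 < (1 : R) /\ conformal_at g z (fun=> 1) y.
Proof.
move=> oS [cg _] [cz zS /(metric_in_coordinateP _ oS cz cg) H] y Sy dy; split=> //.
by move=> phi gp dp; have [h1 h2] := H y dy Sy phi gp dp; split=> // v; rewrite h2 mul1r.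
Qed.

(** The transition is holomorphic and its derivative has modulus one near x, so the derivative is
    constant. *)
Lemma dev_affine S g z w x : open S -> covered S g -> developing_chart S g z ->
  developing_chart S g w -> dom z x -> dom w x ->
  nm (drot z w x) = 1 /\ exists b, \forall y \near x, z y = drot z w x * w y + b.
Proof.
move=> oS cov dz dw d d'; have [cz zS _] := dz; have [cw wS _] := dw.
have [h n] := conformal_hol oS cov cw cz (zS x d) d' d (dev_conformal oS cov dw) (dev_conformal oS cov dz).
have n1 : \forall t \near w x, nm (derive1 (transition w z) t) = 1.
  have := icoord_near cw d' n; apply: filterS => t [_ e]; rewrite e mul1r -nm_sqr => /esym/eqP.
  by rewrite sqrp_eq1 ?nm_ge0 // => /eqP.
have c := unimodular_near_cst (hol_derive1 h) n1 ltr01.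
split; first exact: nbhs_singleton n1.
have d0 : \forall t \near w x,
    cder (fun s => transition w z s - drot z w x * s) t 0.
  apply: filterS2 (hol_cders h) c => t ht ct.
  apply: cder_eq (cderB ht (cderM (cder_cst (drot z w x) t) (cder_id t))) _.
  by rewrite ct mul0r add0r mulr1 subrr.
exists (transition w z (w x) - drot z w x * w x).
have := chart_near cw d' (cder0_near d0); have := chart_dom_near cw d'.
apply: filterS2 => y dy e; rewrite -e (transition_val _ cw dy).
by rewrite addrC subrK.
Qed.

End Developing.

Section Holonomy.
Context {R : realType} {M : topologicalType}.
Local Notation C := R[i].
Context (S : set M) (g : metric R M) (Z : M -> chart R M)
  (oS : open S) (cov : covered S g)
  (ZP : forall x, S x -> developing_chart S g (Z x) /\ dom (Z x) x).
Implicit Types (w z : chart R M) (x y : M) (u b : C) (ga : R -> M).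

(** The local system of the differentials d(Z x): near y, d(Z x) = [dev_sys x y] d(Z y). *)
Definition dev_sys x y : C := drot (Z x) (Z y) y.

Let chartZ z : developing_chart S g z -> is_chart z. Proof. by case. Qed.

Lemma drot_near z w x : developing_chart S g z -> developing_chart S g w -> dom z x -> dom w x ->
  \forall y \near x, drot z w y = drot z w x.
Proof.
move=> dz dw d d'; have [_ [b h]] := dev_affine oS cov dz dw d d'.
exact: affine_drot_near (chartZ dw) d' h.
Qed.

Lemma drot_neq0 z w x : developing_chart S g z -> developing_chart S g w -> dom z x -> dom w x ->
  drot z w x != 0.
Proof.
move=> dz dw d d'; have [h _] := dev_affine oS cov dz dw d d'.
by rewrite -nm_gt0 h.
Qed.

Lemma drot_comp z w w' x u b : (\forall y \near x, z y = u * w y + b) ->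
  developing_chart S g w -> developing_chart S g w' -> dom w x -> dom w' x ->
  drot z w' x = u * drot w w' x.
Proof.
move=> h dw dw' d d'; have [_ [b' h']] := dev_affine oS cov dw dw' d d'.
apply: (@affine_drot _ _ _ _ _ _ (u * b' + b)) => //; first exact: chartZ.
by apply: filterS2 h h' => y -> ->; rewrite mulrDr mulrA addrA.
Qed.

Lemma drotM z w w' x : developing_chart S g z -> developing_chart S g w ->
  developing_chart S g w' -> dom z x -> dom w x -> dom w' x ->
  drot z w' x = drot z w x * drot w w' x.
Proof.
move=> dz dw dw' d d1 d2; have [_ [b h]] := dev_affine oS cov dz dw d d1.
exact: drot_comp h dw dw' d1 d2.
Qed.

Lemma near_dom_S z x : developing_chart S g z -> dom z x -> \forall y \near x, dom z y /\ S y.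
Proof.
move=> [cz zS _] d; have := chart_dom_near cz d; apply: filterS => y dy.
by split=> //; exact: zS.
Qed.

Lemma dev_sys_local : local_system S dev_sys.
Proof.
move=> x Sx; have [dx ddx] := ZP Sx.
apply: filterS (near_dom_S dx ddx) => y [xy Sy]; have [dy ddy] := ZP Sy; split.
  exact: drot_neq0.
have n1 := near_dom_S dx xy; have n2 := near_dom_S dy ddy; have n3 := drot_near dx dy xy ddy.
apply: filterS3 n1 n2 n3 => t [xt St] [yt _] e; have [dt ddt] := ZP St.
by rewrite /dev_sys (drotM dx dy dt xt yt ddt) e.
Qed.

Lemma dev_parallel z ga (a b : R) : developing_chart S g z -> continuous ga ->
  (forall s, a <= s <= b -> dom z (ga s)) ->
  parallel dev_sys ga a b (fun s => drot z (Z (ga s)) (ga s)).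
Proof.
move=> dz c H t0 t01; have z0 := H t0 t01; have [_ zS _] := dz.
have [d0 dd0] := ZP (zS _ z0).
have [d d_gt0 K] := near_path c (filterI (drot_near dz d0 z0 dd0) (near_dom_S d0 dd0)).
exists d => // t tab td; have [e [dt St]] := K t td; have [dz' ddz'] := ZP St.
by rewrite /dev_sys (drotM dz d0 dz' (H t tab) dt ddz') e.
Qed.

Lemma rotation_PT ga r : loop S ga -> rotation_along S g ga r -> PT dev_sys ga 0 1 1 r.
Proof.
move=> [sp e01] [N [t [z [u [[t0 t1 tm] zP zN uP ->]]]]].
have cg := simplex1_cont sp.
(* The differential of [z j] relative to the germ at ga (t j). Transport takes rho 0 to u 0 ... u
   (k-1) rho k; since rho (N+1) = rho 0, dividing by rho 0 leaves the rotation. *)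
pose rho j := drot (z j) (Z (ga (t j))) (ga (t j)).
have dz j : (j <= N.+1)%N -> developing_chart S g (z j) /\ dom (z j) (ga (t j)).
  rewrite leq_eqVlt => /orP[/eqP ->|].
    have [h1 h2] := zP 0%N (leq0n _); rewrite zN t1 -e01 -t0; split=> //.
    by apply: h2; rewrite lexx tm.
  by rewrite ltnS => jN; have [h1 h2] := zP j jN; split=> //; apply: h2; rewrite lexx tm.
have t_ge0 j : (j <= N.+1)%N -> 0 <= t j.
  elim: j => [|j IH] jN; first by rewrite t0.
  by apply: le_trans (IH (ltnW jN)) (tm _ _).
have H k : (k <= N.+1)%N -> PT dev_sys ga 0 (t k) (rho 0%N) ((\prod_(j < k) u j) * rho k).
  elim: k => [|k IH] kN.
    rewrite big_ord0 mul1r t0 /rho t0; apply: (PT_refl _ dev_sys_local).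
    exact: simplex1_S sp.
  have kN' : (k <= N)%N by [].
  have [h1 h2] := zP k kN'; have [_ [b h3]] := uP k kN'.
  apply: (PT_trans (t_ge0 k (ltnW kN)) (tm _ kN') (IH (ltnW kN))).
  have [h4 h5] := dz k.+1 kN; have [h6 h7] := ZP (simplex1_S (t k.+1) sp).
  rewrite big_ord_recr /= -mulrA; apply: PT_scale.
  exists (fun s => drot (z k) (Z (ga s)) (ga s)); split=> //.
    exact: dev_parallel.
  exact: drot_comp h3 h4 h6 h5 h7.
have := H N.+1 (leqnn _); have r0 : rho N.+1 = rho 0%N by rewrite /rho zN t1 t0 -e01.
have rn : rho 0%N != 0.
  have [h1 h2] := dz 0%N (leq0n _); have [h3 h4] := ZP (simplex1_S (t 0%N) sp).
  exact: drot_neq0.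
rewrite r0 t1 => h; have := PT_scale (rho 0%N)^-1 h.
by rewrite mulVf // mulrCA mulVf // mulr1.
Qed.

Lemma path_pieces ga : simplex1 S ga -> exists N (t : nat -> R) (m : nat -> M),
  subdivision N t /\ forall j, (j <= N)%N -> S (m j) /\
    forall s : R, t j <= s <= t j.+1 -> dom (Z (m j)) (ga s).
Proof.
move=> sp; have cg := simplex1_cont sp.
have [] := @subdivide R (fun a b : R => exists m, S m /\ forall s : R, a <= s <= b -> dom (Z m) (ga s)).
  move=> t _; have St := simplex1_S t sp; have [dz dd] := ZP St.
  have [d d0 K] := near_path cg (chart_dom_near (chartZ dz) dd).
  exists d => // x y _ _ _ xd yd; exists (ga t); split=> // s s01; apply: K.
  by move: xd yd s01; rewrite !ltr_norml; lra.
move=> N [t [sub H]].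
have : forall j, exists m, (j <= N)%N -> S m /\ forall s : R, t j <= s <= t j.+1 -> dom (Z m) (ga s).
  move=> j; case: (leqP j N) => jN; last by exists (ga 0).
  by have [m [h1 h2]] := H j jN; exists m.
move=> /choice[m hm]; exists N, t, m; split=> // j jN; exact: hm.
Qed.

Lemma rotation_exists ga : loop S ga -> exists r, rotation_along S g ga r.
Proof.
move=> [sp e01]; have [N [t [m [[t0 t1 tm] H]]]] := path_pieces sp.
(* The index N+1 falls in the second branch, so that the chain closes up at [z 0]. *)
pose z j := if (j <= N)%N then Z (m j) else Z (m 0%N).
pose u j := drot (z j) (z j.+1) (ga (t j.+1)).
have dz j : developing_chart S g (z j).
  rewrite /z; case: leqP => jN; first by have [/ZP[]] := H j jN.
  by have [/ZP[]] := H 0%N (leq0n _).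
have d1 j : (j <= N)%N -> dom (z j) (ga (t j.+1)).
  by move=> jN; rewrite /z jN; have [_] := H j jN; apply; rewrite lexx tm.
have d2 j : (j <= N)%N -> dom (z j.+1) (ga (t j.+1)).
  move=> jN; rewrite /z; case: (ltnP j N) => jN'.
    by have [_] := H j.+1 jN'; apply; rewrite lexx tm.
  have -> : j = N by apply/eqP; rewrite eqn_leq jN.
  rewrite t1 -e01 -t0; have [_] := H 0%N (leq0n _); apply; by rewrite lexx tm.
exists (\prod_(j < N.+1) u j), N, t, z, u; split=> //.
- move=> j jN; split; first exact: dz.
  by rewrite /z jN; have [_] := H j jN.
- by rewrite /z ltnn.
- move=> j jN; have [h1 h2] := dev_affine oS cov (dz _) (dz _) (d1 j jN) (d2 j jN).
  by split=> //; rewrite norm_nm h1.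
Qed.

(** For the converse, some rotation r' is realised by a chain of charts, and r' = r by uniqueness of
    transport. *)
Lemma rotation_along_PT ga r : loop S ga -> rotation_along S g ga r <-> PT dev_sys ga 0 1 1 r.
Proof.
move=> lg; split; first exact: rotation_PT.
move=> h; have [r' hr'] := rotation_exists lg.
have [sp _] := lg.
rewrite (PT_unique dev_sys_local (simplex1_cont sp) ler01 _ h (rotation_PT lg hr')) //.
by move=> t _; exact: simplex1_S sp.
Qed.

Lemma rotational_holonomy_exists :
  rotational_holonomy S g (char_of dev_sys).
Proof.
split; first exact: char_of_H1 dev_sys_local.
move=> ga lg; apply/(rotation_along_PT _ lg); rewrite char_of_single.
exact: transP dev_sys_local lg.1.
Qed.

(* Near x the developing chart Z x is a path connected neighbourhood. *)
Lemma dev_sys_conn x : S x -> \forall y \near x, conn S dev_sys x y (dev_sys x y).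
Proof.
move=> Sx; have [dz dd] := ZP Sx; have cz := chartZ dz; have [_ _ _ _ ci] := cz.
have [_ zS _] := dz.
have n1 := icoord_near cz dd (chart_dom_near cz dd).
have /nbhsCP[e e0 He] := n1.
apply: (chart_near_iff cz dd); apply/nbhsCP; exists e => // t te.
pose ga s := icoord (Z x) (lin (Z x x) t (clamp s)).
have inb s : nm (lin (Z x x) t (clamp s) - Z x x) < e.
  by apply: lin_ball (clamp_itv s) _ te; rewrite subrr nm0.
have cga : continuous ga.
  move=> s; apply: (@cont_comp _ _ _ (fun s => lin (Z x x) t (clamp s)) (icoord (Z x))).
    apply: (@cont_comp _ _ _ clamp (lin (Z x x) t)); first exact: clamp_continuous.
    exact: cd_cont (lin_cd _ _ _).
  have [h1 h2 _] := He _ (inb s); rewrite -h2; exact: ci.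
have dga s : dom (Z x) (ga s) by have [] := He _ (inb s).
have g0 : ga 0 = x by rewrite /ga clamp_id ?lexx ?ler01 // lin0 (chart_icoordK cz dd).
have g1 : ga 1 = icoord (Z x) t by rewrite /ga clamp_id ?lexx ?ler01 // lin1.
exists ga; split=> //.
  split=> // [s|y [s _ <-]]; first by rewrite /ga (clamp_id (clamp_itv s)).
  exact: zS.
exists (fun s => drot (Z x) (Z (ga s)) (ga s)); split.
- by apply: dev_parallel.
- by rewrite g0 -[RHS](lsys_refl dev_sys_local Sx).
- by rewrite g1.
Qed.

End Holonomy.

Section ComplexCharts.
Context {R : realType} {M : topologicalType}.
Implicit Types (S : set M) (w z : chart R M) (x y : M) (g : metric R M).

Lemma transition_chain w w' z x : is_chart w -> is_chart w' -> dom w x -> dom w' x ->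
  hol (transition w w') (w x) -> hol (transition w' z) (w' x) ->
  hol (transition w z) (w x) /\ derive1 (transition w z) (w x) =
    derive1 (transition w' z) (w' x) * derive1 (transition w w') (w x).
Proof.
move=> cw cw' d d' h h'; have n := transition_comp z cw cw' d d'; split.
  apply: hol_near n _; apply: hol_comp h _.
  by rewrite (transition_val w' cw d); exact: h'.
apply: cder_derive1; apply: rd_near n _; apply: cder_comp (hol_cder h) _.
by rewrite (transition_val w' cw d); exact: hol_cder.
Qed.

Lemma dev_hol S g z w x : open S -> covered S g -> developing_chart S g z ->
  developing_chart S g w -> dom z x -> dom w x -> hol (transition w z) (w x).
Proof.
move=> oS cov dz dw d d'; have [cz zS _] := dz; have [cw _ _] := dw.
have [h _] := conformal_hol oS cov cw cz (zS x d) d' d (dev_conformal oS cov dw) (dev_conformal oS cov dz).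
exact: h.
Qed.

Lemma rescale (a b t c : R[i]) : c != 0 -> a * b * t = a * b / c * (c * t).
Proof. by move=> c0; rewrite mulrA divfK. Qed.

Lemma root4_exists (a : R[i]) : exists b, b ^+ 4 = a.
Proof. by exists (4.-root a); rewrite rootCK. Qed.

End ComplexCharts.

(** * Fourth roots of q compared with developing charts *)

Section FourthRoots.
Context {R : realType} {M : topologicalType}.
Local Notation C := R[i].
Context (S : set M) (g : metric R M) (Z : M -> chart R M) (X : set (chart R M))
  (q : chart R M -> M -> C) (A : M -> C)
  (oS : open S) (cov : covered S g)
  (ZP : forall x, S x -> developing_chart S g (Z x) /\ dom (Z x) x)
  (Xc : forall w, X w -> is_chart w) (Xx : forall x, exists2 w, X w & dom w x)
  (Xh : forall w w' x, X w -> X w' -> dom w x -> dom w' x -> hol (transition w w') (w x))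
  (A0 : forall x, S x -> A x != 0)
  (qA : forall x w y, S x -> X w -> dom w y -> dom (Z x) y ->
     [/\ hol (transition w (Z x)) (w y), derive1 (transition w (Z x)) (w y) != 0 &
      q w y = A x * derive1 (transition w (Z x)) (w y) ^+ 4]).
Implicit Types (w z : chart R M) (x y : M) (u b : C) (ga : R -> M) (V : set M)
  (h : chart R M -> M -> C).

Let dZ x w y : C := derive1 (transition w (Z x)) (w y).

Let dev x : S x -> developing_chart S g (Z x). Proof. by move=> /ZP[]. Qed.
Let domZ x : S x -> dom (Z x) x. Proof. by move=> /ZP[]. Qed.
Let isZ x : S x -> is_chart (Z x). Proof. by move=> /dev[]. Qed.

Let dZ_drot x x' w y : S x -> S x' -> X w -> dom w y -> dom (Z x) y -> dom (Z x') y ->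
  dZ x w y = drot (Z x) (Z x') y * dZ x' w y.
Proof.
move=> Sx Sx' Xw d d1 d2; have [h _ _] := qA Sx' Xw d d2.
have h2 := dev_hol oS cov (dev Sx) (dev Sx') d1 d2.
have [_ e] := transition_chain (Xc Xw) (isZ Sx') d d2 h h2; exact: e.
Qed.

Let dZ_law x w w' y : S x -> X w -> X w' -> dom w y -> dom w' y -> dom (Z x) y ->
  dZ x w y = dZ x w' y * derive1 (transition w w') (w y).
Proof.
move=> Sx Xw Xw' d d' dz; have [h _ _] := qA Sx Xw' d' dz.
have [_ e] := transition_chain (Xc Xw) (Xc Xw') d d' (Xh Xw Xw' d d') h; exact: e.
Qed.

Let derive_neq0 w w' y : X w -> X w' -> dom w y -> dom w' y ->
  derive1 (transition w w') (w y) != 0.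
Proof.
move=> Xw Xw' d d'.
by have [] := scp_hol (Xc Xw) (Xc Xw') d d' (Xh Xw Xw' d d') (Xh Xw' Xw d' d).
Qed.

(** The quotient of h by d(Z x) is holomorphic and its fourth power is the constant A x. Its modulus
    is thus constant, and so is the quotient; the other charts follow from the transformation
    law. *)
Lemma fourth_root_local V h x : fourth_root X q V h -> S x -> V x -> exists k,
  \forall y \near x, forall w, X w -> dom w y -> h w y = k * dZ x w y.
Proof.
move=> [oV law hq] Sx Vx; have [w Xw dw] := Xx x; have cw := Xc Xw.
pose D := derive1 (transition w (Z x)).
have [hT D0 _] := qA Sx Xw dw (domZ Sx).
pose f t := h w (icoord w t) / D t.
have hD := hol_derive1 hT.
have hf : hol f (w x).
  apply: (@holM _ (h w \o icoord w) (fun t => (D t)^-1)).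
    by have [/holP] := hq w x Xw (conj dw Vx).
  exact: holV hD D0.
have nV : \forall y \near x, V y by exact: open_nbhs_nbhs.
have nZ := chart_dom_near (isZ Sx) (domZ Sx).
have n1 : \forall y \near x, dom w y /\ V y /\ dom (Z x) y.
  by apply: filterS3 (chart_dom_near cw dw) nV nZ => y ? ? ?.
have [al alA] := root4_exists (A x).
have al0 : al != 0 by apply: contraTneq (A0 Sx) => e; rewrite -alA e expr0n eqxx.
have c_gt0 : 0 < nm al by rewrite nm_gt0.
have nf : \forall t \near w x, nm (f t) = nm al.
  apply: filterS (icoord_near cw dw n1) => t [_ et [dt [Vt zt]]].
  have [_ h4] := hq w _ Xw (conj dt Vt); have [_ D0t qt] := qA Sx Xw dt zt.
  rewrite et in D0t qt; have e1 : h w (icoord w t) = f t * D t by rewrite /f divfK.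
  rewrite qt e1 exprMn -alA in h4.
  have e4 := mulIf (expf_neq0 4 D0t) h4.
  apply/eqP; rewrite -(eqrXn2 (n:=4)) ?nm_ge0 //; apply/eqP.
  by rewrite -nmX e4 nmX.
have fc := unimodular_near_cst hf nf c_gt0.
exists (f (w x)); apply: filterS2 n1 (chart_near cw dw fc) => y [dy [Vy zy]] fy w' Xw' dy'.
have n0 := derive_neq0 Xw Xw' dy dy'; apply: (mulIf n0).
have l := law w w' y Xw Xw' (conj (conj dy dy') Vy); rewrite expr1 in l.
rewrite -l -mulrA -(dZ_law Sx Xw Xw' dy dy' zy) -fy /f (chart_icoordK cw dy).
by have [_ D0y _] := qA Sx Xw dy zy; rewrite /D /dZ divfK.
Qed.

Let W x : chart R M := projT1 (cid2 (Xx x)).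
Let XW x : X (W x). Proof. exact: (s2valP (cid2 (Xx x))). Qed.
Let dW x : dom (W x) x. Proof. exact: (s2valP' (cid2 (Xx x))). Qed.

(* The form [h] is [root_coef h x] times the differential of [Z x] at [x]. *)
Definition root_coef h x : C := h (W x) x / dZ x (W x) x.

Lemma root_coef_near V h x : fourth_root X q V h -> V `<=` S -> V x ->
  \forall y \near x, root_coef h y = root_coef h x * dev_sys Z x y.
Proof.
move=> fr VS Vx; have Sx := VS _ Vx; have [k K] := fourth_root_local fr Sx Vx.
have kx : root_coef h x = k.
  have [_ n0 _] := qA Sx (XW x) (dW x) (domZ Sx).
  by rewrite /root_coef (nbhs_singleton K (W x) (XW x) (dW x)) mulfK.
rewrite kx; apply: filterS2 K (near_dom_S (dev Sx) (domZ Sx)) => y Ky [dy Sy].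
have [_ n0 _] := qA Sy (XW y) (dW y) (domZ Sy).
rewrite /root_coef (Ky _ (XW y) (dW y)) (dZ_drot Sx Sy (XW y) (dW y) dy (domZ Sy)).
by rewrite mulrA mulfK.
Qed.

Lemma root_coef_neq0 V h x : fourth_root X q V h -> V `<=` S -> V x -> root_coef h x != 0.
Proof.
move=> [_ _ hq] VS Vx; have Sx := VS _ Vx; have [_ n0 qx] := qA Sx (XW x) (dW x) (domZ Sx).
have [_ h4] := hq _ _ (XW x) (conj (dW x) Vx).
rewrite /root_coef mulf_neq0 ?invr_neq0 //; apply: contraTneq (A0 Sx) => e.
move: h4; rewrite e expr0n /= qx => /esym/eqP; rewrite mulf_eq0 => /orP[/eqP ->|].
  by rewrite eqxx.
by rewrite expf_eq0 /= (negbTE n0).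
Qed.

Lemma root_coef_agree h h' a x : forms_agree_near X x a h h' ->
  root_coef h x = a * root_coef h' x.
Proof. by move=> /(_ _ (XW x) (dW x))/nbhs_singleton e; rewrite /root_coef e mulrA. Qed.

Lemma root_coef_PT V h ga (a b : R) : fourth_root X q V h -> V `<=` S -> continuous ga ->
  (forall s : R, a <= s <= b -> V (ga s)) ->
  PT (dev_sys Z) ga a b (root_coef h (ga a)) (root_coef h (ga b)).
Proof.
move=> fr VS c H; exists (fun s => root_coef h (ga s)); split=> // t0 t01.
have [d d0 K] := near_path c (root_coef_near fr VS (H _ t01)).
by exists d => // t _ /K.
Qed.

Lemma fourth_root_PT ga r : loop S ga -> fourth_root_along S X q ga r ->
  PT (dev_sys Z) ga 0 1 1 r.
Proof.
move=> [sp e01] [N [t [V [h [[t0 t1 tm] VP hP hN]]]]].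
have cg := simplex1_cont sp.
have t_ge0 j : (j <= N.+1)%N -> 0 <= t j.
  elim: j => [|j IH] jN; first by rewrite t0.
  by apply: le_trans (IH (ltnW jN)) (tm _ _).
have H k : (k <= N)%N -> PT (dev_sys Z) ga 0 (t k.+1) (root_coef (h 0%N) (ga 0))
    (root_coef (h k) (ga (t k.+1))).
  elim: k => [|k IH] kN; have [VS fr Vg] := VP _ kN.
    by have := root_coef_PT fr VS cg Vg; rewrite t0.
  have := IH (ltnW kN); have := root_coef_agree (hP k kN); rewrite mul1r => <- h1.
  exact: (PT_trans (t_ge0 _ (leq_trans kN (leqnSn N))) (tm _ kN) h1 (root_coef_PT fr VS cg Vg)).
have := H N (leqnn _); rewrite t1 (root_coef_agree hN) -e01 => h1.
have [VS fr Vg] := VP 0%N (leq0n _).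
have n0 : root_coef (h 0%N) (ga 0) != 0.
  by apply: (root_coef_neq0 fr VS); apply: Vg; rewrite t0 lexx -t0 tm.
by have := PT_scale (root_coef (h 0%N) (ga 0))^-1 h1; rewrite mulVf // mulrCA mulVf // mulr1.
Qed.

Lemma fourth_root_dZ x a : S x -> a ^+ 4 = A x ->
  fourth_root X q (dom (Z x)) (fun w y => a * dZ x w y).
Proof.
move=> Sx aA; split; first by have [] := isZ Sx.
  move=> w w' y Xw Xw' [[d d'] dz]; rewrite expr1 (dZ_law Sx Xw Xw' d d' dz).
  by rewrite mulrA.
move=> w y Xw [d dz]; have [h n0 ->] := qA Sx Xw d dz; split; last by rewrite exprMn aA.
apply/holP; apply: (@hol_near _ (fun t => a * derive1 (transition w (Z x)) t)).
  apply: filterS (icoord_near (Xc Xw) d (chart_dom_near (Xc Xw) d)) => t [_ e _].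
  by rewrite /dZ /= e.
exact: holM (hol_cst _ _) (hol_derive1 h).
Qed.

Lemma dZ_agree x x' y a : S x -> S x' -> dom (Z x) y -> dom (Z x') y ->
  forms_agree_near X y 1 (fun w (s : M) => a * drot (Z x) (Z x') y * dZ x' w s)
    (fun w (s : M) => a * dZ x w s).
Proof.
move=> Sx Sx' d d' w Xw dw.
have n1 := drot_near oS cov (dev Sx) (dev Sx') d d'.
have n2 : \forall s \near y, dom (Z x) s /\ dom (Z x') s.
  by apply: filterS2 (chart_dom_near (isZ Sx) d) (chart_dom_near (isZ Sx') d') => z ? ?.
apply: filterS3 n1 n2 (chart_dom_near (Xc Xw) dw) => z e [z1 z2] wz.
by rewrite mul1r (dZ_drot Sx Sx' Xw wz z1 z2) e mulrA.
Qed.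

Lemma fourth_root_exists ga : loop S ga -> exists r, fourth_root_along S X q ga r.
Proof.
move=> [sp e01]; have [N [t [m [[t0 t1 tm] H]]]] := path_pieces ZP sp.
pose r j := drot (Z (m j)) (Z (m j.+1)) (ga (t j.+1)).
have [a0 ha0] := root4_exists (A (m 0%N)).
(* The form a j d(Z (m j)) is the continuation of a0 d(Z (m 0)): passing to the next chart
   multiplies the coefficient by the rotation [r j]. *)
pose a := nat_rect (fun=> C) a0 (fun j aj => aj * r j).
have d1 j : (j <= N)%N -> dom (Z (m j)) (ga (t j.+1)).
  by move=> jN; have [_] := H j jN; apply; rewrite lexx tm.
have d2 j : (j < N)%N -> dom (Z (m j.+1)) (ga (t j.+1)).
  by move=> jN; have [_] := H j.+1 jN; apply; rewrite lexx tm.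
have Sm j : (j <= N)%N -> S (m j) by move=> /H[].
have aA j : (j <= N)%N -> a j ^+ 4 = A (m j).
  elim: j => [//|j IH] jN; have e := IH (ltnW jN); rewrite /= exprMn e.
  have [w Xw dw] := Xx (ga (t j.+1)).
  have S1 := Sm j (ltnW jN); have S2 := Sm j.+1 jN.
  have [_ n1 q1] := qA S1 Xw dw (d1 j (ltnW jN)).
  have [_ n2 q2] := qA S2 Xw dw (d2 j jN).
  apply: (mulIf (expf_neq0 4 n2)); rewrite -q2 q1 -mulrA -exprMn.
  by have := dZ_drot S1 S2 Xw dw (d1 j (ltnW jN)) (d2 j jN); rewrite /dZ => ->.
have d0 : dom (Z (m 0%N)) (ga 1).
  by rewrite -e01 -t0; have [_] := H 0%N (leq0n _); apply; rewrite lexx tm.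
have a00 : a0 != 0.
  by apply: contraTneq (A0 (Sm 0%N (leq0n _))) => e; rewrite -ha0 e expr0n eqxx.
(* The last form is rewritten in terms of d(Z (m 0)) at the end point of the loop, then compared
   with the initial coefficient a0. *)
exists (a N * drot (Z (m N)) (Z (m 0%N)) (ga 1) / a0).
exists N, t, (fun j => dom (Z (m j))), (fun j w y => a j * dZ (m j) w y); split.
- split; [exact: t0|exact: t1|exact: tm].
- move=> j jN; have Sj := Sm j jN; split.
  + by have [_ zS _] := dev Sj.
  + exact: fourth_root_dZ Sj (aA j jN).
  + by have [] := H j jN.
- by move=> j jN; exact: (dZ_agree (a j) (Sm _ (ltnW jN)) (Sm _ jN) (d1 _ (ltnW jN)) (d2 _ jN)).
move=> w Xw dw; have := d1 N (leqnn _); rewrite t1 => dN.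
have := dZ_agree (a N) (Sm N (leqnn _)) (Sm 0%N (leq0n _)) dN d0 Xw dw.
apply: filterS => y e; rewrite mul1r in e; apply: (etrans (esym e)).
exact: rescale _ _ _ a00.
Qed.

Lemma rotation_fourth_root ga r : loop S ga ->
  rotation_along S g ga r <-> fourth_root_along S X q ga r.
Proof.
move=> lg; have L := dev_sys_local oS cov ZP; have [sp _] := lg.
rewrite (rotation_along_PT oS cov ZP r lg); split; last exact: fourth_root_PT.
move=> h; have [r' hr'] := fourth_root_exists lg.
rewrite (PT_unique L (simplex1_cont sp) ler01 _ h (fourth_root_PT lg hr')) //.
by move=> t _; exact: simplex1_S sp.
Qed.

Lemma holonomy_monodromy chi :
  rotational_holonomy S g chi <-> fourth_root_monodromy S X q chi.
Proof.
by split=> -[H1 H]; split=> // ga lg; apply/(rotation_fourth_root _ lg); exact: H.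
Qed.

Lemma dev_sys_pow4 x : S x -> \forall y \near x, A x * dev_sys Z x y ^+ 4 = A y.
Proof.
move=> Sx; apply: filterS (near_dom_S (dev Sx) (domZ Sx)) => y [dy Sy].
have [w Xw dw] := Xx y; have [_ _ e] := qA Sx Xw dw dy.
have [_ n0 e'] := qA Sy Xw dw (domZ Sy); apply: (mulIf (expf_neq0 4 n0)).
have D := dZ_drot Sx Sy Xw dw dy (domZ Sy).
by rewrite -e' e -mulrA -exprMn; congr (_ * _ ^+ 4); exact: esym D.
Qed.

End FourthRoots.

(** * Charts composed with plane maps *)

Section ComposedCharts.
Context {R : realType} {M : topologicalType}.
Local Notation C := R[i].
Implicit Types (S D : set M) (w z : chart R M) (x y : M) (g : metric R M) (F G : C -> C)
  (t p q v : C).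

Definition comp_chart w D F G : chart R M := Chart D (F \o w) (icoord w \o G).

Definition local_homeo F G t := [/\ {for t, continuous F}, G (F t) = t,
  {for F t, continuous G} & \forall s \near F t, F (G s) = s].

Lemma comp_chart_is_chart w D F G : is_chart w -> open D -> D `<=` dom w ->
  (forall y, D y -> local_homeo F G (w y)) -> is_chart (comp_chart w D F G).
Proof.
move=> cw oD Dw H; have [_ _ K cc ci] := cw; split=> /=.
- exact: oD.
- rewrite openE => _ [y Dy <-]; have [_ e cG n] := H y Dy.
  have nD : \forall y' \near y, D y' by exact: open_nbhs_nbhs.
  have := icoord_near cw (Dw _ Dy) nD; rewrite -{1}e => /(@cont_near _ _ G (F (w y)) _ cG) n'.
  rewrite /interior /=; apply: filterS2 n n' => t FG [_ e1 d1].
  by exists (icoord w (G t)) => //=; rewrite e1 FG.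
- by move=> x Dx; have [_ -> _ _] := H x Dx; rewrite K //; exact: Dw.
- move=> x Dx; have [cF _ _ _] := H x Dx; apply: cont_comp; last exact: cF.
  by apply: cc; exact: Dw.
- move=> x Dx; have [_ e cG _] := H x Dx; apply: cont_comp; first exact: cG.
  by rewrite /= e; apply: ci; exact: Dw.
Qed.

Lemma comp_chart_trans w D F G y : is_chart w -> dom w y ->
  \forall t \near w y, F t = transition w (comp_chart w D F G) t.
Proof.
move=> cw d; have := icoord_near cw d (chart_dom_near cw d).
by apply: filterS => t [_ e _]; rewrite /transition /= e.
Qed.

Lemma comp_chart_transV w D F G y : is_chart w -> dom w y -> local_homeo F G (w y) ->
  \forall t \near F (w y), G t = transition (comp_chart w D F G) w t.
Proof.
move=> cw d [_ e cG _]; have := icoord_near cw d (chart_dom_near cw d).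
rewrite -{1}e => /(@cont_near _ _ G (F (w y)) _ cG).
by apply: filterS => t [_ k _]; rewrite /transition /= k.
Qed.

Lemma comp_chart_scp w D F G y p q : is_chart w -> dom w y -> local_homeo F G (w y) ->
  sm2 F (w y) -> sm2 G (F (w y)) -> rd F (w y) p q -> 0 < det2 p q ->
  scp w (comp_chart w D F G) y /\
  forall v, differential (transition w (comp_chart w D F G)) (w y) v = dl p q v.
Proof.
move=> cw d lh sF sG r d0; have n1 := @comp_chart_trans w D F G y cw d.
have n2 := @comp_chart_transV w D F G y cw d lh.
have r' := rd_near n1 r; split; last by move=> v; exact: rd_differential r'.
split; [exact: sm2_near n1 sF|exact: sm2_near n2 sG|].
by rewrite (rd_jacobian r').
Qed.

Lemma local_homeo_inverse F a : hol F a -> derive1 F a != 0 -> exists G : C -> C,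
  \forall t \near a, [/\ local_homeo F G t, hol F t, hol G (F t) & derive1 F t != 0].
Proof.
move=> hF n0; have [r r0 [G [h1 h2 h3 h4]]] := inverse_function hF n0; exists G.
apply/nbhsCP; exists r; first exact: r0.
move=> t ta; have [k1 k2] := h1 t ta; have k3 := h3 t ta; split.
- split; [exact: (@hol_continuous _ F t k1)|exact: (h2 t ta)|exact: (@hol_continuous _ G (F t) k3)|].
  have : nbhs (F t) (F @` [set z | nm (z - a) < r]).
    by apply: open_nbhs_nbhs; split; [exact: h4|exists t; [exact: ta|exact: erefl]].
  by apply: filterS => s [z za <-]; rewrite (h2 z za).
- exact: k1.
- exact: k3.
- exact: k2.
Qed.

Lemma open_restrict w x (P : M -> Prop) : is_chart w -> dom w x -> (\forall y \near x, P y) ->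
  exists D, [/\ open D, D `<=` dom w, D x & forall y, D y -> P y].
Proof.
move=> cw d n; exists (dom w `&` interior P); have [od _ _ _ _] := cw; split.
- by apply: openI => //; exact: open_interior.
- by move=> y [].
- by split=> //.
- by move=> y [_ /interior_subset].
Qed.

End ComposedCharts.

(** * Cone coordinates and conformal coordinates *)

Section ConeCharts.
Context {R : realType} {M : topologicalType}.
Local Notation C := R[i].
Implicit Types (S D : set M) (w z : chart R M) (x y : M) (g : metric R M) (theta b A : R).

(** The inverse of [rad b^-1 b]. It takes the coordinate of the cone of angle 2 pi b to the
    conformal coordinate, in which the metric is |z|^(2(b-1)) |dz|^2. *)
Definition radV b : C -> C := rad (powR b^-1 (- b^-1)) b^-1.

Lemma radVK b t : 0 < b -> radV b (rad b^-1 b t) = t.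
Proof. by move=> b0; apply: radK => //; rewrite invr_gt0. Qed.

Lemma radVA_gt0 b : 0 < b -> 0 < powR b^-1 (- b^-1).
Proof. by move=> b0; rewrite powR_gt0 // invr_gt0. Qed.

Lemma radKV b t : 0 < b -> rad b^-1 b (radV b t) = t.
Proof.
move=> b0; have bi : 0 < b^-1 by rewrite invr_gt0.
have := @radK _ (powR b^-1 (- b^-1)) b^-1 t (radVA_gt0 b0) bi.
rewrite invrK -powRrM mulNr mulrN opprK mulVf ?gt_eqF // powRr1 ?ltW //.
Qed.

Lemma rad_homeo b t : 0 < b -> local_homeo (rad b^-1 b) (radV b) t.
Proof.
move=> b0; have bi : 0 < b^-1 by rewrite invr_gt0.
split; [exact: rad_cont| exact: radVK| |].
  exact: rad_cont (radVA_gt0 b0) bi.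
by apply/nbhsCP; exists 1; [exact: ltr01|move=> s _; exact: radKV].
Qed.

Lemma radV_homeo b t : 0 < b -> local_homeo (radV b) (rad b^-1 b) t.
Proof.
move=> b0; have bi : 0 < b^-1 by rewrite invr_gt0.
split; [|exact: radKV|exact: rad_cont|].
  exact: rad_cont (radVA_gt0 b0) bi.
by apply/nbhsCP; exists 1; [exact: ltr01|move=> s _; exact: radVK].
Qed.

Lemma radV_neq0 b t : 0 < b -> t != 0 -> radV b t != 0.
Proof. by move=> b0 t0; apply: rad_neq0 => //; exact: radVA_gt0. Qed.

Lemma radV0 b : radV b 0 = 0. Proof. exact: rad0. Qed.

Lemma rad_rd_det A b t : 0 < A -> 0 < b -> t != 0 -> exists p q,
  [/\ rd (rad A b) t p q, 0 < det2 p q & forall v, dl p q v = rad_diff A b t v].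
Proof.
move=> A0 b0 t0; have r := rd_rad A b t0; do 2! eexists; split; first exact: r.
  by have := jac_rad A0 b0 t0; rewrite (rd_jacobian r).
by move=> v; exact: rad_diffE.
Qed.

Lemma cone_of_conformal S g z theta p : open S -> covered S g -> is_chart z -> dom z p ->
  z p = 0 -> 0 < theta -> dom z `\ p `<=` S ->
  let b := theta / (2 * pi) in
  ~ S p -> (forall x, S x -> dom z x -> conformal_at g z (fun y => powR (sqmod (z y)) (b - 1)) x) ->
  conical_singularity S g p theta.
Proof.
move=> oS [cg _] cz dp zp th0 zS b Sp H; have b0 : 0 < b by rewrite divr_gt0 // pi2_gt0.
have bi : 0 < b^-1 by rewrite invr_gt0.
split; first exact: th0.
set w := comp_chart z (dom z) (rad b^-1 b) (radV b).
have cw : is_chart w.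
  apply: comp_chart_is_chart => //; [by have [] := cz|move=> y _; exact: rad_homeo].
exists w; split; [exact: cw|exact: dp|by rewrite /= zp rad0|exact: zS|].
apply/(metric_in_coordinateP _ oS cw cg) => x dx Sx.
have xp : x != p by apply: contra_notN Sp => /eqP <-.
have zx0 : z x != 0.
  apply: contraNneq xp => e; apply/eqP.
  by rewrite -(chart_icoordK cz dx) e -zp chart_icoordK.
have [u [v [r d0 E]]] := rad_rd_det bi b0 zx0.
have rz : rad b^-1 b (z x) != 0 by exact: rad_neq0.
have [s Ds] := comp_chart_scp (dom z) cz dx (rad_homeo (z x) b0) (sm2_rad _ _ zx0)
  (sm2_rad _ _ rz) r d0.
apply: (mic_change cg cz cw dx dx (H x Sx dx) s) => t.
by rewrite Ds E /= (cone_sqlen_rad _ th0 zx0).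
Qed.

Lemma conformal_of_cone S g w theta p : open S -> covered S g -> is_chart w -> dom w p ->
  w p = 0 -> 0 < theta -> dom w `\ p `<=` S -> ~ S p ->
  metric_in_coordinate S g w (fun x v => cone_sqlen theta (w x) v) ->
  let b := theta / (2 * pi) in let z := comp_chart w (dom w) (radV b) (rad b^-1 b) in
  [/\ is_chart z, z p = 0 &
   forall x, S x -> dom w x -> [/\ z x != 0, scp w z x &
     conformal_at g z (fun y => powR (sqmod (z y)) (b - 1)) x]].
Proof.
move=> oS [cg _] cw dp wp th0 wS Sp H b z; have b0 : 0 < b by rewrite divr_gt0 // pi2_gt0.
have bi : 0 < b^-1 by rewrite invr_gt0.
have cz : is_chart z.
  apply: comp_chart_is_chart => //; [by have [] := cw|move=> y _; exact: radV_homeo].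
split; [exact: cz|by rewrite /z /= wp radV0|move=> x Sx dx].
move/(metric_in_coordinateP _ oS cw cg): H => /(_ x dx Sx) m.
have xp : x != p by apply: contra_notN Sp => /eqP <-.
have wx0 : w x != 0.
  apply: contraNneq xp => e; apply/eqP.
  by rewrite -(chart_icoordK cw dx) e -wp chart_icoordK.
have zx0 : z x != 0 by exact: radV_neq0.
have [p1 [q1 [r1 d1 _]]] := rad_rd_det (radVA_gt0 b0) bi wx0.
have [s _] := comp_chart_scp (dom w) cw dx (radV_homeo (w x) b0) (sm2_rad _ _ wx0)
  (sm2_rad _ _ zx0) r1 d1.
split; [exact: zx0|exact: s|apply: (mic_change cg cw cz dx dx m s) => v].
(* [cone_sqlen_rad] gives the length of the image under [rad] of a vector in the coordinate z; the
   vector v, given in w, is therefore written as the image of its expression v' in z. *)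
have [_ i2] := scp_sym cw cz dx dx s.
have [p2 [q2 [r2 _ E2]]] := rad_rd_det bi b0 zx0.
have r3 : rd (transition z w) (z x) p2 q2.
  apply: rd_near r2; exact: (comp_chart_transV (dom w) cw dx (radV_homeo (w x) b0)).
set v' := differential (transition w z) (w x) v.
rewrite -(i2 v) -/v' (rd_differential _ r3) E2 -(radKV (w x) b0).
exact: cone_sqlen_rad th0 zx0.
Qed.

End ConeCharts.

(** * From quartic differentials to flat metrics *)

Lemma nm_expz (R : realType) (k : R[i]) (m : int) : nm (k ^ m) = nm k ^ m.
Proof. by case: m => j; rewrite ?NegzE -?exprnN -?exprnP ?nmV nmX. Qed.

(** Here |k|^(m/2) is the power m/4 of [sqmod k], and m/4 = b - 1 for the cone of angle 2 pi b = (m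
    + 4) pi / 2. *)
Lemma sqrt_nm_cone (R : realType) (u k : R[i]) (m : int) : k != 0 ->
  Num.sqrt (nm (u ^+ 4 * k ^ m)) = powR (sqmod k) ((m + 4)%:~R / 4 - 1) * sqmod u.
Proof.
move=> k0; rewrite nmM nmX sqrtrM ?exprn_ge0 ?nm_ge0 // mulrC; congr (_ * _).
  rewrite nm_expz -(powR_intmul m (nm_ge0 k)) -(powR12_sqrt (powR_ge0 _ _)) -powRrM -nm_sqr.
  by rewrite -(powR_mulrn 2 (nm_ge0 k)) -powRrM; congr powR; rewrite rmorphD /=; field.
rewrite (_ : 4%N = (2 * 2)%N) // exprM sqrtr_sqr.
by rewrite ger0_norm ?exprn_ge0 ?nm_ge0 // nm_sqr.
Qed.

Lemma cone_angle (R : realType) (a : R) : a * (pi / 2) / (2 * pi) = a / 4.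
Proof. by have := lt0r_neq0 (pi_gt0 R); move: pi => p p0; field. Qed.

Section QuarticMetric.
Context {R : realType} {M : topologicalType}.
Local Notation C := R[i].
Context (S : set M) (X : set (chart R M)) (q : chart R M -> M -> C)
  (oS : open S) (Xc : forall w, X w -> is_chart w) (Xx : forall x, exists2 w, X w & dom w x)
  (Xh : forall w w' x, X w -> X w' -> dom w x -> dom w' x -> hol (transition w w') (w x))
  (law : differential_law 4 X setT q)
  (qreg : forall x w, S x -> X w -> dom w x -> exists h : C -> C,
     [/\ hol h (w x), h (w x) != 0 & \forall y \near x, q w y = h (w y)]).
Implicit Types (w z phi psi : chart R M) (x y : M).

Let g := abs_sqrt_metric X q.

Definition lam w x : R := Num.sqrt (nm (q w x)).

Lemma abs_sqlen w x v : sqlen g w x v = lam w x * sqmod v.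
Proof. by rewrite /sqlen /= normc_nm -/(lam w x) /sqmod; ring. Qed.

Lemma abs_covered : covered S g.
Proof. by split=> [|x _]; [exact: Xc|exact: Xx]. Qed.

Lemma quartic_neq0 w x : S x -> X w -> dom w x -> q w x != 0.
Proof. by move=> Sx Xw d; have [h [_ h0 /nbhs_singleton ->]] := qreg Sx Xw d. Qed.

Lemma lam_gt0 w x : S x -> X w -> dom w x -> 0 < lam w x.
Proof. by move=> Sx Xw d; rewrite sqrtr_gt0 nm_gt0 quartic_neq0. Qed.

Lemma abs_scp phi w x : X phi -> X w -> dom phi x -> dom w x ->
  scp phi w x /\ forall v, lam phi x * sqmod v =
    lam w x * sqmod (differential (transition phi w) (phi x) v).
Proof.
move=> Xp Xw d d'; have h := Xh Xp Xw d d'; have h' := Xh Xw Xp d' d.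
have [s _] := scp_hol (Xc Xp) (Xc Xw) d d' h h'; split; first exact: s.
move=> v; rewrite (rd_differential _ (hol_cder h)) sqmod_dl_cder mulrA; congr (_ * _).
rewrite /lam (law Xp Xw (conj (conj d d') I)) nmM nmX sqrtrM ?nm_ge0 //; congr (_ * _).
rewrite (_ : 4%N = (2 * 2)%N) // exprM sqrtr_sqr ger0_norm ?exprn_ge0 ?nm_ge0 //.
exact: nm_sqr.
Qed.

Lemma abs_conformal w x : X w -> dom w x -> conformal_at g w (lam w) x.
Proof.
move=> Xw d phi Xp dp; have [s e] := abs_scp Xp Xw dp d.
by split; [exact: s|move=> v; rewrite abs_sqlen e].
Qed.

Lemma quartic_root w x : S x -> X w -> dom w x -> exists r : C -> C,
  [/\ hol r (w x), r (w x) != 0 & \forall y \near x, r (w y) ^+ 4 = q w y].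
Proof.
move=> Sx Xw d; have [h [hh h0 n]] := qreg Sx Xw d.
have [r [hr n']] := hol_root (isT : (0 < 4)%N) hh h0.
exists r; split; first exact: hr.
- apply: contraNneq h0 => e; rewrite -(nbhs_singleton n') e expr0n; exact: eqxx.
- by apply: filterS2 n (chart_near (Xc Xw) d n') => y -> ->.
Qed.

Lemma lam_root w x (r : C) : r ^+ 4 = q w x -> lam w x = sqmod r.
Proof.
move=> e; rewrite /lam -e nmX (_ : 4%N = (2 * 2)%N) // exprM sqrtr_sqr.
by rewrite ger0_norm ?exprn_ge0 ?nm_ge0 // nm_sqr.
Qed.

(** The square root and the modulus disappear near x: for a local holomorphic fourth root r of q,
    [lam] is |r|^2. *)
Lemma sm_lam w x : S x -> X w -> dom w x -> sm (lam w \o icoord w) (w x).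
Proof.
move=> Sx Xw d; have [r [hr r0 n]] := quartic_root Sx Xw d.
have [s1 s2] := hol_sm2 hr; apply: sm_near (smD (smM s1 s1) (smM s2 s2)).
apply: filterS (icoord_near (Xc Xw) d n) => t [_ e e4].
by rewrite /= (lam_root e4) e /sqmod !expr2.
Qed.

Lemma abs_riemannian (O : set (chart R M)) :
  (forall o w, O o -> X w -> oriented_compat S o w) -> riemannian_metric O S g.
Proof.
move=> HO; split.
- split; [exact: Xc|by move=> x _; exact: Xx|move=> phi psi Xp Xs].
  apply/(smooth_compatP oS (Xc Xp) (Xc Xs)) => x [[d d'] _].
  by have [] := abs_scp Xp Xs d d'.
- exact: HO.
- move=> phi Xp; have oD : open (phi @` (dom phi `&` S)).
    apply: (chart_open_image (Xc Xp)); last by move=> x [].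
    by apply: openI => //; have [] := Xc Xp.
  have sl : smooth (phi @` (dom phi `&` S)) (lam phi \o icoord phi).
    by apply/(smoothP _ oD) => _ [x [d Sx] <-]; exact: sm_lam Sx Xp d.
  have E : (fun x => Num.sqrt (ComplexField.Normc.normc (q phi x))) = lam phi.
    by apply/funext => x; rewrite normc_nm.
  split; rewrite /= ?E //.
  by apply/(smoothP _ oD) => t _; exact: sm_cst.
- move=> phi x Xp [d Sx] /=; rewrite normc_nm -/(lam phi x); have l := lam_gt0 Sx Xp d.
  by split=> //; rewrite expr0n /= mulr_gt0.
- move=> psi Xs; apply/(metric_in_coordinateP _ oS (Xc Xs) abs_covered.1) => x d Sx phi Xp dp.
  have [s e] := abs_scp Xp Xs dp d.
  by split; [exact: s|move=> v; rewrite !abs_sqlen e].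
Qed.

(** The chart is a primitive of a local fourth root of q, so that q = (dz)^4. The factor 1 is the
    value of the section A in the comparison of fourth roots with developing charts. *)
Lemma adapted_chart x : S x -> exists z, [/\ developing_chart S g z, dom z x &
  forall w y, X w -> dom w y -> dom z y ->
    [/\ hol (transition w z) (w y), derive1 (transition w z) (w y) != 0 &
     q w y = 1 * derive1 (transition w z) (w y) ^+ 4]].
Proof.
move=> Sx; have [w Xw d] := Xx x; have cw := Xc Xw.
have [r [hr r0 n4]] := quartic_root Sx Xw d; have [F nF] := hol_primitive hr.
have hF : hol F (w x) by apply: filterS nF => t h; exists (r t).
have F0 : derive1 F (w x) != 0 by rewrite (cder_derive1 (nbhs_singleton nF)).
have [G nG] := local_homeo_inverse hF F0.
have nS : \forall y \near x, S y by exact: open_nbhs_nbhs.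
have n1 : \forall y \near x, [/\ local_homeo F G (w y), hol F (w y), hol G (F (w y)) &
    derive1 F (w y) != 0] /\ q w y = derive1 F (w y) ^+ 4 /\ S y.
  have m1 := chart_near cw d nF; have m2 := chart_near cw d nG.
  apply: filterS2 (filterI m1 m2) (filterI n4 nS) => y [k1 k2] [k3 Sy].
  by split; [exact: k2|rewrite (cder_derive1 k1) k3].
have [D [oD Dw Dx HD]] := open_restrict cw d n1.
have lh y : D y -> local_homeo F G (w y) by move=> /HD[[]].
pose z := comp_chart w D F G; have cz : is_chart z by exact: comp_chart_is_chart.
have hT y : D y -> hol (transition w z) (w y) /\ derive1 (transition w z) (w y) = derive1 F (w y).
  move=> Dy; have [[_ k _ _] _] := HD y Dy.
  have n2 := comp_chart_trans D F G cw (Dw y Dy); split; first exact: hol_near n2 k.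
  exact: cder_derive1 (rd_near n2 (hol_cder k)).
exists z; split; last first.
- move=> w' y Xw' d' Dy; have [k1 k2] := hT y Dy; have [[_ _ _ k3] [k4 Sy]] := HD y Dy.
  have [l1 l2] := transition_chain (Xc Xw') cw d' (Dw y Dy) (Xh Xw' Xw d' (Dw y Dy)) k1.
  split; [exact: l1| |].
  + rewrite l2 k2; apply: mulf_neq0 k3 _.
    have [_] := scp_hol (Xc Xw') cw d' (Dw y Dy) (Xh Xw' Xw d' (Dw y Dy)) (Xh Xw Xw' (Dw y Dy) d').
    exact.
  + have L := law Xw' Xw (conj (conj d' (Dw y Dy)) I).
    by rewrite k4 -exprMn -k2 -l2 in L; rewrite mul1r; exact: L.
- exact: Dx.
split; [exact: cz|by move=> y /HD[_ []]|].
apply/(metric_in_coordinateP _ oS cz abs_covered.1) => y Dy Sy.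
have [[k0 k1 k2 k3] [k4 _]] := HD y Dy; have dy := Dw y Dy.
have d2 : 0 < det2 (derive1 F (w y)) ('i%C * derive1 F (w y)).
  by rewrite det2_cder sqmod_gt0.
have [s Ds] := comp_chart_scp D cw dy k0 (hol_sm2 k1) (hol_sm2 k2) (hol_cder k1) d2.
apply: (mic_change abs_covered.1 cw cz dy Dy (abs_conformal Xw dy) s) => v.
by rewrite Ds sqmod_dl_cder (lam_root (esym k4)).
Qed.

Lemma abs_holonomy : (exists2 chi, rotational_holonomy S g chi & valued_in_mu4 S chi) /\
  forall chi, rotational_holonomy S g chi <-> fourth_root_monodromy S X q chi.
Proof.
have /choice[Z HZ] : forall x, exists z, S x -> [/\ developing_chart S g z, dom z x &
    forall w y, X w -> dom w y -> dom z y ->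
    [/\ hol (transition w z) (w y), derive1 (transition w z) (w y) != 0 &
     q w y = 1 * derive1 (transition w z) (w y) ^+ 4]].
  move=> x.
  have [Sx|nS] := pselect (S x); first by have [z hz] := adapted_chart Sx; exists z.
  by have [w _ _] := Xx x; exists w.
have ZP x : S x -> developing_chart S g (Z x) /\ dom (Z x) x by move=> /HZ[].
have qA x w y : S x -> X w -> dom w y -> dom (Z x) y ->
    [/\ hol (transition w (Z x)) (w y), derive1 (transition w (Z x)) (w y) != 0 &
     q w y = 1 * derive1 (transition w (Z x)) (w y) ^+ 4].
  by move=> Sx; have [_ _] := HZ x Sx; exact.
have A0 x : S x -> (1 : C) != 0 by move=> _; exact: oner_neq0.
split; last first.
  by move=> chi; exact: (holonomy_monodromy oS abs_covered ZP Xc Xx Xh A0 qA).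
exists (char_of (dev_sys Z)); first exact: (rotational_holonomy_exists oS abs_covered ZP).
apply: (char_of_mu (dev_sys_local oS abs_covered ZP)) => x Sx.
(* For A = 1 this says that the rotations between adapted charts are fourth roots of unity. *)
have := dev_sys_pow4 oS abs_covered ZP Xc Xx qA Sx.
by apply: filterS => y; rewrite mul1r.
Qed.

Lemma abs_cone p (m : int) w h : X w -> dom w p -> -4 < m -> ~ S p ->
  (\forall y \near p, y != p -> S y) -> hol h (w p) -> h (w p) != 0 ->
  (\forall y \near p, q w y = (w y - w p) ^ m * h (w y)) ->
  conical_singularity S g p ((m + 4)%:~R * (pi / 2)).
Proof.
move=> Xw d m4 Sp nS hh h0 nq; have cw := Xc Xw.
have [r [hr n4]] := hol_root (isT : (0 < 4)%N) hh h0.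
pose f := r \o (fun t => w p + t).
(* The hypothesis m > -4 enters here: [cone_coordinate] is used with n = m + 4, which must be
   positive. *)
have n_gt0 : (0 < absz (m + 4)%R)%N by rewrite absz_gt0; lia.
have nE : `|(m + 4)%R|%N%:Z - 4 = m by lia.
have hf : hol f 0.
  apply: (@hol_comp _ (fun t => w p + t) r 0 (holD (hol_cst (w p) 0) (hol_id 0))).
  by rewrite addr0.
have f0 : f 0 != 0.
  rewrite /f /= addr0; apply: contraNneq h0 => e.
  rewrite -(nbhs_singleton n4) e expr0n; exact: eqxx.
have [ze [hz z0 dz0 nz]] := cone_coordinate n_gt0 hf f0; rewrite nE in nz.
(* [cone_coordinate] is stated at 0, while w p is arbitrary. *)
pose tau t := t - w p.
have htau t : hol tau t := holB (hol_id t) (hol_cst (w p) t).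
pose F := ze \o tau.
have dF t : hol ze (tau t) -> hol F t /\ derive1 F t = derive1 ze (tau t).
  move=> k; split; first exact: hol_comp (htau t) k.
  apply: cder_derive1; apply: cder_eq (cder_comp (cderB (cder_id t) (cder_cst (w p) t)) (hol_cder k)) _.
  by rewrite subr0 mulr1.
have taup : tau (w p) = 0 by rewrite /tau subrr.
have [hF dFp] := dF (w p) (eq_ind_r (hol ze) hz taup).
have F0 : derive1 F (w p) != 0 by rewrite dFp taup.
have [G nG] := local_homeo_inverse hF F0.
have ntau (P : C -> Prop) : (\forall t \near (0 : C), P t) -> \forall t \near w p, P (tau t).
  by move=> k; apply: (cont_near (hol_continuous (htau (w p)))); rewrite taup.
have n1 : \forall y \near p, [/\ local_homeo F G (w y), hol F (w y), hol G (F (w y)) &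
    derive1 F (w y) != 0] /\ (y != p -> S y) /\
    (w y != w p -> q w y = derive1 F (w y) ^+ 4 * F (w y) ^ m).
  have m1 := chart_near cw d nG.
  have m2 := chart_near cw d (nbhsC_and n4 (nbhsC_and (ntau _ nz) (ntau _ (hol_open hz)))).
  apply: filterS2 (filterI m1 m2) (filterI nS nq) => y [k1 [k2 [k3 k4]]] [k5 k6].
  split; [exact: k1|split; [exact: k5|move=> yp]].
  have [_ ->] := dF (w y) k4; rewrite k6 -k2.
  have -> : r (w y) = f (tau (w y)) by rewrite /f /tau /= addrCA subrr addr0.
  by rewrite -[w y - w p]/(tau (w y)) -k3 // subr_eq0.
have [D [oD Dw Dp HD]] := open_restrict cw d n1.
have lh y : D y -> local_homeo F G (w y) by move=> /HD[[]].
pose z := comp_chart w D F G; have cz : is_chart z by exact: comp_chart_is_chart.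
have Fp : F (w p) = 0 by rewrite /F /= taup.
have th0 : 0 < (m + 4)%:~R * (pi / 2) :> R.
  by rewrite mulr_gt0 ?divr_gt0 ?pi_gt0 // ltr0z; lia.
apply: (cone_of_conformal oS abs_covered cz Dp Fp th0 _ Sp).
  by move=> y [Dy /= /eqP yp]; have [_ [k _]] := HD y Dy; exact: k.
move=> y Sy Dy; have [[k0 k1 k2 k3] [_ k4]] := HD y Dy; have dy := Dw y Dy.
have wyp : w y != w p.
  apply: contra_notN Sp => /eqP e.
  by rewrite -(chart_icoordK cw d) -e (chart_icoordK cw dy).
have d2 : 0 < det2 (derive1 F (w y)) ('i%C * derive1 F (w y)).
  by rewrite det2_cder sqmod_gt0.
have [s Ds] := comp_chart_scp D cw dy k0 (hol_sm2 k1) (hol_sm2 k2) (hol_cder k1) d2.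
apply: (mic_change abs_covered.1 cw cz dy Dy (abs_conformal Xw dy) s) => v.
rewrite Ds sqmod_dl_cder mulrA; congr (_ * _); rewrite /lam (k4 wyp).
rewrite cone_angle.
apply: sqrt_nm_cone; apply: contra wyp => /eqP e.
have [_ l1 _ _] := k0; have [_ l2 _ _] := lh p Dp.
by rewrite -l1 e -Fp l2.
Qed.

End QuarticMetric.

Section QuarticPart.
Context {R : realType} {M : topologicalType}.
Local Notation C := R[i].

Lemma cone_points_open n (c : 'I_n -> M) : hausdorff_space M -> open (~` range c).
Proof.
move=> H; apply: closed_openC; apply: (accessible_finite_set_closed.1 (@hausdorff_accessible M H)).
exact: finite_image finite_finset.
Qed.

Lemma cone_points_near n (c : 'I_n -> M) p : hausdorff_space M ->
  \forall y \near p, y != p -> (~` range c) y.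
Proof.
move=> H; have : nbhs p (~` (range c `\ p)).
  apply: open_nbhs_nbhs; split; last by move=> [_ /=]; apply.
  apply: closed_openC; apply: (accessible_finite_set_closed.1 (@hausdorff_accessible M H)).
  by apply: (@sub_finite_set _ _ (range c)) (finite_image _ finite_finset) => y [].
by apply: filterS => y k yp cy; apply: k; split=> // /eqP; rewrite (negbTE yp).
Qed.

Lemma divisor_at n (c : 'I_n -> M) m i : injective c -> divisor c m (c i) = m i.
Proof.
move=> inj; rewrite /divisor (big_pred1 i) // => j.
by rewrite /= (inj_eq inj).
Qed.

Lemma divisor_off n (c : 'I_n -> M) m p : (~` range c) p -> divisor c m p = 0.
Proof.
by move=> np; rewrite /divisor big1 // => i /eqP e; case: np; exists i.
Qed.

Lemma quartic_part (O : set (chart R M)) n (c : 'I_n -> M) X q (m : 'I_n -> int) :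
  hausdorff_space M -> injective c -> complex_structure O X ->
  meromorphic_section 4 X q (divisor c m) -> (forall i, -4 < m i) ->
  quarter_flat_cone_metric O c (abs_sqrt_metric X q) (fun i => (m i + 4)%:~R * (pi / 2))
  /\ (forall chi, rotational_holonomy (~` range c) (abs_sqrt_metric X q) chi <->
        fourth_root_monodromy (~` range c) X q chi).
Proof.
move=> H inj [[Xc Xx Xh0] XO] [law mer] m4; have oS := cone_points_open c H.
have Xx' x : exists2 w, X w & dom w x by exact: Xx.
have Xh w w' x : X w -> X w' -> dom w x -> dom w' x -> hol (transition w w') (w x).
  by move=> Xw Xw' d d'; apply/holP; apply: Xh0 Xw Xw' _ (conj d d').
have qreg x w : (~` range c) x -> X w -> dom w x -> exists h : C -> C,
    [/\ hol h (w x), h (w x) != 0 & \forall y \near x, q w y = h (w y)].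
  move=> Sx Xw d; have [h [/holP k1 k2 k3]] := mer w x Xw d; exists h.
  split; [exact: k1|exact: k2|apply: filterS k3 => y ->].
  by rewrite (divisor_off m Sx) expr0z mul1r.
have [hol_ex iff] := abs_holonomy oS Xc Xx' Xh law qreg.
split; last exact: iff.
split; [split| |exact: hol_ex].
- split.
    apply: (abs_riemannian oS Xc Xx' Xh law qreg) => o w Oo Xw x [d _].
    exact: XO Oo Xw x (conj d I).
  by move=> x Sx; have [z [k1 k2 _]] := adapted_chart oS Xc Xx' Xh law qreg Sx; exists z.
- move=> i; have [w Xw d] := Xx' (c i); have [h [/holP k1 k2 k3]] := mer w (c i) Xw d.
  rewrite (divisor_at m i inj) in k3.
  apply: (abs_cone oS Xc Xx' Xh law Xw d (m4 i) _ (cone_points_near c (c i) H) k1 k2 k3).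
  by apply; exists i.
- by move=> i; exists (m i + 4).
Qed.

End QuarticPart.

(** * From flat metrics to quartic differentials *)

(** A path in the punctured disk joins the point e / 2 to t: in polar coordinates, both the radius
    and the angle are affine in time. *)
Lemma punctured_cst (R : realType) (f : R[i] -> R[i]) (e : R) : 0 < e ->
  (forall t : R[i], t != 0 -> nm t < e -> \forall s \near t, f s = f t) ->
  exists K, forall t : R[i], t != 0 -> nm t < e -> f t = K.
Proof.
move=> e0 H; have e2 : 0 < e / 2 by exact: half_pos.
exists (f (e / 2)%:C) => t t0 te; have [a ta] := polar_exists t0.
have nt : 0 < nm t by rewrite nm_gt0.
pose ga (s : R) : R[i] := ((nm t - e / 2) * s + e / 2)%:C * expi (a * s + 0).
have cga (s : R) : {for s, continuous ga}.
  have c1 := (@contRC _ _ _ s).1 (@cont_affine _ (nm t - e / 2) (e / 2) s).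
  apply: (@contM _ _ _ (fun s : R => expi (a * s + 0)) s c1).
  apply: (@cont_comp _ _ _ (fun s : R => a * s + 0) (@expi R)); first exact: cont_affine.
  exact: expi_cont.
have g0 : ga 0 = (e / 2)%:C by rewrite /ga !mulr0 !add0r expi0 mulr1.
have g1 : ga 1 = t by rewrite /ga !mulr1 subrK addr0 -ta.
rewrite -g0 -g1; apply: (@itv_ind _ (fun s s' => f (ga s') = f (ga s)) 0 1 ler01).
  by move=> x y z _ _ _ _ h1 h2; rewrite h2 h1.
move=> s s01; have rho0 : 0 < (nm t - e / 2) * s + e / 2 < e by nra.
have ngs : nm (ga s) = (nm t - e / 2) * s + e / 2.
  by rewrite /ga nmM nmR nm_expi mulr1 ger0_norm //; lra.
have gs0 : ga s != 0 by rewrite -nm_gt0 ngs; lra.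
have gse : nm (ga s) < e by rewrite ngs; lra.
have /nbhsRP[d d0 D] : \forall s' \near s, f (ga s') = f (ga s).
  exact: (cont_near (cga s) (H _ gs0 gse)).
by exists d => // x y _ _ _ /D -> /D ->.
Qed.

(** * Conformal charts and the quartic differential of a flat metric *)

Section ConformalCharts.
Context {R : realType} {M : topologicalType}.
Local Notation C := R[i].
Context (S : set M) (g : metric R M) (oS : open S) (cov : covered S g).
Implicit Types (w z o phi : chart R M) (x y p : M).

Definition conformal_chart w := is_chart w /\ exists la : M -> R,
  forall y, S y -> dom w y -> 0 < la y /\ conformal_at g w la y.

Lemma dev_conformal_chart z : developing_chart S g z -> conformal_chart z.
Proof.
by move=> dz; split; [case: dz|exists (fun=> 1); exact: dev_conformal oS cov dz].
Qed.

Lemma conformal_chart_hol w w' x : conformal_chart w -> conformal_chart w' -> S x ->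
  dom w x -> dom w' x -> hol (transition w w') (w x).
Proof.
move=> [cw [la H]] [cw' [la' H']] Sx d d'.
by have [] := conformal_hol oS cov cw cw' Sx d d' H H'.
Qed.

Lemma conformal_derive_neq0 w w' x : conformal_chart w -> conformal_chart w' -> S x ->
  dom w x -> dom w' x -> derive1 (transition w w') (w x) != 0.
Proof.
move=> c c' Sx d d'; have h := conformal_chart_hol c c' Sx d d'.
have h' := conformal_chart_hol c' c Sx d' d.
by have [_ n0] := scp_hol c.1 c'.1 d d' h h'; exact: n0.
Qed.

Lemma transition_cont_near phi psi x : is_chart phi -> is_chart psi -> dom phi x -> dom psi x ->
  \forall t \near phi x, {for t, continuous (@transition R M phi psi)}.
Proof.
move=> cp cs d d'; have := icoord_near cp d (chart_dom_near cs d').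
by apply: filterS => t [k1 k2 k3]; rewrite -k2; exact: (@transition_cont _ _ _ _ _ cp cs k1 k3).
Qed.

(** The transition from o to w passes through the chart phi of the metric: the first factor has
    local degree one and the second a positive Jacobian determinant. *)
Lemma conformal_orient o phi w x : is_chart o -> mcharts g phi -> oriented_compat S o phi ->
  conformal_chart w -> S x -> dom o x -> dom phi x -> dom w x ->
  orientation_preserving_at (transition o w) (o x).
Proof.
move=> co gp op [cw [la H]] Sx d dp dw; have cp := cov.1 _ gp.
have [_ m] := H x Sx dw; have [[s1 s2 j] _] := m phi gp dp.
have [p [q [r jE _]]] := sm2_diff s1; rewrite jE in j.
have e := transition_val phi co d.
apply: (orient_near (transition_comp w co cp d dp)).
apply: (@orient_comp _ _ _ _ p q (op x (conj (conj d dp) Sx)) (transition_cont_near co cp d dp)).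
- by rewrite e; exact: transition_cont_near cp cw dp dw.
- by rewrite e; exact: r.
- exact: j.
Qed.

(** Transition maps are injective and continuous, so the local degree at p can be read off at the
    neighbouring points. *)
Lemma orient_at_isolated o w p : is_chart o -> is_chart w -> dom o p -> dom w p ->
  (forall y, dom o y -> dom w y -> y != p -> orientation_preserving_at (transition o w) (o y)) ->
  orientation_preserving_at (transition o w) (o p).
Proof.
move=> co cw d d' H; have /nbhsCP[e e0 E] := icoord_near co d (chart_dom_near cw d').
apply: (orient_isolated e0).
- by move=> t /E[k1 k2 k3]; rewrite -k2; exact: (@transition_cont _ _ _ _ _ co cw k1 k3).
- move=> t t' /E[k1 k2 k3] /E[l1 l2 l3] f; rewrite -k2 -l2; congr (o _).
  by rewrite -(chart_icoordK cw k3) -(chart_icoordK cw l3); congr (icoord w _).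
- move=> t /E[k1 k2 k3] tp; rewrite -k2; apply: (H _ k1 k3).
  by apply: contraNneq tp => ep; rewrite -k2 ep.
Qed.

(** Allows the charts [Z x] to be shrunk until the relation between A y and A x holds on their whole
    domain. *)
Lemma restrict_dev z D : developing_chart S g z -> open D -> D `<=` dom z ->
  developing_chart S g (comp_chart z D id id).
Proof.
move=> [cz zS H] oD Dz.
have cz' : is_chart (comp_chart z D id id).
  apply: comp_chart_is_chart => // y _; split=> //; try exact: cvg_id.
  by apply/nbhsCP; exists 1; [exact: ltr01|move=> s _].
split; [exact: cz'|by move=> y /Dz/zS|].
apply/(metric_in_coordinateP _ oS cz' cov.1) => y Dy Sy.
by have /(metric_in_coordinateP _ oS cz cov.1)/(_ y (Dz y Dy) Sy) := H.
Qed.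

Context (Z : M -> chart R M) (ZP : forall x, S x -> developing_chart S g (Z x) /\ dom (Z x) x)
  (A : M -> C) (A1 : forall x, S x -> nm (A x) = 1)
  (AZ : forall x, S x -> \forall y \near x, A y = A x * dev_sys Z x y ^+ 4).

Let confZ x : S x -> conformal_chart (Z x).
Proof. by move=> /ZP[dz _]; exact: dev_conformal_chart. Qed.

(* The coefficient in [w] of A (dz)^4, for developing charts z. *)
Definition quartic w x : C := A x * drot (Z x) w x ^+ 4.

Lemma quartic_law w w' x : conformal_chart w -> conformal_chart w' -> S x ->
  dom w x -> dom w' x -> quartic w x = quartic w' x * derive1 (transition w w') (w x) ^+ 4.
Proof.
move=> c c' Sx d d'; have h := conformal_chart_hol c c' Sx d d'.
have [_ dz] := ZP Sx; have h' := conformal_chart_hol c' (confZ Sx) Sx d' dz.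
have [_ e] := transition_chain c.1 c'.1 d d' h h'.
by rewrite /quartic -[RHS]mulrA -exprMn; congr (_ * _ ^+ 4); exact: e.
Qed.

Lemma quartic_dev w x y : conformal_chart w -> S x -> S y -> dom w y -> dom (Z x) y ->
  A y = A x * dev_sys Z x y ^+ 4 ->
  quartic w y = A x * derive1 (transition w (Z x)) (w y) ^+ 4.
Proof.
move=> c Sx Sy d dx e; have [_ dy] := ZP Sy.
have h := conformal_chart_hol c (confZ Sy) Sy d dy.
have h' := conformal_chart_hol (confZ Sy) (confZ Sx) Sy dy dx.
have [_ k] := transition_chain c.1 (confZ Sy).1 d dy h h'.
by rewrite /quartic e -mulrA -exprMn; congr (_ * _ ^+ 4); exact: esym k.
Qed.

Lemma quartic_near w x : conformal_chart w -> S x -> dom w x -> exists h : C -> C,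
  [/\ hol h (w x), h (w x) != 0 & \forall y \near x, quartic w y = h (w y)].
Proof.
move=> c Sx d; have [dz dd] := ZP Sx; have hT := conformal_chart_hol c (confZ Sx) Sx d dd.
have n0 := conformal_derive_neq0 c (confZ Sx) Sx d dd.
exists (fun t => A x * derive1 (transition w (Z x)) t ^+ 4); split.
- exact: holM (hol_cst (A x) (w x)) (holX 4 (hol_derive1 hT)).
- by apply: mulf_neq0; [rewrite -nm_gt0 A1 //; exact: ltr01|exact: expf_neq0 n0].
- apply: filterS3 (AZ Sx) (near_dom_S dz dd) (chart_dom_near c.1 d) => y e [dy Sy] wy.
  exact: quartic_dev c Sx Sy wy dy e.
Qed.

Lemma quartic_lam w x la : is_chart w -> (forall y, S y -> dom w y -> 0 < la y /\ conformal_at g w la y) ->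
  S x -> dom w x -> Num.sqrt (nm (quartic w x)) = la x.
Proof.
move=> cw H Sx d; have [dz dd] := ZP Sx; have [cz _ _] := dz.
have [l m] := H x Sx d; have [l' m'] := dev_conformal oS cov dz Sx dd.
have [p [hp ->]] := conformal_transition cov cw cz Sx d dd l l' m m'.
rewrite mul1r /quartic /drot (cder_derive1 hp) nmM (A1 Sx) mul1r nmX.
rewrite (_ : 4%N = (2 * 2)%N) // exprM sqrtr_sqr.
by rewrite ger0_norm ?exprn_ge0 ?nm_ge0 // nm_sqr.
Qed.

(* Off the cone point the quotient of [q] by [z^m] is holomorphic of modulus one,
   hence constant. *)
Lemma quartic_cone w p (m : int) : is_chart w -> dom w p -> w p = 0 -> dom w `\ p `<=` S ->
  ~ S p ->
  (forall y, S y -> dom w y -> [/\ w y != 0, 0 < powR (sqmod (w y)) ((m + 4)%:~R / 4 - 1) &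
      conformal_at g w (fun y => powR (sqmod (w y)) ((m + 4)%:~R / 4 - 1)) y]) ->
  exists K, K != 0 /\ \forall y \near p, y != p -> quartic w y = w y ^ m * K.
Proof.
move=> cw d wp wS Sp H; pose la y := powR (sqmod (w y)) ((m + 4)%:~R / 4 - 1).
have Hla y : S y -> dom w y -> 0 < la y /\ conformal_at g w la y by move=> Sy dy; have [] := H y Sy dy.
have cc : conformal_chart w by split; [exact: cw|exists la].
have := icoord_near cw d (chart_dom_near cw d); rewrite wp => /nbhsCP[e e0 E].
pose f t := quartic w (icoord w t) / t ^ m.
have inS t : t != 0 -> nm t < e -> S (icoord w t) /\ dom w (icoord w t) /\ w (icoord w t) = t.
  move=> t0 te; have [|k1 k2 _] := E t; first by rewrite subr0.
  split; [apply: wS; split=> //= ep|by split].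
  by move: t0; rewrite -k2 ep wp eqxx.
have f1 t : t != 0 -> nm t < e -> nm (f t) = 1.
  move=> t0 te; have [k1 [k2 k3]] := inS t t0 te.
  have l := quartic_lam cw Hla k1 k2; have l' := sqrt_nm_cone 1 m t0.
  have s1 : sqmod (1 : C) = 1 by rewrite -nm_sqr nm1 expr1n.
  rewrite expr1n mul1r s1 mulr1 in l'; rewrite /la k3 -l' in l.
  have nE : nm (quartic w (icoord w t)) = nm (t ^ m).
    by apply/eqP; rewrite -eqr_sqrt ?nm_ge0 // l.
  rewrite /f nmM nmV nE mulfV // gt_eqF // nm_gt0; exact: expfz_neq0.
have fl t : t != 0 -> nm t < e -> \forall s \near t, f s = f t.
  move=> t0 te; have [k1 [k2 k3]] := inS t t0 te.
  have [h [hh _ nh]] := quartic_near cc k1 k2; rewrite k3 in hh.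
  have hf : hol f t.
    apply: (@hol_near _ (fun s => h s * (s ^ m)^-1)); last first.
      by apply: holM hh (holV (hol_expz m (hol_id t) t0) _); exact: expfz_neq0.
    have := icoord_near cw k2 nh; rewrite k3; apply: filterS => s [_ q1 q2].
    by rewrite /f q2 q1.
  apply: (unimodular_near_cst hf _ ltr01).
  have n1 : \forall s \near t, nm s < e.
    apply/nbhsCP; exists (e - nm t); first lra.
    by move=> s st; have := nmD (s - t) t; rewrite subrK; lra.
  have n2 := near_neq0 (hol_continuous (hol_id t)) t0.
  by apply: filterS2 n1 n2 => s s1 s2; exact: f1.
have [K KP] := punctured_cst e0 fl; have e2 : 0 < e / 2 by exact: half_pos.
have nK : nm K = 1.
  have nme : nm (e / 2)%:C = e / 2 by rewrite nmR ger0_norm // ltW.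
  have t0 : (e / 2)%:C != 0 :> C by rewrite -nm_gt0 nme.
  have te : nm (e / 2)%:C < e by rewrite nme; lra.
  by rewrite -(KP _ t0 te); exact: f1.
exists K; split; first by rewrite -nm_gt0 nK; exact: ltr01.
have nb : \forall y \near p, nm (w y) < e.
  have := chart_near cw d (nm_ball (w p) e0); apply: filterS => y.
  by rewrite wp subr0.
apply: filterS2 nb (chart_dom_near cw d) => y ye dy yp.
have Sy : S y by apply: wS; split=> //= /eqP; rewrite (negbTE yp).
have [w0 _ _] := H y Sy dy; have := KP _ w0 ye.
rewrite /f (chart_icoordK cw dy) => <-; rewrite mulrC divfK //; exact: expfz_neq0.
Qed.

End ConformalCharts.

Section FlatPart.
Context {R : realType} {M : topologicalType}.
Local Notation C := R[i].

(** The hypothesis on the values of chi makes the fourth power of [dev_sys] a local system without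
    monodromy, which has a nonvanishing global section. *)
Lemma quartic_section (S : set M) (g : metric R M) (Z : M -> chart R M) chi :
  open S -> covered S g -> (forall x, S x -> developing_chart S g (Z x) /\ dom (Z x) x) ->
  rotational_holonomy S g chi -> valued_in_mu4 S chi ->
  exists A : M -> C, (forall x, S x -> nm (A x) = 1) /\
    forall x, S x -> \forall y \near x, A y = A x * dev_sys Z x y ^+ 4.
Proof.
move=> oS cov ZP [_ hol_chi] mu; have L := dev_sys_local oS cov ZP.
pose th x y := dev_sys Z x y ^+ 4.
have L4 : local_system S th.
  move=> x /L; apply: filterS => y [n0 n]; split; first exact: expf_neq0.
  by apply: filterS n => z e; rewrite /th e exprMn.
have [] := global_section L4.
- move=> x Sx; apply: filterS (dev_sys_conn oS cov ZP Sx) => y [p [sp p0 p1 h]].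
  by exists p; split=> //; have := PT_exp 4 h; rewrite expr1n.
- move=> ga be lg h; have [sp _] := lg.
  have /(rotation_along_PT oS cov ZP _ lg) r := hol_chi ga lg.
  have := PT_exp 4 r; rewrite expr1n (mu _ (single_cycle lg)) => h'.
  apply: (PT_unique L4 (simplex1_cont sp) ler01 _ h h') => t _.
  exact: simplex1_S sp.
(* Rotations have modulus one, so |A| is locally constant and dividing by it keeps the section
   parallel. With |A| = 1 the metric of A (dz)^4 is g itself and not a multiple of it. *)
move=> A HA; exists (fun x => A x * ((nm (A x))^-1)%:C); split.
  move=> x Sx; have [n0 _] := HA x Sx; rewrite nmM nmR.
  by rewrite ger0_norm ?invr_ge0 ?nm_ge0 // mulfV // gt_eqF // nm_gt0.
move=> x Sx; have [n0 n] := HA x Sx; have [dz dd] := ZP x Sx.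
apply: filterS2 n (near_dom_S dz dd) => y e [dy Sy]; have [dz' dd'] := ZP y Sy.
have [r1 _] := dev_affine oS cov dz dz' dy dd'.
have nE : nm (A y) = nm (A x) by rewrite e nmM nmX -/(dev_sys Z x y) /dev_sys r1 expr1n mulr1.
by rewrite nE e mulrAC.
Qed.

Lemma flat_part (O : set (chart R M)) n (c : 'I_n -> M) (g : metric R M) theta :
  closed_oriented_surface O -> injective c -> quarter_flat_cone_metric O c g theta ->
  exists X (q : chart R M -> M -> C) (m : 'I_n -> int),
    [/\ complex_structure O X,
        meromorphic_section 4 X q (divisor c m) /\ (forall i, -4 < m i),
        same_metric (~` range c) g (abs_sqrt_metric X q),
        forall i, theta i = (m i + 4)%:~R * (pi / 2) &
        forall chi, rotational_holonomy (~` range c) g chi <->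
          fourth_root_monodromy (~` range c) X q chi].
Proof.
move=> [H _ _ _ [Oc _ _]] inj [[[[[gc gcov _] Og _ _ _] fl] cone] /choice[k kE] [chi hchi mu]].
set S := ~` range c in gc gcov Og fl cone chi hchi mu *.
have oS : open S := cone_points_open c H.
have cov : covered S g by split.
have Sc i : ~ S (c i) by apply; exists i.
have Scase x : S x \/ exists i, x = c i.
  by have [Sx|/contrapT[i _ <-]] := pselect (S x); [left|right; exists i].
have /choice[Z0 HZ0] : forall x, exists z, S x -> developing_chart S g z /\ dom z x.
  move=> x; have [Sx|nS] := pselect (S x); first by have [z h1 h2] := fl x Sx; exists z.
  by exists (Chart set0 (fun=> 0) (fun=> x)).
have [A [A1 AZ]] := quartic_section oS cov HZ0 hchi mu.
have th0 i : 0 < theta i by have [] := cone i.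
have /choice[w wP] : forall i, exists w, [/\ is_chart w, dom w (c i), w (c i) = 0,
    dom w `\ c i `<=` S & metric_in_coordinate S g w (fun x v => cone_sqlen (theta i) (w x) v)].
  by move=> i; have [_] := cone i.
pose b i := theta i / (2 * pi).
pose ze i := comp_chart (w i) (dom (w i)) (radV (b i)) (rad (b i)^-1 (b i)).
pose m i := k i - 4.
have mk i : m i + 4 = k i by rewrite /m subrK.
have bE i : b i = (m i + 4)%:~R / 4 by rewrite mk /b kE cone_angle.
have zeP i : [/\ is_chart (ze i), ze i (c i) = 0 &
   forall x, S x -> dom (ze i) x -> [/\ ze i x != 0,
     0 < powR (sqmod (ze i x)) ((m i + 4)%:~R / 4 - 1) &
     conformal_at g (ze i) (fun y => powR (sqmod (ze i y)) ((m i + 4)%:~R / 4 - 1)) x]].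
  have [h1 h2 h3 h4 h5] := wP i.
  have [k1 k2 k3] := conformal_of_cone oS cov h1 h2 h3 (th0 i) h4 (@Sc i) h5.
  split; [exact: k1|exact: k2|move=> x Sx dx].
  have [l1 _ l2] := k3 x Sx dx; rewrite -bE; split; [exact: l1| |exact: l2].
  by rewrite powR_gt0 // sqmod_gt0.
have dze i : dom (ze i) (c i) by have [] := wP i.
have dzeS i : dom (ze i) `\ c i `<=` S by have [] := wP i.
have conf_ze i : conformal_chart S g (ze i).
  have [k1 _ k3] := zeP i; split; first exact: k1.
  exists (fun y => powR (sqmod (ze i y)) ((m i + 4)%:~R / 4 - 1)) => y Sy dy.
  by have [] := k3 y Sy dy.
(* All developing charts, which avoid the cone points, and one conformal chart at each cone
   point. *)
pose X : set (chart R M) := [set z | developing_chart S g z \/ exists i, z = ze i].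
have confX z : X z -> conformal_chart S g z.
  by move=> [dz|[i ->]]; [exact: (dev_conformal_chart oS cov dz)|exact: conf_ze].
(* No compatibility has to be checked at a cone point except that of [ze i] with itself, where the
   transition is the identity. *)
have X_cone z i : X z -> dom z (c i) -> z = ze i.
  move=> [[_ zS _] /zS /Sc //|[j ->] d]; have [->//|ij] := eqVneq j i.
  have : S (c i) by apply: (dzeS j); split; [exact: d|move=> /inj e; rewrite e eqxx in ij].
  by move=> /Sc.
have /choice[K KP] : forall i, exists K, K != 0 /\
    \forall y \near c i, y != c i -> quartic Z0 A (ze i) y = ze i y ^ m i * K.
  move=> i; have [k1 k2 k3] := zeP i.
  exact: (quartic_cone oS cov HZ0 A1 AZ k1 (dze i) k2 (@dzeS i) (@Sc i) k3).
(* At [c i] the value is K i if m i = 0, and 0 at a zero or a pole; for negative exponents this is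
   the convention 0^-1 = 0 of [meromorphic_section]. *)
pose q (z : chart R M) x := if `[< S x >] then quartic Z0 A z x
  else \sum_(i | c i == x) (0 : C) ^ m i * K i.
have qS z x : S x -> q z x = quartic Z0 A z x by move=> Sx; rewrite /q asboolT.
have qc z i : q z (c i) = 0 ^ m i * K i.
  rewrite /q asboolF; last exact: Sc.
  by rewrite (big_pred1 i) // => j; rewrite /= (inj_eq inj).
have Xh z z' x : X z -> X z' -> dom z x -> dom z' x -> hol (transition z z') (z x).
  move=> Xz Xz' d d'; have [Sx|[i e]] := Scase x.
    exact: (conformal_chart_hol oS cov (confX _ Xz) (confX _ Xz') Sx d d').
  rewrite e in d d' *; rewrite (X_cone _ _ Xz d) (X_cone _ _ Xz' d').
  exact: hol_near (transition_id (conf_ze i).1 (dze i)) (hol_id _).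
have Xx x : exists2 z, X z & dom z x.
  have [Sx|[i ->]] := Scase x; last by exists (ze i) => //; right; exists i.
  by have [z h1 h2] := fl x Sx; exists z => //; left.
have Xc z : X z -> is_chart z by move=> /confX[].
have law : differential_law 4 X setT q.
  move=> z z' x Xz Xz' [[d d'] _]; have [Sx|[i e]] := Scase x.
    rewrite (qS z x Sx) (qS z' x Sx).
    exact: (quartic_law oS cov HZ0 A (confX _ Xz) (confX _ Xz') Sx d d').
  rewrite e in d d' *; rewrite (X_cone _ _ Xz d) (X_cone _ _ Xz' d') !qc.
  have h := rd_near (transition_id (conf_ze i).1 (dze i)) (cder_id _).
  by rewrite (cder_derive1 h) expr1n mulr1.
exists X, q, m; split.
- split; first split.
  + exact: Xc.
  + by move=> x _; exact: Xx.
  + by move=> z z' Xz Xz' x [d d']; apply/holP; exact: Xh.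
  move=> o z Oo Xz x [[d d'] _]; have co := Oc _ Oo.
  have or y : S y -> dom o y -> dom z y -> orientation_preserving_at (transition o z) (o y).
    move=> Sy dy dy'; have [phi gp dp] := gcov y Sy.
    exact: (conformal_orient cov co gp (Og _ _ Oo gp) (confX _ Xz) Sy dy dp dy').
  have [Sx|[i e]] := Scase x; first exact: or.
  rewrite e in d d' *; apply: (orient_at_isolated co (Xc _ Xz) d d') => y dy dy' yc.
  apply: or => //; rewrite (X_cone _ _ Xz d') in dy'; apply: (dzeS i); split=> //= yE.
  by rewrite yE eqxx in yc.
- split; last by move=> i; have := th0 i; rewrite kE -mk pmulr_lgt0 ?divr_gt0 ?pi_gt0 // ltr0z; lia.
  split; first exact: law.
  move=> z p Xz d; have [Sp|[i e]] := Scase p.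
    have [h [h1 h2 h3]] := quartic_near oS cov HZ0 A1 AZ (confX _ Xz) Sp d.
    exists h; split; [exact/holP|exact: h2|].
    rewrite (divisor_off m Sp); have nS : \forall y \near p, S y by exact: open_nbhs_nbhs.
    by apply: filterS2 h3 nS => y e Sy; rewrite (qS z y Sy) expr0z mul1r.
  rewrite e in d *; rewrite (X_cone _ _ Xz d); have [K0 KN] := KP i; have [_ z0 _] := zeP i.
  exists (fun=> K i); split; [apply/holP; exact: hol_cst|exact: K0|].
  rewrite (divisor_at m i inj) z0; apply: filterS2 KN (chart_dom_near (conf_ze i).1 (dze i)).
  move=> y Ky dy; rewrite subr0; have [->|yc] := eqVneq y (c i); first by rewrite qc z0.
  rewrite qS; first exact: Ky.
  by apply: (dzeS i); split=> //= yE; rewrite yE eqxx in yc.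
- move=> psi Xp; apply/(metric_in_coordinateP _ oS (Xc _ Xp) gc) => x d Sx phi gp dp.
  have [cp [la Hla]] := confX _ Xp; have [_ mi] := Hla x Sx d; have [s e] := mi phi gp dp.
  split; [exact: s|move=> v; rewrite e abs_sqlen; congr (_ * _)].
  rewrite /lam (qS psi x Sx); exact: (esym (quartic_lam oS cov HZ0 A1 cp Hla Sx d)).
- by move=> i; rewrite mk; exact: kE.
move=> chi'.
(* The comparison of holonomy and monodromy requires q = A x (dz)^4, with a constant coefficient, on
   the whole domain of the chart chosen at x; hence the restriction to D x. *)
have /choice[D HD] : forall x, exists D, S x -> [/\ open D, D `<=` dom (Z0 x), D x &
    forall y, D y -> A y = A x * dev_sys Z0 x y ^+ 4].
  move=> x; have [Sx|nS] := pselect (S x); last by exists set0.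
  have [[cz _ _] dd] := HZ0 x Sx.
  by have [D HD] := open_restrict cz dd (AZ x Sx); exists D.
pose Z x := comp_chart (Z0 x) (D x) id id.
have ZP x : S x -> developing_chart S g (Z x) /\ dom (Z x) x.
  move=> Sx; have [h1 h2 h3 _] := HD x Sx; have [dz _] := HZ0 x Sx.
  by split; [exact: (restrict_dev oS cov dz h1 h2)|exact: h3].
have A0 x : S x -> A x != 0 by move=> Sx; rewrite -nm_gt0 A1.
apply: (holonomy_monodromy oS cov ZP Xc Xx Xh A0) => x z y Sx Xz dz Dy.
have [h1 h2 h3 h4] := HD x Sx; have [dv _] := HZ0 x Sx; have [_ zS _] := dv.
have dy := h2 _ Dy; have Sy := zS _ dy; have cv := dev_conformal_chart oS cov dv.
split.
- exact: (conformal_chart_hol oS cov (confX _ Xz) cv Sy dz dy).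
- exact: (conformal_derive_neq0 oS cov (confX _ Xz) cv Sy dz dy).
- rewrite (qS z y Sy); exact: (quartic_dev oS cov HZ0 (confX _ Xz) Sx Sy dz dy (h4 y Dy)).
Qed.

End FlatPart.

Theorem lemma2p5 (R : realType) (M : topologicalType) (O : set (chart R M))
    (n : nat) (c : 'I_n -> M)
    (M_surface : closed_oriented_surface O) (c_inj : injective c) :
  (forall (g : metric R M) (theta : 'I_n -> R),
     quarter_flat_cone_metric O c g theta ->
     exists (X : set (chart R M)) (q : chart R M -> M -> R[i])
         (m : 'I_n -> int),
       [/\ complex_structure O X,
           meromorphic_section 4 X q (divisor c m)
             /\ (forall i, -4 < m i),
           same_metric (~` range c) g (abs_sqrt_metric X q),
           forall i, theta i = (m i + 4)%:~R * (pi / 2) &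
           forall chi, rotational_holonomy (~` range c) g chi <->
             fourth_root_monodromy (~` range c) X q chi])
  /\
  (forall (X : set (chart R M)) (q : chart R M -> M -> R[i]) (m : 'I_n -> int),
     complex_structure O X ->
     meromorphic_section 4 X q (divisor c m) ->
     (forall i, -4 < m i) ->
     quarter_flat_cone_metric O c (abs_sqrt_metric X q)
       (fun i => (m i + 4)%:~R * (pi / 2))
     /\ (forall chi,
           rotational_holonomy (~` range c) (abs_sqrt_metric X q) chi <->
           fourth_root_monodromy (~` range c) X q chi)).
Proof.
have [H _ _ _ _] := M_surface; split; first by move=> g theta; exact: flat_part.
by move=> X q m; exact: quartic_part.
Qed.
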